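(* Let $n$ be a positive integer and $N=n^2-n+1$. Let $p,\bar p,\tilde p$ be primes, none of which divides $N$, such that $\bar p\equiv p\pmod N$ and $\tilde p\equiv p^{-1}\pmod N$ (where $p^{-1}$ is an inverse of $p$ modulo $N$). Then $$a(\mathcal{H}_n^{(p)})=a(\mathcal{H}_n^{(\bar p)})=a(\mathcal{H}_n^{(\tilde p)}).$$
   Context: For a positive integer $n$ and a prime $\ell$, $\mathcal{H}_n^{(\ell)}$ denotes the Hurwitz function field $K(S,T)$ with $S^nT+T^n+S=0$, where $K$ is an algebraically closed field of characteristic $\ell$. Cartier operator: let $F/K$ be a function field over a perfect field $K$ of characteristic $\ell>0$ and let $t$ be a separating element. Every differential $\omega$ of $F/K$ can be written uniquely as $\omega=(x_0^\ell+x_1^\ell t+\cdots+x_{\ell-1}^\ell t^{\ell-1})\,dt$ with $x_i\in F$, and $\mathcal{C}(\omega):=x_{\ell-1}\,dt$; this does not depend on $t$, and $\mathcal{C}$ maps holomorphic differentials to holomorphic differentials. The $a$-number $a(F)$ is the $K$-dimension of the kernel of $\mathcal{C}$ acting on the holomorphic differentials of $F$. *)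

(* Defs.v *)
From HB Require Import structures.
From mathcomp Require Import all_boot all_order all_algebra all_field.

Set Implicit Arguments.
Unset Strict Implicit.
Unset Printing Implicit Defensive.

Import GRing.Theory.
Local Open Scope ring_scope.

(* A function field F/K is given by its structural embedding iota : K -> F.   *)
Section FunctionField.

Variables (K F : fieldType) (iota : {rmorphism K -> F}).

Definition is_subfield (A : F -> Prop) : Prop :=
  [/\ A 1,
      forall x y, A x -> A y -> A (x - y) &
      forall x y, A x -> A y -> A (x / y)].

(* adjoin s z <-> z lies in K(s), the least subfield containing K and s.      *)
Definition adjoin (s : seq F) (z : F) : Prop :=
  forall A : F -> Prop, is_subfield A -> (forall c, A (iota c)) ->
    (forall x, x \in s -> A x) -> A z.

(* F is a separable algebraic extension of K(t).                              *)
Definition separating (t : F) : Prop :=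
  forall z : F, exists g : {poly F},
    [/\ forall i, adjoin [:: t] g`_i, separable_poly g & root g z].

(* Valuation rings of F/K; these correspond bijectively to the places.        *)
Definition valuation_ring (O : F -> Prop) : Prop :=
  [/\ forall c, O (iota c),
      forall x y, O x -> O y -> O (x - y),
      forall x y, O x -> O y -> O (x * y),
      exists z, ~ O z &
      forall z, z != 0 -> O z \/ O z^-1].

Definition maximal_ideal (O : F -> Prop) (x : F) : Prop :=
  O x /\ (x = 0 \/ ~ O x^-1).

Definition uniformizer (O : F -> Prop) (t : F) : Prop :=
  forall x, maximal_ideal O x <-> exists2 u, O u & x = t * u.

Definition derivation (M : lmodType F) (D : F -> M) : Prop :=
  [/\ forall c, D (iota c) = 0,
      forall x y, D (x + y) = D x + D y &
      forall x y, D (x * y) = x *: D y + y *: D x].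

(* (Om, d) is the module of Kaehler differentials of F/K. Uniqueness of the   *)
(* factorization through d is expressed by Om being generated by d F.         *)
Definition kaehler (Om : lmodType F) (d : F -> Om) : Prop :=
  [/\ derivation d,
      forall w : Om, exists m (u z : 'I_m -> F),
        w = \sum_(i < m) u i *: d (z i) &
      forall (M : lmodType F) (D : F -> M), derivation D ->
        exists f : {linear Om -> M}, forall z, f (d z) = D z].

Section Differentials.

Variables (Om : lmodType F) (d : F -> Om).

(* v_P(w) >= 0 at every place P, where v_P(u dt) = v_P(u) when v_P(t) = 1.    *)
Definition holomorphic (w : Om) : Prop :=
  forall O, valuation_ring O ->
    exists t u, [/\ uniformizer O t, O u & w = u *: d t].

(* The graph of the Cartier operator in characteristic l: cartier l w v       *)
(* means C(w) = v.                                                            *)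
Definition cartier (l : nat) (w v : Om) : Prop :=
  exists (t : F) (x : nat -> F),
    [/\ separating t,
        w = (\sum_(i < l) x i ^+ l * t ^+ i) *: d t &
        v = x l.-1 *: d t].

Definition holomorphic_cartier_kernel (l : nat) (w : Om) : Prop :=
  holomorphic w /\ cartier l w 0.

(* The K-subspace V of Om has a K-basis with r elements.                      *)
Definition has_dimension (V : Om -> Prop) (r : nat) : Prop :=
  exists b : 'I_r -> Om,
    [/\ forall i, V (b i),
        forall w, V w -> exists c : 'I_r -> K,
          w = \sum_(i < r) iota (c i) *: b i &
        forall c : 'I_r -> K,
          \sum_(i < r) iota (c i) *: b i = 0 -> forall i, c i = 0].

End Differentials.

(* The a-number of F/K, in characteristic l, is the natural number a. The     *)
(* choice of (Om, d) is irrelevant: it is unique up to unique isomorphism.    *)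
Definition is_a_number (l a : nat) : Prop :=
  exists (Om : lmodType F) (d : F -> Om),
    kaehler d /\ has_dimension (holomorphic_cartier_kernel d l) a.

End FunctionField.

(* The function field K(S, T) with S^n T + T^n + S = 0. As T^n + S^n T + S is *)
(* irreducible over the rational function field K(S), these conditions        *)
(* determine (F, S, T) up to unique K-isomorphism.                            *)
Record hurwitzField (n : nat) (K : fieldType) := HurwitzField {
  hurwitz_field :> fieldType;
  hurwitz_iota : {rmorphism K -> hurwitz_field};
  hurwitz_S : hurwitz_field;
  hurwitz_T : hurwitz_field;
  hurwitz_transcendental : ~ algebraicOver hurwitz_iota hurwitz_S;
  hurwitz_generated : forall z, adjoin hurwitz_iota [:: hurwitz_S; hurwitz_T] z;
  hurwitz_equation : hurwitz_S ^+ n * hurwitz_T + hurwitz_T ^+ n + hurwitz_S = 0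
}.

(* Main.v *)
(* Write n = m + 1, x = S^m T and N = m (m + 1) + 1 = n^2 - n + 1.  The curve
   gives 1 + x = - T^n / S and S^N (1 + x) = - x^n, so F is a Kummer extension
   of K(x) of degree N.  Comparing orders at the three vertices of the projective
   model, which the cyclic symmetry permutes and where the orders of the Kummer
   components of a form are distinct, the holomorphic forms are spanned by
   S^i T^j dS / fT with i + j < m, where fT = S^n + n T^m.

   Give such a form the weight n i + j + 1 modulo N; weights of distinct forms
   are distinct.  The Cartier operator in characteristic l maps each of these
   forms to a scalar multiple of another one or to 0, and the image is nonzero
   if and only if there is a form of weight e' with l e' = e, e being the weight
   of the given one.  Hence the a-number is the number of weights in the
   triangle that are not in l times the set of weights.  This number depends
   only on l mod N, and multiplication by l shows that it is the same for
   l^-1. *)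

From HB Require Import structures.
Require Import Defs.
From mathcomp Require Import all_boot all_order all_algebra all_field.
From mathcomp Require Import ring zify.
From Stdlib Require Import Classical ClassicalEpsilon.

Set Implicit Arguments.
Unset Strict Implicit.
Unset Printing Implicit Defensive.

Import Order.TTheory GRing.Theory Num.Theory.
Local Open Scope ring_scope.

(** * Bivariate polynomials and the Hurwitz polynomial *)

(** With the generator dS / fT fixed, the module of differentials is F itself and d becomes a
    Hamiltonian derivation D. Places are arbitrary valuation rings, so each of them is first shown
    to contain the coordinates of one of the three affine charts, and then to be the local ring of a
    point of that chart.

    The reason behind the criterion for a nonzero image: put B = T^n / S = -(1 + x). Then dx is N
    S^m B times dS / fT, and a monomial form equals N^-1 M^l x^al B^be dx with M a Laurent monomial
    in S, T and al, be < l. Its image is governed by the coefficient of x^(l-1) in x^al (-1-x)^be,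
    which is a binomial coefficient up to sign and is nonzero exactly when al + be >= l - 1. That
    inequality is then matched with the condition on weights.

    The definition of the Cartier operator allows any separating t. The kernel is therefore tested
    without t: a form in it is exact, and (d/dx)^(l-1) annihilates exact forms because (d/dx)^l = 0.
    Conversely t = x exhibits forms of the kernel, which requires that x be separating. *)

Section BivariateEvaluation.

Variables (K R : comNzRingType) (phi : {rmorphism K -> R}) (s t : R).

(* Opaque, so that neither simplification nor unification unfolds it. *)
Lemma ev1_subproof : {g : {rmorphism {poly K} -> R} |
  forall p, g p = (map_poly phi p).[s]}.
Proof.
by exists (GRing.RMorphism.clone _ _ (horner_morph (fun c => mulrC s (phi c))) _).
Qed.

Definition ev1 := sval ev1_subproof.

Lemma ev1E p : ev1 p = (map_poly phi p).[s].
Proof. exact: (svalP ev1_subproof). Qed.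

Lemma ev1C c : ev1 c%:P = phi c.
Proof. by rewrite ev1E map_polyC hornerC. Qed.

Lemma ev1X : ev1 'X = s.
Proof. by rewrite ev1E map_polyX hornerX. Qed.

Lemma ev2_subproof : {g : {rmorphism {poly {poly K}} -> R} |
  forall P, g P = (map_poly ev1 P).[t]}.
Proof.
by exists (GRing.RMorphism.clone _ _ (horner_morph (fun p => mulrC t (ev1 p))) _).
Qed.

Definition ev2 := sval ev2_subproof.

Lemma ev2E P : ev2 P = (map_poly ev1 P).[t].
Proof. exact: (svalP ev2_subproof). Qed.

Lemma ev2C p : ev2 p%:P = ev1 p.
Proof. by rewrite ev2E map_polyC hornerC. Qed.

Lemma ev2X : ev2 'X = t.
Proof. by rewrite ev2E map_polyX hornerX. Qed.

Definition evE := (ev1C, ev1X, ev2C, ev2X).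

End BivariateEvaluation.

Section Partials.

Variable K : comNzRingType.
Implicit Types P Q : {poly {poly K}}.

Definition derX P : {poly {poly K}} := map_poly (deriv (R := K)) P.

Lemma derXD P Q : derX (P + Q) = derX P + derX Q.
Proof. exact: raddfD. Qed.

Lemma derXB P Q : derX (P - Q) = derX P - derX Q.
Proof. exact: raddfB. Qed.

Lemma derXM P Q : derX (P * Q) = derX P * Q + P * derX Q.
Proof.
apply/polyP => i; rewrite coefD !coefM coef_map coefM raddf_sum -big_split.
by apply: eq_bigr => j _; rewrite /= derivM !coef_map.
Qed.

Lemma derXC p : derX p%:P = p^`()%:P.
Proof. exact: map_polyC. Qed.

Lemma derX_X : derX 'X = 0.
Proof. by apply/polyP => i; rewrite coef_map coefX coef0 raddfMn /= derivC mul0rn. Qed.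

Lemma derX_Xn k : derX 'X^k = 0.
Proof.
elim: k => [|k IH]; first by rewrite expr0 -[1]/(1%:P%:P) derXC derivC.
by rewrite exprS derXM derX_X IH mul0r mulr0 addr0.
Qed.

(** Division by Y - b, then division of the remainder by X - a. It provides generators of the
    maximal ideal at a point and, applied to the curve equation, its gradient there. *)
Lemma taylor2 P (a b : K) : exists c P1 P2,
  P = c%:P%:P + ('X - a%:P)%:P * P1 + ('X - b%:P%:P) * P2.
Proof.
have [P2 eP2]: exists P2, P - P.[b%:P]%:P = P2 * ('X - b%:P%:P).
  by apply/factor_theorem; rewrite /root !hornerE subrr.
have [p1 ep1]: exists p1, P.[b%:P] - P.[b%:P].[a]%:P = p1 * ('X - a%:P).
  by apply/factor_theorem; rewrite /root !hornerE subrr.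
exists P.[b%:P].[a], p1%:P, P2.
rewrite [_ * P2]mulrC -eP2 -polyCM [_ * p1]mulrC -ep1 polyCB.
by rewrite [X in X + _]addrC subrK addrC subrK.
Qed.

End Partials.

Section HurwitzPolynomial.

Variables (K : comNzRingType) (m : nat).

Definition hurwitz_poly : {poly {poly K}} :=
  'X^(m.+1) + ('X^(m.+1))%:P * 'X + 'X%:P.

Lemma hurwitz_polyE (R : comNzRingType) (phi : {rmorphism K -> R}) s t :
  ev2 phi s t hurwitz_poly = s ^+ m.+1 * t + t ^+ m.+1 + s.
Proof. by rewrite !(rmorphD, rmorphM) /= !evE !rmorphXn /= !evE [X in X + s]addrC. Qed.

Lemma hurwitz_poly_derX (R : comNzRingType) (phi : {rmorphism K -> R}) s t :
  ev2 phi s t (derX hurwitz_poly) = m.+1%:R * s ^+ m * t + 1.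
Proof.
rewrite !derXD derXM derX_X mulr0 addr0 !derXC derivX derivXn.
by rewrite derX_Xn add0r rmorphD rmorphM /= !evE rmorph1 rmorphMn rmorphXn /= evE -mulr_natl.
Qed.

Lemma hurwitz_poly_derY (R : comNzRingType) (phi : {rmorphism K -> R}) s t :
  ev2 phi s t hurwitz_poly^`() = s ^+ m.+1 + m.+1%:R * t ^+ m.
Proof.
rewrite /hurwitz_poly !derivD derivM !derivC derivX derivXn mul0r add0r mulr1 addr0 /=.
rewrite rmorphD rmorphMn rmorphXn /= !evE rmorphXn /= evE mulr_natl.
by rewrite addrC.
Qed.

End HurwitzPolynomial.

Lemma size_hurwitz_poly (K : idomainType) m : size (hurwitz_poly K m) = m.+2.
Proof.
case: m => [|m]; rewrite /hurwitz_poly.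
  rewrite !expr1 -[X in X + _ + _]mul1r -mulrDl size_MXaddC -polyC1 -polyCD.
  by rewrite polyC_eq0 size_polyC addrC -size_poly_eq0 size_XaddC.
rewrite -addrA size_polyDl size_polyXn // size_MXaddC.
by case: ifP => // _; rewrite ltnS (leq_ltn_trans (size_polyC_leq1 _)).
Qed.

Lemma hurwitz_poly_neq0 (K : idomainType) m : hurwitz_poly K m != 0.
Proof. by rewrite -size_poly_eq0 size_hurwitz_poly. Qed.

Lemma map_horner_eval0 (K : fieldType) (a : K) (Q : {poly {poly K}}) :
  map_poly (horner_eval a) Q = 0 -> exists Q', Q = ('X - a%:P)%:P * Q'.
Proof.
move=> Qa; exists (map_poly (fun p => p %/ ('X - a%:P)) Q).
apply/polyP => i; rewrite coefCM coef_map_id0 ?div0p // mulrC divpK //.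
rewrite dvdp_XsubCl rootE; have := congr1 (fun p : {poly K} => p`_i) Qa.
by rewrite coef_map coef0 /= horner_evalE => ->.
Qed.

(* Gauss's lemma; the first hypothesis says that f is primitive. *)
Lemma primitive_dvd (K : closedFieldType) (c : {poly K}) (f P Q : {poly {poly K}}) :
  (forall a, map_poly (horner_eval a) f != 0) -> c != 0 -> c%:P * P = Q * f ->
  exists Q', P = Q' * f.
Proof.
move=> prim_f; move: {2}(size c) (leqnn (size c)) => k.
elim: k c Q => [|k IH] c Q; first by rewrite leqn0 size_poly_eq0 => ->.
move=> le_c c0 e.
case: (boolP (size c == 1%N)) => [/size_poly1P[d d0 ec]|sc1].
  exists (d^-1%:P%:P * Q); rewrite -mulrA -e ec mulrA -!polyCM mulVf //.
  by rewrite !polyC1 mul1r.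
have /closed_rootP[a /factor_theorem[c' ec]] := sc1.
have c'0 : c' != 0 by apply: contraNneq c0 => c'0; rewrite ec c'0 mul0r.
have [Q' eQ] : exists Q', Q = ('X - a%:P)%:P * Q'.
  apply: map_horner_eval0; apply/eqP.
  have: map_poly (horner_eval a) (Q * f) == 0.
    rewrite -e rmorphM /= map_polyC /= horner_evalE ec !hornerE subrr mulr0.
    by rewrite polyC0 mul0r.
  by rewrite rmorphM mulf_eq0 (negPf (prim_f a)) orbF.
apply: (IH c' Q') => //.
  rewrite -ltnS; apply: leq_trans le_c; rewrite ec size_Mmonic ?monicXsubC //.
  by rewrite size_XsubC addn2.
apply: (mulfI (x := ('X - a%:P)%:P)); first by rewrite polyC_eq0 polyXsubC_eq0.
by rewrite !mulrA -polyCM [_ * c']mulrC -ec e eQ.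
Qed.

Lemma hurwitz_poly_primitive (K : closedFieldType) m (a : K) :
  map_poly (horner_eval a) (hurwitz_poly K m) != 0.
Proof.
apply/eqP => /polyP e.
have := e 0%N; have := e m.+1.
rewrite !coef_map !coef0 /= /horner_eval /hurwitz_poly.
rewrite !coefD !coefMX !coefXn !coefC /= addr0 !hornerE => e1 ea.
(* The constant coefficient X forces a = 0, and there the leading coefficient takes the value 1; for
   m = 0 it is 1 + X. *)
move: e1; rewrite eqxx ea.
by case: eqP => [->|_]; rewrite ?expr1 !hornerE /= ?addr0 => /eqP; rewrite oner_eq0.
Qed.

(** Factorizations obtained by pseudo-division carry a factor c in K[X], and reduction modulo X is
    useful only if c is prime to X. Whenever c vanishes at 0, the product h g vanishes modulo X, so
    X can be cancelled against h or g. *)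
Lemma strip_X (K : fieldType) (c : {poly K}) (f g h : {poly {poly K}}) :
  c != 0 -> c%:P * f = h * g -> g != 0 ->
  exists c' g' h', [/\ ~~ root c' 0, c'%:P * f = h' * g' & size g' = size g].
Proof.
move: {2}(size c) (leqnn (size c)) => k.
elim: k c g h => [|k IH] c g h; first by rewrite leqn0 size_poly_eq0 => ->.
move=> le_c c0 e g0.
have [c00|c00] := boolP (root c 0); last by exists c, g, h.
have /factor_theorem[c' ec] := c00.
have c'0 : c' != 0 by apply: contraNneq c0 => c'0; rewrite ec c'0 mul0r.
have le_c' : (size c' <= k)%N.
  rewrite -ltnS; apply: leq_trans le_c; rewrite ec size_Mmonic ?monicXsubC //.
  by rewrite size_XsubC addn2.
have X0 : ('X - 0%:P)%:P != 0 :> {poly {poly K}}.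
  by rewrite polyC_eq0 polyXsubC_eq0.
have: map_poly (horner_eval 0) (h * g) == 0.
  by rewrite -e rmorphM /= map_polyC /= horner_evalE (rootP c00) polyC0 mul0r.
rewrite rmorphM mulf_eq0 => /orP[] /eqP /map_horner_eval0[q eq].
  apply: (IH c' g q) => //; apply: (mulfI X0).
  by rewrite !mulrA -polyCM [_ * c']mulrC -ec e eq.
have q0 : q != 0 by apply: contraNneq g0 => q0; rewrite eq q0 mulr0.
have [//|c'' [g' [h' [H1 H2 H3]]]] := IH c' q h le_c' c'0 _ q0.
  apply: (mulfI X0).
  by rewrite !mulrA -polyCM [_ * c']mulrC -ec e eq mulrCA mulrA.
exists c'', g', h'; split=> //.
by rewrite H3 eq mul_polyC size_scale // polyXsubC_eq0.
Qed.

(* Eisenstein's criterion at 'X. *)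
Lemma hurwitz_poly_irreducible (K : fieldType) m c (g h : {poly {poly K}}) :
  c != 0 -> c%:P * hurwitz_poly K m = h * g -> size g = 1%N \/ size g = m.+2.
Proof.
move=> c0 e; have : g != 0.
  have : c%:P * hurwitz_poly K m != 0.
    by rewrite mulf_neq0 ?polyC_eq0 // hurwitz_poly_neq0.
  by rewrite e; apply: contraNneq => ->; rewrite mulr0.
move=> /(strip_X c0 e)[{}c [{}g [{}h [c00 {}e <-]]]] {c0}.
have c0 : c != 0 by apply: contraNneq c00 => ->; rewrite root0.
have hg0 : h * g != 0.
  by rewrite -e mulf_neq0 ?polyC_eq0 // hurwitz_poly_neq0.
have [h0 g0] : h != 0 /\ g != 0 by move: hg0; rewrite mulf_eq0 negb_or => /andP.
pose at0 := map_poly (horner_eval (0 : K)).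
have f0 : at0 (hurwitz_poly K m) = ('X - 0%:P) ^+ m.+1.
  rewrite subr0 /at0 /hurwitz_poly !(rmorphD, rmorphM) /= map_polyXn !map_polyC map_polyX /=.
  by rewrite /horner_eval !hornerE expr0n polyC0 mul0r !addr0.
have e0 : c.[0] *: ('X - 0%:P) ^+ m.+1 = at0 h * at0 g.
  by rewrite -rmorphM -e rmorphM /= map_polyC /= horner_evalE mul_polyC -f0.
have /dvdp_exp_XsubCP[k _ ek] : at0 g %| ('X - 0%:P) ^+ m.+1.
  by rewrite -(dvdpZr _ _ c00) e0 dvdp_mull.
have /dvdp_exp_XsubCP[j _ ej] : at0 h %| ('X - 0%:P) ^+ m.+1.
  by rewrite -(dvdpZr _ _ c00) e0 dvdp_mulr.
have sk : size (at0 g) = k.+1 by rewrite (eqp_size ek) size_exp_XsubC.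
have sj : size (at0 h) = j.+1 by rewrite (eqp_size ej) size_exp_XsubC.
have skj : (k + j = m.+1)%N.
  have := congr1 (fun p : {poly K} => size p) e0.
  rewrite size_scale // size_exp_XsubC size_mul -?size_poly_eq0 ?sk ?sj //.
  by lia.
have shg : (size h + size g = m.+3)%N.
  rewrite -(prednK (n := (size h + size g))) ?addn_gt0 ?lt0n ?size_poly_eq0 ?h0 //.
  by rewrite -size_mul // -e mul_polyC size_scale // size_hurwitz_poly.
have lg : (k.+1 <= size g)%N by rewrite -sk size_poly.
have lh : (j.+1 <= size h)%N by rewrite -sj size_poly.
have [ {}sk ]: size g = k.+1 by lia.
case: (posnP k) => [k0|k0]; first by left; lia.
case: (posnP j) => [j0|j0]; first by right; lia.
(* With both k and j positive, X divides the constant coefficients of g and h, so X^2 divides the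
   constant coefficient c X of the product, although c is nonzero at 0. *)
have root0 (p : {poly {poly K}}) i : (0 < i)%N -> at0 p %= ('X - 0%:P) ^+ i -> root p`_0 0.
  case: i => // i _ /eqp_root/(_ 0); rewrite root_exp_XsubC eqxx => /rootP.
  by rewrite horner_coef0 coef_map /= horner_evalE => /rootP.
have /factor_theorem[u eu] := root0 g k k0 ek.
have /factor_theorem[v ev] := root0 h j j0 ej.
have := congr1 (fun p : {poly {poly K}} => p`_0) e.
rewrite coefCM coef0M eu ev /hurwitz_poly !coefD coefXn coefMX !coefC /= !add0r subr0.
rewrite mulrA => e1; have ec := mulIf (negbT (polyX_eq0 K)) e1.
by move: c00; rewrite ec !rootM rootX eqxx orbT.
Qed.

Section Evaluation.

Variables (m : nat) (K : closedFieldType) (H : hurwitzField m.+1 K).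
Local Notation F := (hurwitz_field H).
Local Notation iota := (hurwitz_iota H).
Local Notation S := (hurwitz_S H).
Local Notation T := (hurwitz_T H).
Local Notation f := (hurwitz_poly K m).

Definition gen_ev : {rmorphism {poly {poly K}} -> F} := ev2 iota S T.
Local Notation ev := gen_ev.

Lemma ev_C p : ev p%:P = ev1 iota S p. Proof. exact: ev2C. Qed.
Lemma ev_CC c : ev c%:P%:P = iota c. Proof. by rewrite ev_C ev1C. Qed.
Lemma ev_XC : ev 'X%:P = S. Proof. by rewrite ev_C ev1X. Qed.
Lemma ev_X : ev 'X = T. Proof. exact: ev2X. Qed.

Lemma ev1S_eq0 p : (ev1 iota S p == 0) = (p == 0).
Proof.
apply/eqP/eqP => [p0|->]; last exact: rmorph0.
apply/eqP; apply: contra_notT (@hurwitz_transcendental _ _ H) => pn0.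
by exists p => //; apply/rootP; rewrite -ev1E.
Qed.

Lemma ev_hurwitz_poly : ev f = 0.
Proof. by rewrite /gen_ev hurwitz_polyE hurwitz_equation. Qed.

(** The pseudo-remainder of the Hurwitz polynomial by g vanishes at (S, T) as well. Descent on the
    degree ends at a divisor of a multiple c f, and irreducibility leaves only constants, excluded
    by the transcendence of S, and full degree. *)
Lemma ev_size g : g != 0 -> ev g = 0 -> (m.+2 <= size g)%N.
Proof.
move: {2}(size g) (leqnn (size g)) => k.
elim: k g => [|k IH] g le_g g0 evg.
  by move: g0; rewrite -size_poly_leq0 le_g.
have e := Pdiv.Idomain.divp_eq f g.
set c := _ ^+ _ in e; set q := Pdiv.Idomain.divp _ _ in e.
set r := Pdiv.Idomain.modp _ _ in e.
have c0 : c != 0 by rewrite expf_neq0 // lead_coef_eq0.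
have r_lt : (size r < size g)%N by rewrite Pdiv.Idomain.ltn_modp.
have evr : ev r = 0.
  have := congr1 ev e; rewrite -mul_polyC rmorphM /= ev_hurwitz_poly mulr0.
  by rewrite rmorphD rmorphM /= evg mulr0 add0r.
have [r0|r0] := eqVneq r 0; last first.
  apply: leq_trans (ltnW r_lt); apply: IH => //.
  by rewrite -ltnS; apply: leq_trans le_g.
move: e; rewrite r0 addr0 -mul_polyC => e.
have [/eqP/size_poly1P[p p0 eg]|->//] := hurwitz_poly_irreducible c0 e.
by move: evg p0; rewrite eg ev_C => /eqP; rewrite ev1S_eq0 => ->.
Qed.

Lemma ev_eq0_dvd P : ev P = 0 -> exists Q, P = Q * f.
Proof.
move=> evP; have e := Pdiv.Idomain.divp_eq P f.
set c := _ ^+ _ in e; set q := Pdiv.Idomain.divp _ _ in e.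
set r := Pdiv.Idomain.modp _ _ in e.
have c0 : c != 0 by rewrite expf_neq0 // lead_coef_eq0 hurwitz_poly_neq0.
have evr : ev r = 0.
  have := congr1 ev e; rewrite -mul_polyC rmorphM /= evP mulr0.
  by rewrite rmorphD rmorphM /= ev_hurwitz_poly mulr0 add0r.
have r0 : r = 0.
  apply/eqP; apply: contraT => /ev_size/(_ evr).
  by rewrite leqNgt -(size_hurwitz_poly K m) Pdiv.Idomain.ltn_modp hurwitz_poly_neq0.
apply: (primitive_dvd (@hurwitz_poly_primitive K m) c0).
by rewrite mul_polyC e r0 addr0.
Qed.

(** A substitute for the norm: every nonzero element of K[S, T] divides a nonzero polynomial in S.
    The gcd of f and P has degree 0 in Y, since a gcd of full degree would have a cofactor of too
    small a degree that vanishes at (S, T). *)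
Lemma ev_bezout P : ev P != 0 ->
  exists V (g : {poly K}), g != 0 /\ ev V * ev P = ev1 iota S g.
Proof.
move=> evP; have P0 : P != 0 by apply: contraNneq evP => ->; rewrite rmorph0.
pose d := Pdiv.Idomain.gcdp f P.
have d0 : d != 0 by rewrite Pdiv.Idomain.gcdp_eq0 negb_and P0 orbT.
have /Pdiv.Idomain.dvdpP[[/= c1 h] c10 e1] := Pdiv.Idomain.dvdp_gcdl f P.
have /Pdiv.Idomain.dvdpP[[/= c2 q] c20 e2] := Pdiv.Idomain.dvdp_gcdr f P.
have evd : ev d != 0.
  apply/eqP => evd; have := congr1 ev e2.
  rewrite -mul_polyC !rmorphM /= -/d evd mulr0 => /eqP.
  by rewrite mulf_eq0 (negPf evP) orbF ev_C ev1S_eq0 (negPf c20).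
move: e1; rewrite -mul_polyC => e1.
have sd : size d = 1%N.
  have [//|sd] := hurwitz_poly_irreducible c10 e1.
  have h0 : h != 0.
    have : c1%:P * f != 0 by rewrite mulf_neq0 ?polyC_eq0 ?hurwitz_poly_neq0.
    by rewrite e1; apply: contraNneq => ->; rewrite mul0r.
  have : ev h = 0.
    have := congr1 ev e1; rewrite !rmorphM /= ev_hurwitz_poly mulr0 => /esym/eqP.
    by rewrite mulf_eq0 (negPf evd) orbF => /eqP.
  move=> /(ev_size h0); have := congr1 (fun p : {poly {poly K}} => size p) e1.
  rewrite mul_polyC size_scale // size_hurwitz_poly size_mul // -/d sd.
  by move: (size h) => s; lia.
have [[u v] /= euv] := Pdiv.Idomain.Bezoutp f P.
have /Pdiv.Idomain.eqpP[[/= c3 c4] /andP[/= c30 c40] e3] := euv.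
have /eqP/size_poly1P[d' d'0 ed] := sd.
exists (c3%:P * v), (c4 * d'); split; first by rewrite mulf_neq0.
have := congr1 ev e3; rewrite -!mul_polyC -/d ed -polyCM.
rewrite !rmorphM rmorphD !rmorphM /= ev_hurwitz_poly mulr0 add0r mulrA => ->.
by rewrite !ev_C.
Qed.

Lemma ev_frac z : exists P Q, ev Q != 0 /\ z = ev P / ev Q.
Proof.
pose A z := exists P Q, ev Q != 0 /\ z = ev P / ev Q.
suff: A z by [].
have evA P : A (ev P) by exists P, 1; rewrite rmorph1 oner_eq0 divr1.
apply: (hurwitz_generated z) => [|c|x].
- split=> [|x y [P [Q [Q0 ->]]] [P' [Q' [Q'0 ->]]]|x y [P [Q [Q0 ->]]] [P' [Q' [Q'0 ->]]]].
  + by rewrite -(rmorph1 ev).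
  + exists (P * Q' - P' * Q), (Q * Q'); rewrite rmorphM mulf_neq0 //; split=> //.
    by rewrite rmorphB !rmorphM /=; field; apply/andP.
  + have [P'0|P'0] := eqVneq (ev P') 0.
      by exists 0, 1; rewrite rmorph1 oner_eq0 rmorph0 P'0 !mul0r invr0 mulr0.
    exists (P * Q'), (Q * P'); rewrite rmorphM mulf_neq0 //; split=> //.
    by rewrite !rmorphM /= invf_div mulf_div.
- by rewrite -ev_CC; apply: evA.
- rewrite !inE => /orP[] /eqP ->.
    by rewrite -ev_XC; apply: evA.
  by rewrite -ev_X; apply: evA.
Qed.

End Evaluation.

(** * Points of the affine curve *)

(** Write n = m + 1. The expressions s f_s, t f_t and f are linear combinations of s^n t, t^n and s,
    and the determinant of this system is n^2 - n + 1 = N. At a singular point the three monomials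
    would vanish, hence s = t = 0, where f_s = 1. *)
Lemma hurwitz_smooth (R : fieldType) m (s t : R) :
  (m * m.+1).+1%:R != 0 :> R -> s ^+ m.+1 * t + t ^+ m.+1 + s = 0 ->
  m.+1%:R * s ^+ m * t + 1 != 0 \/ s ^+ m.+1 + m.+1%:R * t ^+ m != 0.
Proof.
move=> N0 e; have [fS|] := eqVneq (m.+1%:R * s ^+ m * t + 1) 0; last by left.
have [fT|] := eqVneq (s ^+ m.+1 + m.+1%:R * t ^+ m) 0; last by right.
have e1 : m.+1%:R * (s ^+ m.+1 * t) + s = 0.
  by rewrite -(mulr0 s) -fS exprS; ring.
have e2 : s ^+ m.+1 * t + m.+1%:R * t ^+ m.+1 = 0.
  by rewrite -(mulr0 t) -fT (exprS t); ring.
have e3 : (m * m.+1).+1%:R * (s ^+ m.+1 * t) = 0.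
  transitivity (m.+1%:R * (m.+1%:R * (s ^+ m.+1 * t) + s)
    - m.+1%:R * (s ^+ m.+1 * t + t ^+ m.+1 + s) +
    (s ^+ m.+1 * t + m.+1%:R * t ^+ m.+1)); last by rewrite e1 e e2; ring.
  by rewrite -addn1 natrD natrM -!(addn1 m) !natrD; ring.
have e4 : s ^+ m.+1 * t = 0 by move/eqP: e3; rewrite mulf_eq0 (negPf N0) => /eqP.
have s0 : s = 0 by move: e1; rewrite e4 mulr0 add0r.
move/eqP: e; rewrite e4 s0 add0r addr0 expf_eq0 /= => /eqP t0.
by move/eqP: fS; rewrite t0 mulr0 add0r oner_eq0.
Qed.

Section Point.

Variables (m : nat) (K : closedFieldType) (H : hurwitzField m.+1 K).
Local Notation F := (hurwitz_field H).
Local Notation iota := (hurwitz_iota H).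
Local Notation S := (hurwitz_S H).
Local Notation T := (hurwitz_T H).
Local Notation f := (hurwitz_poly K m).
Local Notation ev := (gen_ev H).

(** Modulo X - s0 the polynomial f(s0, Y) agrees with f, which vanishes at (S, T). *)
Lemma hurwitz_poly_at (s0 : K) : exists W,
  (map_poly iota (map_poly (horner_eval s0) f)).[T] = (S - iota s0) * ev W.
Proof.
pose g := map_poly (horner_eval s0) f.
have [W eW] : exists W, f - map_poly polyC g = ('X - s0%:P)%:P * W.
  apply: map_horner_eval0; apply/polyP => i.
  by rewrite rmorphB /= !(coefB, coef_map, coef0) /= !horner_evalE hornerC subrr.
have evg (q : {poly K}) : ev (map_poly polyC q) = (map_poly iota q).[T].
  elim/poly_ind: q => [|q c IH]; first by rewrite !rmorph0 horner0.
  rewrite 2!rmorphD 2!rmorphM /= IH !map_polyX !map_polyC /=.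
  by rewrite ev_X ev_CC [in RHS]rmorphD rmorphM /= map_polyX map_polyC !hornerE.
exists (- W); have := congr1 ev eW; rewrite rmorphB rmorphM /= ev_hurwitz_poly sub0r evg.
by rewrite ev_C rmorphB /= ev1X ev1C rmorphN mulrN => <-; rewrite opprK.
Qed.

Variables (s0 t0 : K).

Definition point_ev : {rmorphism {poly {poly K}} -> K} := ev2 idfun s0 t0.
Local Notation ev0 := point_ev.

Lemma ev0_CC c : ev0 c%:P%:P = c.
Proof. by rewrite /point_ev (ev2C idfun) (ev1C idfun). Qed.

Lemma ev0_XC : ev0 'X%:P = s0.
Proof. by rewrite /point_ev (ev2C idfun) (ev1X idfun). Qed.

Lemma ev0_X : ev0 'X = t0.
Proof. exact: (ev2X idfun). Qed.

(* z is regular at the point (s0, t0) of the curve, with value c there. *)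
Definition spec (z : F) (c : K) :=
  exists P Q, [/\ ev0 Q != 0, z = ev P / ev Q & c = ev0 P / ev0 Q].

Definition regular_at z := exists c, spec z c.

Hypothesis on_curve : s0 ^+ m.+1 * t0 + t0 ^+ m.+1 + s0 = 0.

Lemma ev_eq0_ev0 P : ev P = 0 -> ev0 P = 0.
Proof.
by move=> /ev_eq0_dvd[Q ->]; rewrite rmorphM /= /point_ev hurwitz_polyE on_curve mulr0.
Qed.

Lemma ev0_neq0_ev P : ev0 P != 0 -> ev P != 0.
Proof. by apply: contra_neq => /ev_eq0_ev0. Qed.

Lemma spec_fun z c c' : spec z c -> spec z c' -> c = c'.
Proof.
move=> [P [Q [Q0 -> ->]]] [P' [Q' [Q'0 e ->]]].
have [evQ evQ'] := (ev0_neq0_ev Q0, ev0_neq0_ev Q'0).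
have /ev_eq0_ev0 : ev (P * Q' - P' * Q) = 0.
  rewrite rmorphB !rmorphM /=; apply/eqP; rewrite subr_eq0.
  by rewrite -eqr_div // e.
rewrite rmorphB !rmorphM /= => /eqP; rewrite subr_eq0 => /eqP e'.
by apply/eqP; rewrite eqr_div // e'.
Qed.

Lemma spec_ev P : spec (ev P) (ev0 P).
Proof. by exists P, 1; rewrite !rmorph1 oner_eq0 !divr1. Qed.

Lemma spec_iota c : spec (iota c) c.
Proof. by have := spec_ev c%:P%:P; rewrite ev_CC ev0_CC. Qed.

Lemma spec_S : spec S s0.
Proof. by have := spec_ev 'X%:P; rewrite ev_XC ev0_XC. Qed.

Lemma spec_T : spec T t0.
Proof. by have := spec_ev 'X; rewrite ev_X ev0_X. Qed.

Lemma specD z c z' c' : spec z c -> spec z' c' -> spec (z + z') (c + c').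
Proof.
move=> [P [Q [Q0 -> ->]]] [P' [Q' [Q'0 -> ->]]].
have [evQ evQ'] := (ev0_neq0_ev Q0, ev0_neq0_ev Q'0).
exists (P * Q' + P' * Q), (Q * Q'); split; first by rewrite rmorphM mulf_neq0.
  by rewrite addf_div // rmorphD !rmorphM.
by rewrite addf_div // rmorphD !rmorphM.
Qed.

Lemma specM z c z' c' : spec z c -> spec z' c' -> spec (z * z') (c * c').
Proof.
move=> [P [Q [Q0 -> ->]]] [P' [Q' [Q'0 -> ->]]].
exists (P * P'), (Q * Q'); split; first by rewrite rmorphM mulf_neq0.
  by rewrite mulf_div !rmorphM.
by rewrite mulf_div !rmorphM.
Qed.

Lemma specN z c : spec z c -> spec (- z) (- c).
Proof.
move=> [P [Q [Q0 -> ->]]].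
by exists (- P), Q; split=> //; rewrite rmorphN /= mulNr.
Qed.

Lemma specB z c z' c' : spec z c -> spec z' c' -> spec (z - z') (c - c').
Proof. by move=> sz /specN; apply: specD. Qed.

Lemma specV z c : spec z c -> c != 0 -> spec z^-1 c^-1.
Proof.
move=> [P [Q [Q0 -> ->]]]; rewrite mulf_eq0 negb_or => /andP[P0 _].
by exists Q, P; split; rewrite ?invf_div.
Qed.

Lemma specX z c k : spec z c -> spec (z ^+ k) (c ^+ k).
Proof.
move=> sz; elim: k => [|k IH]; last by rewrite !exprS; apply: specM.
by rewrite !expr0 -(rmorph1 iota); apply: spec_iota.
Qed.

Lemma spec_sum I (r : seq I) (z : I -> F) (c : I -> K) :
  (forall i, spec (z i) (c i)) -> spec (\sum_(i <- r) z i) (\sum_(i <- r) c i).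
Proof.
move=> sz; elim/big_rec2: _ => [|i c' z' _ IH]; last exact: specD.
by rewrite -(rmorph0 iota); apply: spec_iota.
Qed.

Lemma spec_horner z c (p : {poly K}) :
  spec z c -> spec (map_poly iota p).[z] p.[c].
Proof.
move=> sz; elim/poly_ind: p => [|p a IH].
  by rewrite rmorph0 !horner0 -(rmorph0 iota); apply: spec_iota.
rewrite rmorphD rmorphM /= map_polyX map_polyC !hornerE.
by apply: specD (spec_iota a); apply: specM.
Qed.

(** The finiteness that makes the local ring discrete: z divides some g(S) up to a unit, and g is a
    power of X - s0 times a polynomial that does not vanish at s0. *)
Lemma spec_S_dvd z : z != 0 -> regular_at z ->
  exists r k, regular_at r /\ z * r = (S - iota s0) ^+ k.
Proof.
move=> z0 [_ [P [Q [Q0 ez _]]]]; have evQ := ev0_neq0_ev Q0.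
have evP : ev P != 0 by apply: contra_neq z0 => P0; rewrite ez P0 mul0r.
have [V [g [g0 eV]]] := ev_bezout evP.
have [k [q /implyP/(_ g0) q0 eg]] := multiplicity_XsubC g s0.
have sq := spec_horner q spec_S.
have q0' : (map_poly iota q).[S] != 0.
  apply: contraNneq q0 => qS; rewrite rootE (spec_fun sq (c' := 0)) ?eqxx //.
  by rewrite qS -(rmorph0 iota); apply: spec_iota.
exists (ev Q * ev V * ((map_poly iota q).[S])^-1), k; split.
  eexists; apply: specM (specV sq q0); apply: specM; exact: spec_ev.
apply: (mulIf q0'); rewrite -[LHS]mulrA divfK // mulrA ez divfK //.
by rewrite mulrC eV eg rmorphM /= rmorphXn /= rmorphB /= ev1X ev1C mulrC ev1E.
Qed.

(** S - s0 divides f(s0, T), which is a power of T - t0 times a unit at the point. This carries the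
    previous bound over to the parameter T - t0. *)
Lemma spec_T_dvd : exists r k,
  regular_at r /\ (S - iota s0) * r = (T - iota t0) ^+ k.
Proof.
pose g := map_poly (horner_eval s0) f.
have g0 : g != 0 := hurwitz_poly_primitive _ _.
have [W eW] := hurwitz_poly_at s0.
have [k [q /implyP/(_ g0) q0 eg]] := multiplicity_XsubC g t0.
have sq := spec_horner q spec_T.
have q0' : (map_poly iota q).[T] != 0.
  apply: contraNneq q0 => qT; rewrite rootE (spec_fun sq (c' := 0)) ?eqxx //.
  by rewrite qT -(rmorph0 iota); apply: spec_iota.
exists (ev W * ((map_poly iota q).[T])^-1), k; split.
  eexists; apply: specM (specV sq q0); exact: spec_ev.
apply: (mulIf q0'); rewrite -[LHS]mulrA divfK // -eW -/g eg.
by rewrite rmorphM rmorphXn /= rmorphB /= map_polyX map_polyC !hornerE mulrC.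
Qed.

End Point.

(** * Valuations *)

(* The value of v at 0 is irrelevant. *)
Definition is_valuation (F : fieldType) (R : F -> Prop) (v : F -> int) :=
  (forall a b, a != 0 -> b != 0 -> v (a * b) = v a + v b) /\
  (forall z, z != 0 -> (R z <-> 0 <= v z)).

Section Valuation.

Variables (F : fieldType) (R : F -> Prop).
Hypotheses (R1 : R 1) (RB : forall x y, R x -> R y -> R (x - y)).

Lemma valD_ring x y : R x -> R y -> R (x + y).
Proof.
move=> Rx Ry; rewrite -[y]opprK; apply: RB => //.
by rewrite -sub0r; apply: RB => //; rewrite -(subrr 1); apply: RB.
Qed.

Section Theory.

Variable v : F -> int.
Hypothesis vP : is_valuation R v.

Lemma val_mul a b : a != 0 -> b != 0 -> v (a * b) = v a + v b.
Proof. exact: vP.1. Qed.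

Lemma val1 : v 1 = 0.
Proof.
apply: (addrI (v 1)); rewrite -val_mul ?oner_eq0 //.
by rewrite mul1r addr0.
Qed.

Lemma valV a : a != 0 -> v a^-1 = - v a.
Proof.
move=> a0; apply: (addrI (v a)).
by rewrite -val_mul ?invr_eq0 // mulfV // val1 subrr.
Qed.

Lemma valX a k : a != 0 -> v (a ^+ k) = v a *+ k.
Proof.
move=> a0; elim: k => [|k IH]; first by rewrite expr0 val1.
by rewrite exprS val_mul ?expf_neq0 // IH mulrS.
Qed.

Lemma valXz a (k : int) : a != 0 -> v (a ^ k) = v a * k.
Proof.
move=> a0; case: k => k.
  by rewrite -exprnP valX // pmulrn -mulrzr intz.
by rewrite NegzE -exprnN valV ?expf_neq0 // valX // mulrN pmulrn -mulrzr intz.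
Qed.

Lemma val_unit a : a != 0 -> R a -> R a^-1 -> v a = 0.
Proof.
have [_ vR] := vP; move=> a0 /(vR _ a0) va; have a'0 : a^-1 != 0 by rewrite invr_eq0.
move=> /(vR _ a'0); rewrite valV // => va'.
by apply/eqP; rewrite eq_le va andbT -oppr_ge0.
Qed.

Definition val_ge (c : int) z := z = 0 \/ c <= v z.

Lemma val_geD c x y : val_ge c x -> val_ge c y -> val_ge c (x + y).
Proof.
have [->|x0] := eqVneq x 0; first by rewrite add0r.
have [->|y0] := eqVneq y 0; first by rewrite addr0.
wlog le_xy : x y x0 y0 / v x <= v y => [hw cx cy|].
  by have [le|/ltW le] := leP (v x) (v y); [|rewrite addrC]; apply: hw.
move=> [/eqP|cx _]; first by rewrite (negPf x0).
have [->|xy0] := eqVneq (x + y) 0; [by left | right].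
have e : x + y = x * (1 + y / x) by field.
have u0 : 1 + y / x != 0 by apply: contraNneq xy0 => u0; rewrite e u0 mulr0.
rewrite e val_mul //; apply: le_trans cx _; rewrite lerDl; apply/(vP.2 _ u0).
apply: valD_ring => //; apply/vP.2; first by rewrite mulf_neq0 ?invr_eq0.
by rewrite val_mul ?invr_eq0 // valV // subr_ge0.
Qed.

Lemma val_ge_sum c (I : finType) (P : pred I) (z : I -> F) :
  (forall i, P i -> val_ge c (z i)) -> val_ge c (\sum_(i | P i) z i).
Proof.
by move=> cz; elim/big_ind: _ => //; [left | apply: val_geD].
Qed.

Lemma val_add1 e : val_ge 1 e -> 1 + e != 0 /\ v (1 + e) = 0.
Proof.
have no1 : ~ val_ge 1 1.
  by move=> [/eqP|]; rewrite ?oner_eq0 // val1.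
have vN z : val_ge 1 z -> val_ge 1 (- z).
  move=> [->|vz]; first by left; rewrite oppr0.
  have [->|z0] := eqVneq z 0; [by left; rewrite oppr0 | right].
  have N10 : -1 != 0 :> F by rewrite oppr_eq0 oner_eq0.
  have : v (-1) + v (-1) = 0 by rewrite -val_mul // mulrNN mulr1 val1.
  by move=> v1; rewrite -mulN1r val_mul //; lia.
move=> ve; have e0 : 1 + e != 0.
  apply: contra_notN no1 => /eqP e0.
  have -> : 1 = - e by rewrite -[LHS]addr0 -(subrr e) addrA e0 sub0r.
  exact: vN.
split=> //; apply/eqP; rewrite eq_le; apply/andP; split; last first.
  apply/(vP.2 _ e0); apply: valD_ring => //.
  have [->|e'0] := eqVneq e 0; first by rewrite -(subrr 1); apply: RB.
  by case: ve => [/eqP|ve]; [rewrite (negPf e'0) | apply/(vP.2 _ e'0); lia].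
rewrite leNgt; apply: contra_notN no1 => lt.
have lt1 : val_ge 1 (1 + e) by right; rewrite -gtz0_ge1.
by have := val_geD lt1 (vN _ ve); rewrite addrK.
Qed.

(** Distinct values leave no cancellation: the sum is its term of least value times 1 + e, where e
    has positive value. *)
Lemma val_sum_distinct (I : finType) (z : I -> F) c :
  (forall i j, z i != 0 -> z j != 0 -> v (z i) = v (z j) -> i = j) ->
  val_ge c (\sum_i z i) -> forall i, z i != 0 -> c <= v (z i).
Proof.
move=> inj_v csum i zi0.
case: (@arg_minP _ _ _ i (fun i => z i != 0) (fun i => v (z i)) zi0) => j zj0 le_j.
apply: le_trans (le_j i zi0).
pose e := \sum_(i | i != j) z i / z j.
have es : \sum_i z i = z j * (1 + e).
  rewrite (bigD1 j) //= mulrDr mulr1 mulr_sumr; congr (_ + _).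
  by apply: eq_bigr => k _; rewrite mulrCA mulfV ?mulr1.
have ve : val_ge 1 e.
  apply: val_ge_sum => k kj; have [->|zk0] := eqVneq (z k) 0.
    by left; rewrite mul0r.
  right; rewrite val_mul ?invr_eq0 // valV //.
  have := le_j k zk0; rewrite le_eqVlt => /orP[/eqP /inj_v jk|].
    by rewrite jk // eqxx in kj.
  by lia.
have [e0 v0] := val_add1 ve.
case: csum; rewrite es; first by move/eqP; rewrite mulf_eq0 (negPf zj0) (negPf e0).
by rewrite val_mul // v0 addr0.
Qed.

Lemma val_sum_eq0 (I : finType) (z : I -> F) :
  (forall i j, z i != 0 -> z j != 0 -> v (z i) = v (z j) -> i = j) ->
  \sum_i z i = 0 -> forall i, z i = 0.
Proof.
move=> inj_v sum0 i; apply/eqP; apply: contraT => zi0.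
have := val_sum_distinct (c := v (z i) + 1) inj_v (or_introl sum0) zi0.
by lia.
Qed.

End Theory.

Section DiscreteValuationRing.

Variable tau : F.
Hypotheses (RM : forall x y, R x -> R y -> R (x * y))
  (Rfrac : forall z, exists a b, [/\ R a, R b, b != 0 & z = a / b])
  (Rloc : forall a, R a -> R a^-1 \/ exists a', R a' /\ a = tau * a')
  (Rdvd : forall a, a != 0 -> R a -> exists r k, R r /\ a * r = tau ^+ k)
  (Rtau : R tau) (tau_nonunit : ~ R tau^-1).

Let tau0 : tau != 0.
Proof. by apply: contra_notN tau_nonunit => /eqP t0; rewrite t0 invr0 -{1}t0. Qed.

Let RX x k : R x -> R (x ^+ k).
Proof. by move=> Rx; elim: k => [|k IH]; rewrite ?expr0 // exprS; apply: RM. Qed.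

Let unit u := [/\ u != 0, R u & R u^-1].

Let factor a : a != 0 -> R a -> exists u (k : nat), unit u /\ a = u * tau ^+ k.
Proof.
move=> a0 Ra; have [r [k [Rr e]]] := Rdvd a0 Ra.
elim: k a a0 Ra e => [|k IH] a a0 Ra e.
  exists a, 0%N; rewrite expr0 mulr1; split=> //; split=> //.
  by rewrite -[_^-1]mulr1 -[X in _ * X](expr0 tau) -e mulKf.
have [RVa|[a' [Ra' ea]]] := Rloc Ra.
  by exists a, 0%N; rewrite expr0 mulr1.
have a'0 : a' != 0 by apply: contraNneq a0 => a'0; rewrite ea a'0 mulr0.
have [|u [j [uu ej]]] := IH a' a'0 Ra'.
  by apply: (mulfI tau0); rewrite mulrA -ea e exprS.
by exists u, j.+1; split=> //; rewrite ea ej exprS mulrCA.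
Qed.

Let factorz z : z != 0 -> exists j, exists2 u, unit u & z = u * tau ^ j.
Proof.
move=> z0; have [a [b [Ra Rb b0 ez]]] := Rfrac z.
have a0 : a != 0 by apply: contraNneq z0 => a0; rewrite ez a0 mul0r.
have [u [k [[u0 Ru RVu] ea]]] := factor a0 Ra.
have [w [l [[w0 Rw RVw] eb]]] := factor b0 Rb.
exists (k%:Z - l%:Z); exists (u / w).
  split; first by rewrite mulf_neq0 ?invr_eq0.
    exact: RM.
  by rewrite invf_div; apply: RM.
by rewrite ez ea eb expfzDr // -exprnN -exprnP -mulf_div.
Qed.

Let regular_ge0 u j : unit u -> R (u * tau ^ j) -> 0 <= j.
Proof.
move=> [u0 Ru RVu] Rz; rewrite leNgt; apply/negP => j0; apply: tau_nonunit.
have -> : tau^-1 = u^-1 * (u * tau ^ j) * tau ^+ absz (j + 1).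
  rewrite mulKf // exprnP -expfzDr // -exprN1; congr (_ ^ _).
  by lia.
by apply: RM; [apply: RM | apply: RX].
Qed.

Let factorz_inj u j w k : unit u -> unit w -> u * tau ^ j = w * tau ^ k -> j = k.
Proof.
have half u' w' i l : unit u' -> unit w' -> u' * tau ^ i = w' * tau ^ l -> l <= i.
  move=> [u0 Ru RVu] [w0 Rw RVw] e; rewrite -subr_ge0.
  apply: (@regular_ge0 (u' / w')).
    split; first by rewrite mulf_neq0 ?invr_eq0.
      exact: RM.
    by rewrite invf_div; apply: RM.
  rewrite expfzDr // mulrACA e -invr_expz mulrACA !mulfV ?expfz_neq0 //.
  by rewrite mulr1.
move=> uu uw e; apply/eqP; rewrite eq_le (half _ _ _ _ uu uw e) andbT.
exact: half uw uu (esym e).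
Qed.

(** A nonunit of R is divisible by tau, and the exponent in [Rdvd] bounds how often this can be
    repeated. So every nonzero element is a unit times a unique power of tau, and v is that
    exponent. *)
Lemma dvr_valuation : exists v, is_valuation R v /\ v tau = 1.
Proof.
have choose z : {j | z != 0 -> exists2 u, unit u & z = u * tau ^ j}.
  apply: constructive_indefinite_description.
  have [_|/factorz[j ej]] := eqVneq z 0; first by exists 0.
  by exists j.
pose v z := sval (choose z).
have vE u j : unit u -> v (u * tau ^ j) = j.
  move=> uu; have [|w uw e] := svalP (choose (u * tau ^ j)).
    by rewrite mulf_neq0 ?expfz_neq0 //; case: uu.
  exact: factorz_inj uw uu (esym e).
have u1 : unit 1 by split; rewrite ?oner_eq0 ?invr1.
exists v; split; last by rewrite -[tau]mul1r -[X in 1 * X]expr1z vE.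
split=> [a b /factorz[j [u uu ->]] /factorz[k [w uw ->]]|z /factorz[j [u uu ->]]].
  rewrite !vE // mulrACA -expfzDr // vE //.
  case: uu uw => [u0 Ru RVu] [w0 Rw RVw].
  by split; rewrite ?mulf_neq0 ?invfM //; apply: RM.
rewrite vE //; split; first exact: regular_ge0.
by case: j => // j _; case: uu => _ Ru _; apply: RM => //; apply: RX.
Qed.

End DiscreteValuationRing.

End Valuation.

(** * Derivations and Kaehler differentials *)

Section Derivation.

Variables (K F : fieldType) (iota : {rmorphism K -> F}) (M : lmodType F).
Variable (D : F -> M).
Hypothesis derD : derivation iota D.

Lemma der_const c : D (iota c) = 0. Proof. by case: derD. Qed.
Lemma der_add x y : D (x + y) = D x + D y. Proof. by case: derD. Qed.
Lemma der_mul x y : D (x * y) = x *: D y + y *: D x. Proof. by case: derD. Qed.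

Lemma der0 : D 0 = 0. Proof. by rewrite -(rmorph0 iota) der_const. Qed.
Lemma der1 : D 1 = 0. Proof. by rewrite -(rmorph1 iota) der_const. Qed.

Lemma der_opp x : D (- x) = - D x.
Proof. by apply: (addrI (D x)); rewrite -der_add !subrr der0. Qed.

Lemma der_sub x y : D (x - y) = D x - D y.
Proof. by rewrite der_add der_opp. Qed.

Lemma der_exp x k : D (x ^+ k.+1) = (k.+1%:R * x ^+ k) *: D x.
Proof.
elim: k => [|k IH]; first by rewrite expr1 expr0 mulr1 scale1r.
rewrite exprS der_mul IH scalerA -scalerDl; congr (_ *: _).
by rewrite exprS -[k.+2%:R]natr1; ring.
Qed.

Lemma der_inv x : D x^-1 = - x ^- 2 *: D x.
Proof.
have [->|x0] := eqVneq x 0; first by rewrite invr0 der0 scaler0.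
have: D (x^-1 * x) = 0 by rewrite mulVf // der1.
rewrite der_mul => /eqP; rewrite addrC addr_eq0 => /eqP e.
apply: (scalerI x0); rewrite e -scaleNr scalerA; congr (_ *: _).
by field.
Qed.

Lemma der_sum I (r : seq I) (P : pred I) (G : I -> F) :
  D (\sum_(i <- r | P i) G i) = \sum_(i <- r | P i) D (G i).
Proof. exact: (big_morph D der_add der0). Qed.

Lemma der_horner (p : {poly F}) x : (forall i, D p`_i = 0) ->
  D p.[x] = p^`().[x] *: D x.
Proof.
elim/poly_ind: p => [|p c IH] Dp; first by rewrite horner0 deriv0 horner0 der0 scale0r.
have Dp' i : D p`_i = 0 by have := Dp i.+1; rewrite coefD coefMX coefC addr0.
have Dc : D c = 0 by have := Dp 0%N; rewrite coefD coefMX coefC add0r.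
rewrite derivD derivM derivX derivC addr0 mulr1 !hornerE der_add Dc addr0.
by rewrite der_mul IH // scalerA -scalerDl [_ + p.[x]]addrC mulrC.
Qed.

Lemma der_ev1 s p : D (ev1 iota s p) = ev1 iota s p^`() *: D s.
Proof.
by rewrite !ev1E der_horner ?deriv_map // => i; rewrite coef_map der_const.
Qed.

Lemma der_ev2 s t P :
  D (ev2 iota s t P) =
  ev2 iota s t (derX P) *: D s + ev2 iota s t P^`() *: D t.
Proof.
elim/poly_ind: P => [|P p IH].
  by rewrite /derX deriv0 !raddf0 der0 !scale0r addr0.
rewrite derXD derXM derX_X mulr0 addr0 derXC derivD derivM derivX derivC addr0 mulr1.
rewrite !rmorphD !rmorphM /= ev2X !ev2C der_add der_mul IH der_ev1.
rewrite scalerDr !scalerA !scalerDl [t * _]mulrC [t * _]mulrC.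
by rewrite [RHS]addrACA [X in _ = _ + X]addrC [X in X + _ = _]addrC -addrA.
Qed.

Lemma der_eq0_subfield : is_subfield (fun z => D z = 0).
Proof.
split=> [|x y Dx Dy|x y Dx Dy]; first exact: der1.
  by rewrite der_sub Dx Dy subr0.
by rewrite der_mul der_inv Dx Dy !scaler0 addr0.
Qed.

Lemma der_eq0 s : (forall x, x \in s -> D x = 0) ->
  forall z, adjoin iota s z -> D z = 0.
Proof.
by move=> Ds z /(_ _ der_eq0_subfield); apply=> // c; apply: der_const.
Qed.

End Derivation.

(** Named so that it can carry a linear structure: it is the factorization required by the universal
    property of the differentials. *)
Definition scale_vector (F : fieldType) (M : lmodType F) (w : M) (u : F^o) : M := u *: w.

Fact scale_vector_is_linear (F : fieldType) (M : lmodType F) (w : M) :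
  linear (scale_vector w).
Proof. by move=> a u v; rewrite /scale_vector scalerDl scalerA. Qed.

HB.instance Definition _ (F : fieldType) (M : lmodType F) (w : M) :=
  GRing.isLinear.Build F F^o M *:%R (scale_vector w) (scale_vector_is_linear w).

Section Hamiltonian.

Variables (m : nat) (K : closedFieldType) (H : hurwitzField m.+1 K).
Local Notation F := (hurwitz_field H).
Local Notation iota := (hurwitz_iota H).
Local Notation S := (hurwitz_S H).
Local Notation T := (hurwitz_T H).
Local Notation f := (hurwitz_poly K m).
Local Notation ev := (gen_ev H).

Definition fS : F := m.+1%:R * S ^+ m * T + 1.
Definition fT : F := S ^+ m.+1 + m.+1%:R * T ^+ m.

(* D z is the quotient of dz by the differential dS / fT = - dT / fS. *)
Definition hamiltonian (D : F -> F^o) :=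
  [/\ derivation iota D, D S = fT & D T = - fS].

Lemma ev_derX : ev (derX f) = fS. Proof. exact: hurwitz_poly_derX. Qed.
Lemma ev_derY : ev f^`() = fT. Proof. exact: hurwitz_poly_derY. Qed.

Lemma hamiltonian_ev D P : hamiltonian D ->
  D (ev P) = ev (derX P) * fT - ev P^`() * fS.
Proof. by move=> [dD DS DT]; rewrite /gen_ev (der_ev2 dD) DS DT scalerN. Qed.

(** On polynomials, E is the Hamiltonian vector field of f followed by evaluation. It sends f to fS
    fT - fT fS = 0 and so respects the relation between S and T; the product rule extends it to
    fractions. *)
Lemma hamiltonian_exists : exists D, hamiltonian D.
Proof.
pose E P := ev (derX P) * fT - ev P^`() * fS.
have EM P Q : E (P * Q) = E P * ev Q + ev P * E Q.
  by rewrite /E derXM derivM !rmorphD !rmorphM /=; ring.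
have EB P Q : E (P - Q) = E P - E Q.
  by rewrite /E /derX !raddfB /=; ring.
have ED P Q : E (P + Q) = E P + E Q.
  by rewrite /E derXD derivD !rmorphD /=; ring.
have E0 P : ev P = 0 -> E P = 0.
  move=> /ev_eq0_dvd[Q ->]; rewrite EM ev_hurwitz_poly mulr0 add0r.
  by rewrite /E ev_derX ev_derY [fS * _]mulrC subrr mulr0.
(* The product rule for P = z Q, with w as the derivative of z. Uniqueness of w makes the choice of
   the fraction immaterial. *)
pose rel z w := exists P Q, [/\ ev Q != 0, ev P = z * ev Q & E P = z * E Q + w * ev Q].
have rel_fun z w w' : rel z w -> rel z w' -> w = w'.
  move=> [P [Q [Q0 eP eE]]] [P' [Q' [Q'0 eP' eE']]].
  have : E (P * Q' - P' * Q) = 0.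
    by apply: E0; rewrite rmorphB !rmorphM /= eP eP'; ring.
  rewrite EB !EM eP eP' eE eE' => e.
  have : (w - w') * (ev Q * ev Q') = 0 by rewrite -e; ring.
  move=> /eqP; rewrite !mulf_eq0 (negPf Q0) (negPf Q'0) !orbF subr_eq0.
  by move/eqP.
have rel_ev P : rel (ev P) (E P).
  exists P, 1; rewrite rmorph1 oner_eq0 !mulr1; split=> //.
  by rewrite /E -polyC1 derXC !derivC !rmorph0 !mul0r subrr mulr0 add0r.
have rel_ex z : exists w, rel z w.
  have [P [Q [Q0 ->]]] := ev_frac z.
  exists ((E P - ev P / ev Q * E Q) / ev Q), P, Q; split=> //.
    by rewrite divfK.
  by rewrite divfK // addrC subrK.
have [D relD] : exists D, forall z, rel z (D z).
  exists (fun z => sval (constructive_indefinite_description _ (rel_ex z))).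
  by move=> z; apply: svalP.
have DE P : D (ev P) = E P := rel_fun _ _ _ (relD _) (rel_ev P).
exists D; split; last 2 first.
- rewrite -[LHS](congr1 D (ev_XC H)) DE /E derXC derivX derivC.
  by rewrite rmorph1 rmorph0 mul1r mul0r subr0.
- rewrite -[LHS](congr1 D (ev_X H)) DE /E derX_X derivX.
  by rewrite rmorph1 rmorph0 mul1r mul0r sub0r.
split=> [c|x y|x y].
- by rewrite -ev_CC DE /E derXC !derivC !rmorph0 !mul0r subrr.
- apply: (rel_fun _ _ _ (relD _)).
  have [P [Q [Q0 eP eE]]] := relD x; have [P' [Q' [Q'0 eP' eE']]] := relD y.
  exists (P * Q' + P' * Q), (Q * Q'); rewrite !rmorphD !rmorphM ED !EM mulf_neq0 //=.
  by rewrite eP eP' eE eE'; split=> //; ring.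
- apply: (rel_fun _ _ _ (relD _)).
  have [P [Q [Q0 eP eE]]] := relD x; have [P' [Q' [Q'0 eP' eE']]] := relD y.
  exists (P * P'), (Q * Q'); rewrite !rmorphM !EM mulf_neq0 //=.
  by rewrite eP eP' eE eE' /GRing.scale /=; split=> //; ring.
Qed.

Lemma derivation_eq0 (M : lmodType F) (D : F -> M) :
  derivation iota D -> D S = 0 -> D T = 0 -> forall z, D z = 0.
Proof.
move=> dD DS DT z; apply: (der_eq0 dD (s := [:: S; T])).
  by move=> x; rewrite !inE => /orP[] /eqP ->.
exact: hurwitz_generated.
Qed.

Hypothesis N0 : (m * m.+1).+1%:R != 0 :> K.

Lemma fS_fT_neq0 : fS != 0 \/ fT != 0.
Proof.
apply: hurwitz_smooth; last exact: hurwitz_equation.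
by rewrite -(rmorph_nat iota) fmorph_eq0.
Qed.

(** Any derivation D' satisfies fS D'S + fT D'T = 0. As fS and fT are not both 0, the pair (D'S,
    D'T) is a multiple w0 of (fT, - fS), so D' and w0 D agree on generators. *)
Lemma hamiltonian_kaehler D : hamiltonian D -> kaehler iota D.
Proof.
move=> hD; have [dD DS DT] := hD; split=> //.
  move=> w; have [x Dx] : exists x, D x != 0.
    have [f0|f0] := fS_fT_neq0; [exists T | exists S]; rewrite ?DT ?DS //.
    by rewrite oppr_eq0.
  exists 1%N, (fun=> w / D x), (fun=> x).
  by rewrite big_ord1 /GRing.scale /= divfK.
move=> M D' dD'.
have [w0 [eS eT]] : exists w0, D' S = fT *: w0 /\ D' T = - fS *: w0.
  have : D' (ev f) = 0 by rewrite ev_hurwitz_poly (der0 dD').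
  rewrite /gen_ev (der_ev2 dD') ev_derX ev_derY => e.
  have [f0|f0] := fS_fT_neq0.
    exists (- fS^-1 *: D' T); rewrite !scalerA mulrNN mulfV // scale1r.
    split=> //; apply: (scalerI f0); rewrite scalerA mulrCA mulrN mulfV // mulrN1 scaleNr.
    by apply/eqP; rewrite -addr_eq0 e.
  exists (fT^-1 *: D' S); rewrite !scalerA mulfV // scale1r; split=> //.
  apply: (scalerI f0); rewrite scalerA mulrCA mulfV // mulr1 scaleNr.
  by apply/eqP; rewrite -addr_eq0 addrC e.
exists (scale_vector w0) => z; apply/eqP; rewrite -subr_eq0; apply/eqP.
move: z; apply: (derivation_eq0 (D := fun z => scale_vector w0 (D z) - D' z)).
- split=> [c|x y|x y]; rewrite /scale_vector.
  + by rewrite (der_const dD) (der_const dD') scale0r subrr.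
  + by rewrite (der_add dD) (der_add dD') scalerDl opprD addrACA.
  + rewrite (der_mul dD) (der_mul dD') scalerDl opprD addrACA -!scalerA.
    by rewrite !scalerBr.
- by rewrite DS eS subrr.
- by rewrite DT eT subrr.
Qed.

End Hamiltonian.

(** * Places of the affine curve *)

Section LocalParameters.

Variables (m : nat) (K : closedFieldType) (H : hurwitzField m.+1 K).
Local Notation F := (hurwitz_field H).
Local Notation iota := (hurwitz_iota H).
Local Notation S := (hurwitz_S H).
Local Notation T := (hurwitz_T H).
Local Notation f := (hurwitz_poly K m).
Local Notation ev := (gen_ev H).

Variables (s0 t0 : K).
Local Notation ev0 := (point_ev s0 t0).
Local Notation spec := (@spec m K H s0 t0).
Local Notation regular_at := (@regular_at m K H s0 t0).

Hypothesis on_curve : s0 ^+ m.+1 * t0 + t0 ^+ m.+1 + s0 = 0.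

Lemma spec_S_sub : spec (S - iota s0) 0.
Proof.
by rewrite -(subrr s0); apply: specB; [exact: on_curve | exact: spec_S | exact: spec_iota].
Qed.

Lemma spec_T_sub : spec (T - iota t0) 0.
Proof.
by rewrite -(subrr t0); apply: specB; [exact: on_curve | exact: spec_T | exact: spec_iota].
Qed.

Lemma regular_const c : regular_at (iota c).
Proof. by exists c; apply: spec_iota. Qed.

Lemma regular1 : regular_at 1.
Proof. by rewrite -(rmorph1 iota); apply: regular_const. Qed.

Lemma regularB x y : regular_at x -> regular_at y -> regular_at (x - y).
Proof. by move=> [a xa] [b yb]; exists (a - b); apply: specB. Qed.

Lemma regularM x y : regular_at x -> regular_at y -> regular_at (x * y).
Proof. by move=> [a xa] [b yb]; exists (a * b); apply: specM. Qed.

Lemma regularD x y : regular_at x -> regular_at y -> regular_at (x + y).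
Proof. by move=> [a xa] [b yb]; exists (a + b); apply: specD. Qed.

Lemma regular_ev P : regular_at (ev P).
Proof. by exists (ev0 P); apply: spec_ev. Qed.

Lemma spec0_nonunit z : z != 0 -> spec z 0 -> ~ regular_at z^-1.
Proof.
move=> z0 sz [c sz']; have := specM sz sz'; rewrite mulfV // mul0r => s1.
have s1' : spec 1 1 by rewrite -{1}(rmorph1 iota); apply: spec_iota.
by move/eqP: (spec_fun on_curve s1 s1'); rewrite eq_sym oner_eq0.
Qed.

Definition local_parameter (tau : F) :=
  [/\ spec tau 0, tau != 0,
      forall z, spec z 0 -> exists z', regular_at z' /\ z = tau * z' &
      forall z, z != 0 -> regular_at z ->
        exists r k, regular_at r /\ z * r = tau ^+ k].

Lemma hurwitz_S_neq c : S != iota c.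
Proof.
apply: contra_not_neq (@hurwitz_transcendental _ _ H) => ->.
exact: algebraic_id.
Qed.

Lemma ev_XsubC a : ev ('X - a%:P)%:P = S - iota a.
Proof. by rewrite ev_C rmorphB /= ev1X ev1C. Qed.

Lemma ev_YsubC a : ev ('X - a%:P%:P) = T - iota a.
Proof. by rewrite rmorphB /= ev_X ev_CC. Qed.

Lemma ev0_XsubC : ev0 ('X - s0%:P)%:P = 0.
Proof. by rewrite polyCB rmorphB /= ev0_XC ev0_CC subrr. Qed.

Lemma ev0_YsubC : ev0 ('X - t0%:P%:P) = 0.
Proof. by rewrite rmorphB /= ev0_X ev0_CC subrr. Qed.

Lemma ev_taylor c P1 P2 :
  ev (c%:P%:P + ('X - s0%:P)%:P * P1 + ('X - t0%:P%:P) * P2) =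
  iota c + (S - iota s0) * ev P1 + (T - iota t0) * ev P2.
Proof. by rewrite 2!rmorphD 2!rmorphM /= ev_CC ev_XsubC ev_YsubC. Qed.

Lemma ev0_taylor c P1 P2 :
  ev0 (c%:P%:P + ('X - s0%:P)%:P * P1 + ('X - t0%:P%:P) * P2) = c.
Proof. by rewrite 2!rmorphD 2!rmorphM /= ev0_CC ev0_XsubC ev0_YsubC !mul0r !addr0. Qed.

(** The Taylor expansion of f at the point, evaluated on the curve. A nonzero partial derivative
    makes its cofactor a unit of the local ring, so that one of S - s0, T - t0 becomes a multiple of
    the other. *)
Lemma gradient_relation : exists P1 P2,
  [/\ (S - iota s0) * ev P1 + (T - iota t0) * ev P2 = 0,
      ev0 P1 = m.+1%:R * s0 ^+ m * t0 + 1 &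
      ev0 P2 = s0 ^+ m.+1 + m.+1%:R * t0 ^+ m].
Proof.
have [c [P1 [P2 e]]] := taylor2 f s0 t0; exists P1, P2.
have ev0f : ev0 f = 0 by rewrite /point_ev hurwitz_polyE on_curve.
have c0 : c = 0 by rewrite -(ev0_taylor c P1 P2) -e.
split.
- by have := ev_hurwitz_poly H; rewrite e ev_taylor c0 rmorph0 add0r.
- have := congr1 (fun P => ev0 (derX P)) e; rewrite /= {1}/point_ev hurwitz_poly_derX => ->.
  rewrite !derXD !derXM derXC derXB derX_X !derXC derivB derivX !derivC.
  rewrite !polyC0 !subr0 polyC1 mul1r mul0r !add0r.
  by rewrite 2!rmorphD 2!rmorphM /= ev0_XsubC ev0_YsubC !mul0r !addr0.
- have := congr1 (fun P => ev0 P^`()) e; rewrite /= {1}/point_ev hurwitz_poly_derY => ->.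
  rewrite !derivD !derivM derivB derivX !derivC.
  rewrite !subr0 mul1r mul0r !add0r addrCA addrA.
  by rewrite 2!rmorphD 2!rmorphM /= ev0_XsubC ev0_YsubC !mul0r !addr0.
Qed.

Lemma spec0_gen z : spec z 0 -> exists a b, [/\ regular_at a, regular_at b &
  z = (S - iota s0) * a + (T - iota t0) * b].
Proof.
move=> [P [Q [Q0 -> /esym/eqP]]]; rewrite mulf_eq0 invr_eq0 (negPf Q0) orbF => /eqP P0.
have [c [P1 [P2 e]]] := taylor2 P s0 t0.
have c0 : c = 0 by rewrite -(ev0_taylor c P1 P2) -e.
have RV : regular_at (ev Q)^-1.
  by eexists; apply: specV (spec_ev _ _ _ _) Q0.
exists (ev P1 / ev Q), (ev P2 / ev Q); split.
- by apply: regularM => //; apply: regular_ev.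
- by apply: regularM => //; apply: regular_ev.
rewrite e c0 ev_taylor rmorph0 add0r.
by rewrite mulrDl !mulrA.
Qed.

Lemma regularX x k : regular_at x -> regular_at (x ^+ k).
Proof. by move=> [c xc]; exists (c ^+ k); apply: specX. Qed.

Let S_sub_neq0 : S - iota s0 != 0.
Proof. by rewrite subr_eq0 hurwitz_S_neq. Qed.

Lemma local_parameter_T :
  m.+1%:R * s0 ^+ m * t0 + 1 != 0 -> local_parameter (T - iota t0).
Proof.
move=> fS0; have [P1 [P2 [e e1 _]]] := gradient_relation; rewrite -e1 in fS0.
have evP1 := ev0_neq0_ev H on_curve fS0.
have RV : regular_at (ev P1)^-1.
  by eexists; apply: specV (spec_ev _ _ _ _) fS0.
have eS : S - iota s0 = (T - iota t0) * (- ev P2 / ev P1).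
  apply: (mulIf evP1); rewrite -mulrA divfK //; apply/eqP.
  by rewrite mulrN -addr_eq0 e.
have RP : regular_at (- ev P2 / ev P1).
  by apply: regularM => //; rewrite -rmorphN; apply: regular_ev.
split.
- exact: spec_T_sub.
- by apply: contraNneq S_sub_neq0 => t_eq0; rewrite eS t_eq0 mul0r.
- move=> z /spec0_gen[a [b [Ra Rb ->]]].
  exists ((- ev P2 / ev P1) * a + b); split; last by rewrite eS -[_ * _ * a]mulrA mulrDr.
  by apply: regularD => //; apply: regularM.
- move=> z z0 /(spec_S_dvd on_curve z0)[r [k [Rr er]]].
  have [r' [k' [Rr' er']]] := spec_T_dvd H on_curve.
  exists (r * r' ^+ k), (k' * k)%N; split; first by apply: regularM => //; apply: regularX.
  by rewrite mulrA er -exprMn er' exprM.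
Qed.

Lemma local_parameter_S :
  s0 ^+ m.+1 + m.+1%:R * t0 ^+ m != 0 -> local_parameter (S - iota s0).
Proof.
move=> fT0; have [P1 [P2 [e _ e2]]] := gradient_relation; rewrite -e2 in fT0.
have evP2 := ev0_neq0_ev H on_curve fT0.
have RV : regular_at (ev P2)^-1.
  by eexists; apply: specV (spec_ev _ _ _ _) fT0.
have eT : T - iota t0 = (S - iota s0) * (- ev P1 / ev P2).
  apply: (mulIf evP2); rewrite -mulrA divfK //; apply/eqP.
  by rewrite mulrN -addr_eq0 addrC e.
have RP : regular_at (- ev P1 / ev P2).
  by apply: regularM => //; rewrite -rmorphN; apply: regular_ev.
split => //.
- exact: spec_S_sub.
- move=> z /spec0_gen[a [b [Ra Rb ->]]].
  exists (a + (- ev P1 / ev P2) * b); split; last by rewrite eT -[_ * _ * b]mulrA mulrDr.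
  by apply: regularD => //; apply: regularM.
- exact: spec_S_dvd.
Qed.

Lemma local_parameter_valuation tau : local_parameter tau ->
  exists v, is_valuation regular_at v /\ v tau = 1.
Proof.
move=> [stau tau0 Rtau dtau].
apply: dvr_valuation => //.
- exact: regular1.
- exact: regularM.
- move=> z; have [P [Q [Q0 ez]]] := ev_frac z.
  by exists (ev P), (ev Q); split=> //; apply: regular_ev.
- move=> a [c sa]; have [c0|c0] := eqVneq c 0.
    by right; apply: Rtau; rewrite -c0.
  by left; exists c^-1; apply: specV.
- by exists 0.
- exact: spec0_nonunit.
Qed.

Section PlaceValuation.

Variable v : F -> int.
Hypothesis vP : is_valuation regular_at v.

Lemma spec_val_eq0 z c : spec z c -> c != 0 -> z != 0 /\ v z = 0.
Proof.
move=> sz c0; have z0 : z != 0.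
  apply: contraNneq c0 => z0; apply/eqP; apply: (spec_fun on_curve sz).
  by rewrite z0 -(rmorph0 iota); apply: spec_iota.
split=> //; apply: (val_unit vP) => //; first by exists c.
by exists c^-1; apply: specV.
Qed.

Lemma val_const c : c != 0 -> v (iota c) = 0.
Proof. by move=> c0; have [] := spec_val_eq0 (spec_iota H s0 t0 c) c0. Qed.

End PlaceValuation.

Lemma regular_der D z : hamiltonian D -> regular_at z -> regular_at (D z : F).
Proof.
move=> hD [c [P [Q [Q0 ez _]]]]; have [dD _ _] := hD.
have evQ := ev0_neq0_ev H on_curve Q0.
have RV : regular_at (ev Q)^-1.
  by eexists; apply: specV (spec_ev _ _ _ _) Q0.
have Rev R : regular_at (D (ev R) : F).
  by rewrite (hamiltonian_ev _ hD) -ev_derX -ev_derY -!rmorphM -rmorphB; apply: regular_ev.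
rewrite ez (der_mul dD) (der_inv dD) /GRing.scale /=.
apply: regularD.
  apply: regularM; first exact: regular_ev.
  apply: regularM => //; rewrite -exprVn -mulN1r; apply: regularM.
    by rewrite -(rmorph1 iota) -rmorphN; apply: regular_const.
  exact: regularX.
by apply: regularM.
Qed.

End LocalParameters.

(** * Valuation rings over an algebraically closed field *)

Section ValuationRing.

Variables (K : closedFieldType) (F : fieldType) (iota : {rmorphism K -> F}).
Variable O : F -> Prop.
Hypothesis O_ring : valuation_ring iota O.
Local Notation mO := (maximal_ideal O).

Lemma vr_const c : O (iota c). Proof. by case: O_ring. Qed.
Lemma vr_sub x y : O x -> O y -> O (x - y). Proof. by case: O_ring => _ h *; apply: h. Qed.
Lemma vr_mul x y : O x -> O y -> O (x * y). Proof. by case: O_ring => _ _ h *; apply: h. Qed.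
Lemma vr1 : O 1. Proof. by rewrite -(rmorph1 iota); apply: vr_const. Qed.
Lemma vr0 : O 0. Proof. by rewrite -(rmorph0 iota); apply: vr_const. Qed.
Lemma vr_add x y : O x -> O y -> O (x + y).
Proof. exact: valD_ring vr1 vr_sub x y. Qed.
Lemma vr_exp x k : O x -> O (x ^+ k).
Proof.
by move=> Ox; elim: k => [|k IH]; [exact: vr1 | rewrite exprS; apply: vr_mul].
Qed.

Lemma mO_unit x : O x -> ~ mO x -> O x^-1.
Proof.
move=> Ox mx; apply: NNPP => OVx; apply: mx; split=> //; by right.
Qed.

Lemma mO_mul x y : O x -> mO y -> mO (x * y).
Proof.
move=> Ox [Oy my]; split; first exact: vr_mul.
have [->|xy0] := eqVneq (x * y) 0; [by left | right => OV].
have [x0 y0] : x != 0 /\ y != 0 by apply/andP; rewrite -negb_or -mulf_eq0.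
case: my => [/eqP|]; first by rewrite (negPf y0).
apply; have -> : y^-1 = x * (x * y)^-1 by rewrite invfM mulrA mulfV ?mul1r.
exact: vr_mul.
Qed.

Lemma mO_opp x : mO x -> mO (- x).
Proof.
rewrite -mulN1r; apply: mO_mul; rewrite -(rmorph1 iota) -rmorphN.
exact: vr_const.
Qed.

Lemma mO_add x y : mO x -> mO y -> mO (x + y).
Proof.
have half a b : a != 0 -> O (b / a) -> mO a -> mO (a + b).
  move=> a0 Oba ma; have -> : a + b = (1 + b / a) * a by rewrite mulrDl mul1r divfK.
  by apply: mO_mul => //; apply: vr_add => //; apply: vr1.
move=> mx my; have [->|x0] := eqVneq x 0; first by rewrite add0r.
have [->|y0] := eqVneq y 0; first by rewrite addr0.
have [_ _ _ _ tot] := O_ring; have [|Oyx|Oxy] := tot (y / x).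
- by rewrite mulf_neq0 ?invr_eq0.
- exact: half.
- by rewrite addrC; apply: half => //; rewrite -invf_div.
Qed.

Lemma mO1 : ~ mO 1.
Proof. by move=> [_ [/eqP|]]; [rewrite oner_eq0 | rewrite invr1; have := vr1]. Qed.

Lemma mO_const c : c != 0 -> ~ mO (iota c).
Proof.
move=> c0 mc; apply: mO1; rewrite -(mulVf (_ : iota c != 0)) ?fmorph_eq0 //.
by apply: mO_mul => //; rewrite -fmorphV; apply: vr_const.
Qed.

Lemma mO_prime x y : O x -> O y -> mO (x * y) -> mO x \/ mO y.
Proof.
move=> Ox Oy mxy; have [->|x0] := eqVneq x 0.
  by left; split; [exact: vr0 | left].
have [mx|/(mO_unit Ox) OVx] := classic (mO x); [by left | right].
by rewrite -(mulKf x0 y); apply: mO_mul.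
Qed.

(** p splits into linear factors over K, and the maximal ideal is prime. *)
Lemma mO_root (p : {poly K}) x : p != 0 -> O x -> mO (map_poly iota p).[x] ->
  exists c, mO (x - iota c).
Proof.
move=> p0 Ox; have [r ->] := closed_field_poly_normal p.
rewrite map_polyZ rmorph_prod hornerZ /= => mp.
have : mO (\prod_(z <- r) (x - iota z)).
  have -> : \prod_(z <- r) (x - iota z) =
      iota (lead_coef p)^-1 * (iota (lead_coef p) *
        (\prod_(z <- r) map_poly iota ('X - z%:P)).[x]).
    rewrite mulrA -rmorphM mulVf ?lead_coef_eq0 // rmorph1 mul1r horner_prod.
    by apply: eq_bigr => z _; rewrite rmorphB /= map_polyX map_polyC !hornerE.
  by apply: mO_mul => //; apply: vr_const.
elim: r {mp} => [|z r IH]; first by rewrite big_nil => /mO1.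
rewrite big_cons => /mO_prime[||m_xz|/IH//]; [| |by exists z].
  by apply: vr_sub => //; apply: vr_const.
apply: big_ind => [||y _]; [exact: vr1 | exact: vr_mul | ].
by apply: vr_sub => //; apply: vr_const.
Qed.

End ValuationRing.

Section Places.

Variables (m : nat) (K : closedFieldType) (H : hurwitzField m.+1 K).
Local Notation F := (hurwitz_field H).
Local Notation iota := (hurwitz_iota H).
Local Notation S := (hurwitz_S H).
Local Notation T := (hurwitz_T H).
Local Notation f := (hurwitz_poly K m).
Local Notation ev := (gen_ev H).
Local Notation on_curve s0 t0 := (s0 ^+ m.+1 * t0 + t0 ^+ m.+1 + s0 = 0).

Section Classification.

Variable O : F -> Prop.
Hypothesis O_ring : valuation_ring iota O.
Local Notation mO := (maximal_ideal O).
Hypotheses (OS : O S) (OT : O T).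

Lemma vr_horner x (p : {poly K}) : O x -> O (map_poly iota p).[x].
Proof.
move=> Ox; elim/poly_ind: p => [|p c IH].
  by rewrite rmorph0 horner0; apply: vr0 O_ring.
rewrite rmorphD rmorphM /= map_polyX map_polyC !hornerE.
by apply: (vr_add O_ring); [apply: (vr_mul O_ring) | apply: vr_const O_ring _].
Qed.

Lemma vr_ev P : O (ev P).
Proof.
elim/poly_ind: P => [|P p IH]; first by rewrite rmorph0; apply: vr0 O_ring.
rewrite rmorphD rmorphM /= ev_X ev_C ev1E.
by apply: (vr_add O_ring); [apply: (vr_mul O_ring) | apply: vr_horner].
Qed.

(** If S were congruent to no constant, every nonzero polynomial in S would be a unit of O. Every
    nonzero element of K[S, T] divides such a polynomial, so O would be all of F. *)
Lemma place_center_S : exists s0, mO (S - iota s0).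
Proof.
apply: NNPP => no_center; have [_ _ _ [z Oz] _] := O_ring; apply: Oz.
have [P [Q [Q0 ->]]] := ev_frac z.
have [V [g [g0 eV]]] := ev_bezout Q0.
have gS0 : ev1 iota S g != 0 by rewrite ev1S_eq0.
have -> : (ev Q)^-1 = ev V * (ev1 iota S g)^-1.
  rewrite -eV invfM mulrA mulfV ?mul1r //.
  by apply: contraNneq gS0 => V0; rewrite -eV V0 mul0r.
apply: (vr_mul O_ring); first exact: vr_ev.
apply: (vr_mul O_ring); first exact: vr_ev.
apply: mO_unit; first by rewrite ev1E; apply: vr_horner.
by rewrite ev1E => /(mO_root O_ring g0 OS).
Qed.

Lemma mO_ev s0 t0 P : mO (S - iota s0) -> mO (T - iota t0) ->
  mO (ev P - iota (point_ev s0 t0 P)).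
Proof.
move=> mS mT; have [c [P1 [P2 e]]] := taylor2 P s0 t0.
have -> : point_ev s0 t0 P = c by rewrite e ev0_taylor.
rewrite e ev_taylor addrC !addrA addNr add0r.
by apply: (mO_add O_ring); rewrite mulrC; apply: (mO_mul O_ring) => //; apply: vr_ev.
Qed.

Lemma place_center : exists s0 t0,
  [/\ on_curve s0 t0, mO (S - iota s0) & mO (T - iota t0)].
Proof.
have [s0 mS] := place_center_S; have [W eW] := hurwitz_poly_at H s0.
have [|t0 mT] := mO_root O_ring (hurwitz_poly_primitive m s0) OT.
  by rewrite eW mulrC; apply: (mO_mul O_ring) => //; apply: vr_ev.
exists s0, t0; split=> //; apply/eqP; apply: contraT => e0.
have := mO_ev f mS mT; rewrite ev_hurwitz_poly sub0r -rmorphN.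
rewrite /point_ev hurwitz_polyE => me; case: (mO_const O_ring _ me).
by rewrite oppr_eq0.
Qed.

Section Center.

Variables s0 t0 : K.
Hypotheses (H0 : on_curve s0 t0) (mS : mO (S - iota s0)) (mT : mO (T - iota t0)).

Lemma vr_regular z : regular_at s0 t0 z -> O z.
Proof.
move=> [c [P [Q [Q0 -> _]]]]; apply: (vr_mul O_ring); first exact: vr_ev.
apply: (mO_unit (vr_ev _)) => mQ.
apply: (mO_const O_ring Q0); rewrite -(opprK (iota _)); apply: (mO_opp O_ring).
rewrite -[- _](addKr (ev Q)) addrC; apply: (mO_add O_ring); first exact: mO_ev.
exact: (mO_opp O_ring).
Qed.

(** A discrete valuation ring is maximal under domination: for z in O but outside the local ring,
    1/z is a multiple of tau, so 1 = z / z would lie in the maximal ideal of O. *)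
Lemma vr_local_parameter tau : local_parameter s0 t0 tau -> mO tau ->
  forall z, O z <-> regular_at s0 t0 z.
Proof.
move=> ptau mtau z; split; last exact: vr_regular.
have [->|z0 Oz] := eqVneq z 0; first by rewrite -(rmorph0 iota); move=> _; apply: regular_const.
have [v [vP _]] := local_parameter_valuation H0 ptau.
have [stau tau0 tau_gen _] := ptau.
apply: NNPP => nRz.
have vz : v z < 0 by rewrite ltNge; apply/negP => /(vP.2 _ z0).
have Vz0 : z^-1 != 0 by rewrite invr_eq0.
have [c sz] : regular_at s0 t0 z^-1.
  by apply/(vP.2 _ Vz0); rewrite (valV vP) // oppr_ge0 ltW.
have [c0|c0] := eqVneq c 0; last first.
  by have [_] := spec_val_eq0 H0 vP sz c0; rewrite (valV vP) // => /eqP; rewrite oppr_eq0 lt_eqF.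
have [z' [Rz' e]] : exists z', regular_at s0 t0 z' /\ z^-1 = tau * z'.
  by apply: tau_gen; rewrite -c0.
apply: (mO1 O_ring); rewrite -(mulfV z0) e.
by apply: (mO_mul O_ring) => //; rewrite mulrC; apply: (mO_mul O_ring) => //; apply: vr_regular.
Qed.

End Center.

End Classification.

Section RegularRing.

Variables s0 t0 : K.
Hypothesis H0 : on_curve s0 t0.
Hypothesis N0 : (m * m.+1).+1%:R != 0 :> K.

Lemma local_parameter_exists : exists2 tau, local_parameter (H := H) s0 t0 tau &
  tau = T - iota t0 /\ m.+1%:R * s0 ^+ m * t0 + 1 != 0 \/
  tau = S - iota s0 /\ s0 ^+ m.+1 + m.+1%:R * t0 ^+ m != 0.
Proof.
case: (hurwitz_smooth N0 H0) => f0.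
  by exists (T - iota t0); [apply: local_parameter_T | left].
by exists (S - iota s0); [apply: local_parameter_S | right].
Qed.

Lemma regular_valuation_ring : valuation_ring iota (@regular_at m K H s0 t0).
Proof.
have [tau ptau _] := local_parameter_exists.
have [v [vP _]] := local_parameter_valuation H0 ptau.
have [stau tau0 _ _] := ptau.
split.
- exact: regular_const.
- exact: regularB.
- exact: regularM.
- by exists tau^-1; apply: spec0_nonunit.
- move=> z z0; have Vz0 : z^-1 != 0 by rewrite invr_eq0.
  have [vz|/ltW vz] := leP 0 (v z); [left|right]; apply/(vP.2 _ _) => //.
  by rewrite (valV vP) // oppr_ge0.
Qed.

End RegularRing.

End Places.

(** * Holomorphic forms and the cyclic symmetry *)

Section Holomorphy.

Variables (m : nat) (K : closedFieldType) (H : hurwitzField m.+1 K).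
Local Notation F := (hurwitz_field H).
Local Notation iota := (hurwitz_iota H).
Local Notation S := (hurwitz_S H).
Local Notation T := (hurwitz_T H).
Local Notation on_curve s0 t0 := (s0 ^+ m.+1 * t0 + t0 ^+ m.+1 + s0 = 0).

Hypothesis N0 : (m * m.+1).+1%:R != 0 :> K.
Variable D : F -> F^o.
Hypothesis hD : hamiltonian D.

Definition holomorphic_at (O : F -> Prop) (w : F^o) :=
  exists t u, [/\ uniformizer O t, O u & w = u *: D t].

(** O is the local ring at its center, and D of the local parameter there is, up to sign, a partial
    derivative of f that does not vanish. So D tau is a unit: dS / fT has neither zeros nor poles on
    the affine curve. *)
Lemma holomorphic_at_affine O (w : F) : valuation_ring iota O -> O S -> O T ->
  O w -> holomorphic_at O w.
Proof.
move=> O_ring OS OT Ow.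
have [s0 [t0 [H0 mS mT]]] := place_center O_ring OS OT.
have [dD DS DT] := hD.
have [tau ptau tauE] := local_parameter_exists H H0 N0.
have mtau : maximal_ideal O tau by case: tauE => [[-> _]|[-> _]].
have OE := vr_local_parameter O_ring OS OT H0 mS mT ptau mtau.
have [c c0 sD] : exists2 c, c != 0 & spec s0 t0 (D tau : F) c.
  case: tauE => [[-> f0]|[-> f0]]; rewrite (der_sub dD) (der_const dD) subr0.
    exists (- (m.+1%:R * s0 ^+ m * t0 + 1)); rewrite ?oppr_eq0 // DT; apply: specN.
    by rewrite -ev_derX -(hurwitz_poly_derX m idfun); apply: spec_ev.
  exists (s0 ^+ m.+1 + m.+1%:R * t0 ^+ m) => //.
  by rewrite DS -ev_derY -(hurwitz_poly_derY m idfun); apply: spec_ev.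
have [v [vP _]] := local_parameter_valuation H0 ptau.
have [D0 _] := spec_val_eq0 H0 vP sD c0.
exists tau, (w / D tau); split; last by rewrite /GRing.scale /= divfK.
  have [stau tau0 tau_gen _] := ptau.
  move=> x; split=> [[Ox mx]|[u Ou ->]]; last by rewrite mulrC; apply: (mO_mul O_ring).
  have [d sx] : regular_at s0 t0 x by apply/OE.
  have [z' [Rz' ->]] : exists z', regular_at s0 t0 z' /\ x = tau * z'.
    apply: tau_gen; have [d0|d0] := eqVneq d 0; first by rewrite -d0.
    have [x0 _] := spec_val_eq0 H0 vP sx d0.
    case: mx => [/eqP|]; first by rewrite (negPf x0).
    by case; apply/OE; exists d^-1; apply: specV.
  by exists z' => //; apply/OE.
by apply: (vr_mul O_ring) => //; apply/OE; exists c^-1; apply: specV.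
Qed.

Lemma holomorphic_at_regular s0 t0 (w : F^o) : on_curve s0 t0 ->
  holomorphic_at (@regular_at m K H s0 t0) w -> @regular_at m K H s0 t0 w.
Proof.
move=> H0 [t [u [ut Ru ->]]]; apply: regularM => //.
apply: regular_der => //.
have [//] : maximal_ideal (@regular_at m K H s0 t0) t.
by apply/ut; exists 1; [apply: regular1 | rewrite mulr1].
Qed.

End Holomorphy.

Section Rotation.

Variables (m : nat) (K : closedFieldType) (H : hurwitzField m.+1 K).
Local Notation F := (hurwitz_field H).
Local Notation iota := (hurwitz_iota H).
Local Notation S := (hurwitz_S H).
Local Notation T := (hurwitz_T H).

Lemma transcendental_const z : algebraicOver iota z -> exists c, z = iota c.
Proof.
move=> [p p0 /rootP]; have [r ->] := closed_field_poly_normal p.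
rewrite map_polyZ rmorph_prod hornerZ /= horner_prod => /eqP.
rewrite mulf_eq0 fmorph_eq0 lead_coef_eq0 (negPf p0) /= prodf_seq_eq0 => /hasP[c _ /=].
rewrite rmorphB /= map_polyX map_polyC !hornerE subr_eq0 => /eqP ->.
by exists c.
Qed.

Lemma hurwitz_S_neq0 : S != 0.
Proof. by rewrite -(rmorph0 iota) hurwitz_S_neq. Qed.

Lemma hurwitz_T_neq0 : T != 0.
Proof.
apply: contraNneq hurwitz_S_neq0 => T0; have := hurwitz_equation H.
by rewrite T0 mulr0 expr0n /= !add0r => ->.
Qed.

Lemma rot_transcendental : ~ algebraicOver iota (T / S).
Proof.
move=> /transcendental_const[c /(canRL (divfK hurwitz_S_neq0)) eT].
apply: (@hurwitz_transcendental _ _ H).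
(* The curve equation after the substitution T = c S. For m = 0 two terms have degree 1, so the top
   coefficient is used first to get c = 0. *)
exists (c%:P * 'X^(m.+2) + (c ^+ m.+1)%:P * 'X^(m.+1) + 'X).
  apply/eqP => /polyP e0.
  have c0 : c = 0.
    have := e0 m.+2; rewrite !coefD !coefCM !coefXn coefX coef0 eqxx.
    by rewrite (eqn_leq m.+2 m.+1) ltnn /= mulr0 mulr1 !addr0.
  have := e0 1%N; rewrite !coefD !coefCM !coefXn coefX coef0 c0 expr0n /=.
  by rewrite !mul0r !add0r => /eqP; rewrite oner_eq0.
rewrite rootE !rmorphD !rmorphM /= !map_polyC !map_polyXn !map_polyX !hornerE /=.
by apply/eqP; rewrite -[RHS](hurwitz_equation H) eT exprMn rmorphXn /= exprS; ring.
Qed.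

Lemma rot_generated z : adjoin iota [:: T / S; S^-1] z.
Proof.
move=> A Asub Aconst Agen; have [A1 AB AV] := Asub.
have AS : A S.
  by rewrite -[S]invrK -[_^-1]mul1r; apply: AV => //; apply: Agen; rewrite !inE eqxx orbT.
have AVS : A S^-1 by rewrite -[_^-1]mul1r; apply: AV.
apply: (hurwitz_generated z) => // x; rewrite !inE => /orP[] /eqP -> //.
have -> : T = (T / S) / S^-1 by rewrite invrK divfK ?hurwitz_S_neq0.
by apply: AV => //; apply: Agen; rewrite !inE eqxx.
Qed.

Lemma rot_equation :
  (T / S) ^+ m.+1 * S^-1 + S^-1 ^+ m.+1 + T / S = 0.
Proof.
have S0 := hurwitz_S_neq0.
have -> : (T / S) ^+ m.+1 * S^-1 + S^-1 ^+ m.+1 + T / S =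
    (S ^+ m.+1 * T + T ^+ m.+1 + S) / S ^+ m.+2.
  rewrite expr_div_n exprVn !exprS; by field; rewrite S0 expf_neq0.
by rewrite hurwitz_equation mul0r.
Qed.

(* The cyclic symmetry (X : Y : Z) -> (Y : Z : X) of the plane curve
   X^n Y + Y^n Z + Z^n X = 0. *)
Definition hurwitz_rot : hurwitzField m.+1 K :=
  HurwitzField rot_transcendental rot_generated rot_equation.

(** The generator dS / fT of the rotated curve is S^(m-1) times the original one, so coefficients of
    a fixed form get multiplied by S^(1-m), written as a quotient to cover m = 0. *)
Lemma rot_hamiltonian (D : F -> F^o) :
  hamiltonian D -> @hamiltonian m K hurwitz_rot (fun z => S / S ^+ m * D z).
Proof.
move=> [dD DS DT]; have S0 := hurwitz_S_neq0; have Sm0 := expf_neq0 m S0.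
split.
- split=> [c|x y|x y].
  + by rewrite (der_const dD) mulr0.
  + by rewrite (der_add dD) mulrDr.
  + by rewrite (der_mul dD) mulrDr /GRing.scale /= !(mulrCA (S / S ^+ m)).
- rewrite /= (der_mul dD) (der_inv dD) DS DT /GRing.scale /= /fT /fS /=.
  rewrite expr_div_n exprVn; apply/eqP; rewrite -subr_eq0; apply/eqP.
  (* The two sides differ by this multiple of the curve equation. *)
  rewrite -[RHS](mul0r (- m.+2%:R / (S * S ^+ m))) -(hurwitz_equation H) !exprS -[m.+2%:R]natr1.
  by field; rewrite Sm0.
- rewrite /= (der_inv dD) DS /GRing.scale /= /fT /fS /= expr_div_n !exprS expr0.
  by field; rewrite S0 Sm0.
Qed.

End Rotation.

Section HolomorphicForms.

Variables (m : nat) (K : closedFieldType).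
Hypothesis N0 : (m * m.+1).+1%:R != 0 :> K.
Implicit Types H : hurwitzField m.+1 K.

Lemma holomorphic_at_rot H (D : hurwitz_field H -> (hurwitz_field H)^o) O w :
  let c := hurwitz_S H / hurwitz_S H ^+ m in
  holomorphic_at D O w <-> holomorphic_at (fun z => c * D z : _^o) O (c * w : _^o).
Proof.
move=> c; have c0 : c != 0.
  by rewrite mulf_neq0 ?invr_eq0 ?expf_neq0 // hurwitz_S_neq0.
split=> [] [t [u [ut Ou e]]]; exists t, u; split=> //.
  by rewrite e /GRing.scale /= mulrCA.
by apply: (mulfI c0); rewrite e /GRing.scale /= mulrCA.
Qed.

Lemma affine_monomial H D i j (O : hurwitz_field H -> Prop) : hamiltonian D ->
  valuation_ring (hurwitz_iota H) O -> O (hurwitz_S H) -> O (hurwitz_T H) ->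
  holomorphic_at D O (hurwitz_S H ^+ i * hurwitz_T H ^+ j : _^o).
Proof.
move=> hD O_ring OS OT; apply: holomorphic_at_affine => //.
by apply: (vr_mul O_ring); apply: (vr_exp O_ring).
Qed.

(** As a form of degree m - 1 in homogeneous coordinates, the monomial has exponents i, j, k, and
    the rotation permutes them cyclically. *)
Lemma rot_monomial H i j k : (i + j + k = m.-1)%N -> (0 < m)%N ->
  let c := hurwitz_S H / hurwitz_S H ^+ m in
  c * (hurwitz_S H ^+ i * hurwitz_T H ^+ j) =
  hurwitz_S (hurwitz_rot H) ^+ j * hurwitz_T (hurwitz_rot H) ^+ k.
Proof.
move=> ijk m0 /=; have S0 := hurwitz_S_neq0 H.
have -> : hurwitz_S H ^+ m = hurwitz_S H ^+ (i + j + k).+1 by congr (_ ^+ _); lia.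
rewrite expr_div_n exprVn exprS !exprD; field.
by rewrite S0 !expf_neq0.
Qed.

(** Every place is finite on one of the three affine charts. The charts are rotations of each other,
    and on each of them the coefficient of the form is again a monomial with natural exponents. *)
Lemma monomial_holomorphic H D i j : hamiltonian D -> (i + j < m)%N ->
  holomorphic (hurwitz_iota H) D (hurwitz_S H ^+ i * hurwitz_T H ^+ j : _^o).
Proof.
move=> hD ij O O_ring; have S0 := hurwitz_S_neq0 H; have T0 := hurwitz_T_neq0 H.
have [k ijk] : exists k, (i + j + k = m.-1)%N by exists (m.-1 - (i + j))%N; lia.
have m0 : (0 < m)%N by lia.
have jki : (j + k + i = m.-1)%N by lia.
set S := hurwitz_S H in S0 *; set T := hurwitz_T H in T0 *.
have hD1 := rot_hamiltonian hD; have hD2 := rot_hamiltonian hD1.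
have case1 : O S -> O T -> holomorphic_at D O (S ^+ i * T ^+ j : _^o).
  exact: affine_monomial.
have case2 : O (T / S) -> O S^-1 -> holomorphic_at D O (S ^+ i * T ^+ j : _^o).
  move=> O1 O2; apply/holomorphic_at_rot; rewrite (@rot_monomial H _ _ _ ijk) //.
  exact: (@affine_monomial (hurwitz_rot H)).
have case3 : O T^-1 -> O (S / T) -> holomorphic_at D O (S ^+ i * T ^+ j : _^o).
  move=> O1 O2; apply/holomorphic_at_rot; rewrite (@rot_monomial H _ _ _ ijk) //.
  apply/(@holomorphic_at_rot (hurwitz_rot H)); rewrite (@rot_monomial (hurwitz_rot H) _ _ _ jki) //.
  apply: (@affine_monomial (hurwitz_rot (hurwitz_rot H))) => //=.
    by rewrite invf_div mulrA [_ * S]mulrC -/S mulfV // mul1r.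
  by rewrite invf_div.
have [_ _ _ _ tot] := O_ring.
have OV x : x != 0 -> ~ O x -> O x^-1 by move=> x0; case: (tot x x0).
have [OS|/(OV _ S0) OVS] := classic (O S).
  have [OT|/(OV _ T0) OVT] := classic (O T); first exact: case1.
  by apply: case3 => //; apply: (vr_mul O_ring).
have [OTS|/OV OST] := classic (O (T / S)); first exact: case2.
have {}OST : O (S / T) by rewrite -invf_div; apply: OST; rewrite mulf_neq0 ?invr_eq0.
apply: case3 => //; rewrite -[T^-1](mulKf S0); exact: (vr_mul O_ring).
Qed.

(* The point (0, 0) is the vertex (0 : 0 : 1) of the projective curve. *)
Lemma vertex_valuation H : exists v,
  [/\ is_valuation (@regular_at m K H 0 0) v, v (hurwitz_T H) = 1,
      v (hurwitz_S H) = m.+1%:Z,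
      (forall c, c != 0 -> v (hurwitz_iota H c) = 0) &
      (forall z c, spec 0 0 z c -> c != 0 -> z != 0 /\ v z = 0)].
Proof.
set S := hurwitz_S H; set T := hurwitz_T H.
have H0 : (0 : K) ^+ m.+1 * 0 + 0 ^+ m.+1 + 0 = 0 by rewrite mulr0 expr0n /= !addr0.
have f0 : m.+1%:R * 0 ^+ m * 0 + 1 != 0 :> K by rewrite mulr0 add0r oner_eq0.
have pT := @local_parameter_T m K H 0 0 H0 f0.
have [v [vP vT]] := local_parameter_valuation H0 pT.
rewrite rmorph0 subr0 -/T in vT.
have S0 : S != 0 := hurwitz_S_neq0 H; have T0 : T != 0 := hurwitz_T_neq0 H.
(* The curve equation reads S (1 + S^m T) = - T^(m+1), and the bracket is a unit at the origin; this
   gives the order of S. *)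
have [u0 vu] : 1 + S ^+ m * T != 0 /\ v (1 + S ^+ m * T) = 0.
  apply: (spec_val_eq0 H0 vP (c := 1)); last exact: oner_neq0.
  have -> : 1 = 1 + 0 ^+ m * 0 :> K by rewrite mulr0 addr0.
  apply: specD => //; first by rewrite -(rmorph1 (hurwitz_iota H)); apply: spec_iota.
  by apply: specM; [apply/specX/spec_S | apply: spec_T].
exists v; split=> //; [|by move=> c; apply: (val_const H0 vP)|by move=> z c; apply: spec_val_eq0].
have e : S * (1 + S ^+ m * T) = -1 * T ^+ m.+1.
  by apply/eqP; rewrite mulN1r -addr_eq0 mulrDr mulr1 mulrA -exprS -addrA addrC hurwitz_equation.
have N10 : -1 != 0 :> hurwitz_field H by rewrite oppr_eq0 oner_eq0.
have vN1 : v (-1) = 0.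
  by rewrite -(rmorph1 (hurwitz_iota H)) -rmorphN (val_const H0 vP) // oppr_eq0 oner_eq0.
have := congr1 v e; rewrite !(val_mul vP) ?expf_neq0 // vu addr0 vN1 add0r => ->.
by rewrite (valX vP) // vT pmulrn -mulrzr mul1r intz.
Qed.

End HolomorphicForms.

(** * The Kummer expansion *)

Section Kummer.

Variables (m : nat) (K : closedFieldType) (H : hurwitzField m.+1 K).
Local Notation F := (hurwitz_field H).
Local Notation iota := (hurwitz_iota H).
Local Notation S := (hurwitz_S H).
Local Notation T := (hurwitz_T H).
Local Notation ev := (gen_ev H).
Local Notation N := (m * m.+1).+1.

Let S0 : S != 0 := hurwitz_S_neq0 H.
Let T0 : T != 0 := hurwitz_T_neq0 H.

Definition kx : F := S ^+ m * T.
Local Notation x := kx.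
Local Notation xp := (ev1 iota x).

Lemma kx_neq0 : x != 0.
Proof. by rewrite mulf_neq0 ?expf_neq0. Qed.

Lemma kx_add1 : 1 + x = - (T ^+ m.+1 / S).
Proof.
apply: (mulfI S0); rewrite mulrN [S * (_ / _)]mulrC divfK // mulrDr mulr1 /x mulrA -exprS.
by apply/eqP; rewrite -addr_eq0 -addrA addrC hurwitz_equation.
Qed.

Lemma kx_add1_neq0 : 1 + x != 0.
Proof. by rewrite kx_add1 oppr_eq0 mulf_neq0 ?invr_eq0 ?expf_neq0. Qed.

Lemma kummer_equation : S ^+ N * (1 + x) = - x ^+ m.+1.
Proof.
rewrite kx_add1 mulrN exprMn -exprM; congr (- _).
by rewrite exprS -mulrA mulrCA [S * _]mulrC divfK.
Qed.

(** An algebraic x would be a constant, but its order at the origin is N > 0. *)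
Lemma xp_eq0 p : (xp p == 0) = (p == 0).
Proof.
apply/eqP/eqP => [p0|->]; last exact: rmorph0.
apply/eqP; apply: contraT => pn0.
have [c xc] : exists c, x = iota c.
  by apply: transcendental_const; exists p => //; apply/rootP; rewrite -ev1E.
have [v [vP vT vS vc _]] := vertex_valuation H.
have vx : v x = N.
  rewrite /x (val_mul vP) ?expf_neq0 // (valX vP) // vS vT.
  by rewrite pmulrn -mulrzr intz; lia.
have c0 : c != 0 by apply: contraNneq kx_neq0 => c0; rewrite xc c0 rmorph0.
by move: vx; rewrite xc vc.
Qed.

Local Notation E := (ev2 iota x S).

Definition kummer_rep z := exists (q : {poly K}) (P : {poly {poly K}}),
  q != 0 /\ xp q * z = E P.

Lemma kummer_rep_mul z z' : kummer_rep z -> kummer_rep z' -> kummer_rep (z * z').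
Proof.
move=> [q [P [q0 e]]] [q' [P' [q'0 e']]]; exists (q * q'), (P * P').
by rewrite !mulf_neq0 //; split=> //; rewrite !rmorphM /= -e -e'; ring.
Qed.

Lemma kummer_rep_add z z' : kummer_rep z -> kummer_rep z' -> kummer_rep (z + z').
Proof.
move=> [q [P [q0 e]]] [q' [P' [q'0 e']]]; exists (q * q'), (q'%:P * P + q%:P * P').
rewrite !mulf_neq0 //; split=> //; rewrite rmorphD !rmorphM /= !ev2C -e -e'; ring.
Qed.

Lemma kummer_rep_E P : kummer_rep (E P).
Proof. by exists 1, P; rewrite oner_eq0 rmorph1 mul1r. Qed.

Lemma kummer_rep_xp p : kummer_rep (xp p).
Proof. by rewrite -(ev2C iota x S); apply: kummer_rep_E. Qed.

Lemma kummer_rep_const c : kummer_rep (iota c).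
Proof. by rewrite -(ev1C iota x); apply: kummer_rep_xp. Qed.

Lemma kummer_rep_S : kummer_rep S.
Proof. by rewrite -[S in kummer_rep S](ev2X iota x S); apply: kummer_rep_E. Qed.

Lemma kummer_rep_x : kummer_rep x.
Proof. by rewrite -[x in kummer_rep x](ev1X iota x); apply: kummer_rep_xp. Qed.

Lemma kummer_rep_exp z k : kummer_rep z -> kummer_rep (z ^+ k).
Proof.
move=> Vz; elim: k => [|k IH]; last by rewrite exprS; apply: kummer_rep_mul.
by rewrite expr0 -(rmorph1 iota); apply: kummer_rep_const.
Qed.

Lemma kummer_rep_xpV q : q != 0 -> kummer_rep (xp q)^-1.
Proof. by move=> q0; exists q, 1; rewrite rmorph1 mulfV ?xp_eq0. Qed.

(** S - c divides S^N - c^N, and by the Kummer equation (1 + x)(S^N - c^N) is the polynomial q in x,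
    which is nonzero. *)
Lemma kummer_rep_SV c : kummer_rep (S - iota c)^-1.
Proof.
have Sc : S - iota c != 0 by rewrite subr_eq0 hurwitz_S_neq.
pose q : {poly K} := - 'X^(m.+1) - (c ^+ N)%:P * (1 + 'X).
have qE : xp q = (1 + x) * (S ^+ N - iota c ^+ N).
  rewrite mulrBr [_ * S ^+ N]mulrC kummer_equation rmorphB rmorphN rmorphM rmorphD rmorphXn.
  by rewrite /= ev1C ev1X rmorph1 rmorphXn /= [X in _ - X]mulrC.
have q0 : q != 0.
  apply/eqP => q0; have := congr1 (fun p : {poly K} => p.[0]) q0.
  rewrite /q !hornerE /= expr0n /= oppr0 sub0r ?mulr1 => /eqP.
  rewrite oppr_eq0 expf_eq0 /= => /eqP c0; move/eqP: q0.
  by rewrite /q c0 expr0n /= polyC0 mul0r subr0 oppr_eq0 expf_eq0 polyX_eq0.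
have -> : (S - iota c)^-1 =
    (1 + x) * (\sum_(i < N) S ^+ (N.-1 - i) * iota c ^+ i) * (xp q)^-1.
  have xq0 : xp q != 0 by rewrite xp_eq0.
  apply: (mulfI Sc); rewrite mulfV //; apply: (mulIf xq0).
  by rewrite mul1r qE -[RHS]mulrA divfK -?qE // qE subrXX; ring.
apply: kummer_rep_mul; last exact: kummer_rep_xpV.
apply: kummer_rep_mul.
  apply: kummer_rep_add; last exact: kummer_rep_x.
  by rewrite -(rmorph1 iota); apply: kummer_rep_const.
apply: big_ind => [|y z|i _].
- by rewrite -(rmorph0 iota); apply: kummer_rep_const.
- exact: kummer_rep_add.
apply: kummer_rep_mul; first exact/kummer_rep_exp/kummer_rep_S.
exact/kummer_rep_exp/kummer_rep_const.
Qed.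

Lemma kummer_rep_T : kummer_rep T.
Proof.
have -> : T = x * (S - iota 0)^-1 ^+ m.
  by rewrite rmorph0 subr0 exprVn /x mulrAC mulfV ?mul1r ?expf_neq0.
by apply: kummer_rep_mul; [apply: kummer_rep_x | apply/kummer_rep_exp/kummer_rep_SV].
Qed.

Lemma kummer_rep_ev1S p : kummer_rep (ev1 iota S p).
Proof.
elim/poly_ind: p => [|p c IH].
  by rewrite rmorph0 -(rmorph0 iota); apply: kummer_rep_const.
rewrite rmorphD rmorphM /= ev1X ev1C.
by apply: kummer_rep_add (kummer_rep_const c); apply: kummer_rep_mul kummer_rep_S.
Qed.

Lemma kummer_rep_ev P : kummer_rep (ev P).
Proof.
elim/poly_ind: P => [|P p IH].
  by rewrite rmorph0 -(rmorph0 iota); apply: kummer_rep_const.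
rewrite rmorphD rmorphM /= ev_X ev_C.
by apply: kummer_rep_add (kummer_rep_ev1S p); apply: kummer_rep_mul kummer_rep_T.
Qed.

(** A denominator from K[S, T] divides a polynomial in S, and this one splits over K into factors S
    - c, whose inverses are already known to lie in K(x)[S]. *)
Lemma kummer_repP z : kummer_rep z.
Proof.
have [P [Q [Q0 ->]]] := ev_frac z; apply: kummer_rep_mul; first exact: kummer_rep_ev.
have [V [g [g0 e]]] := ev_bezout Q0.
have gS0 : ev1 iota S g != 0 by rewrite ev1S_eq0.
have -> : (ev Q)^-1 = ev V * (ev1 iota S g)^-1.
  rewrite -e invfM mulrA mulfV ?mul1r //.
  by apply: contraNneq gS0 => V0; rewrite -e V0 mul0r.
apply: kummer_rep_mul; first exact: kummer_rep_ev.
have [r ->] := closed_field_poly_normal g.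
rewrite -mul_polyC rmorphM /= ev1C rmorph_prod invfM -fmorphV.
apply: kummer_rep_mul; first exact: kummer_rep_const.
elim: r => [|c r IH]; first by rewrite big_nil invr1 -(rmorph1 iota); apply: kummer_rep_const.
rewrite big_cons invfM; apply: kummer_rep_mul => //.
by rewrite rmorphB /= ev1X ev1C; apply: kummer_rep_SV.
Qed.

Lemma kummer_expansion z : exists (q : {poly K}) (p : 'I_N -> {poly K}),
  q != 0 /\ xp q * z = \sum_(k < N) xp (p k) * S ^+ k.
Proof.
have [q [P [q0 e]]] := kummer_repP z.
(* The Kummer equation as a polynomial in S over K[x]; the remainder modulo G has degree below N in
   S. *)
pose G : {poly {poly K}} := (1 + 'X)%:P * 'X^N + ('X^(m.+1))%:P.
have X10 : 1 + 'X != 0 :> {poly K} by rewrite addrC -size_poly_eq0 size_XaddC.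
have sG : size G = N.+1.
  have sXN : size ((1 + 'X)%:P * 'X^N : {poly {poly K}}) = N.+1.
    by rewrite mul_polyC size_scale // size_polyXn.
  by rewrite size_polyDl sXN // (leq_ltn_trans (size_polyC_leq1 _)).
have G0 : G != 0 by rewrite -size_poly_eq0 sG.
have EG : E G = 0.
  rewrite rmorphD rmorphM rmorphXn /= !ev2C ev2X rmorphD rmorph1 rmorphXn /= ev1X.
  by rewrite mulrC kummer_equation addNr.
have eP := Pdiv.Idomain.divp_eq P G.
set c := _ ^+ _ in eP; set Q := Pdiv.Idomain.divp _ _ in eP.
set R := Pdiv.Idomain.modp _ _ in eP.
have c0 : c != 0 by rewrite expf_neq0 // lead_coef_eq0.
have sR : (size R <= N)%N by rewrite -ltnS -sG Pdiv.Idomain.ltn_modp.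
exists (c * q), (fun k : 'I_N => R`_k); rewrite mulf_neq0 //; split=> //.
have -> : xp (c * q) * z = E R.
  have := congr1 E eP; rewrite -mul_polyC rmorphM rmorphD rmorphM /= EG mulr0 add0r ev2C.
  by rewrite -e rmorphM mulrA.
rewrite ev2E (horner_coef_wide _ (n := N)); last exact: leq_trans (size_poly _ _) sR.
by apply: eq_bigr => k _; rewrite coef_map.
Qed.

End Kummer.

Lemma roots_of_const (K : closedFieldType) n (a : K) :
  n.+1%:R != 0 :> K -> a != 0 ->
  exists rs : seq K, [/\ uniq rs, size rs = n.+1 & forall s, s \in rs -> s ^+ n.+1 = a].
Proof.
move=> n0 a0.
have sX b : size ('X^(n.+1) - b%:P : {poly K}) = n.+2 by rewrite size_XnsubC.
have [s1 s1a] : exists s1, s1 ^+ n.+1 = a.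
  have [|s1] := closed_rootP ('X^(n.+1) - a%:P) _; first by rewrite sX.
  by rewrite rootE !hornerE subr_eq0 => /eqP; exists s1.
have s10 : s1 != 0 by apply: contraNneq a0 => s0; rewrite -s1a s0 expr0n.
have [r er] := closed_field_poly_normal ('X^(n.+1) - 1%:P : {poly K}).
rewrite lead_coefDl ?size_polyXn ?size_polyN ?size_poly1 // lead_coefXn scale1r in er.
have ur : uniq r by rewrite -separable_prod_XsubC -er separable_Xn_sub_1.
exists [seq z * s1 | z <- r]; split.
- by rewrite map_inj_uniq //; apply: mulIf.
- by rewrite size_map; apply: succn_inj; rewrite -(size_prod_XsubC r id) -er sX.
- move=> _ /mapP[z zr ->]; rewrite exprMn s1a.
  have : root ('X^(n.+1) - 1%:P) z by rewrite er root_prod_XsubC.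
  by rewrite rootE !hornerE subr_eq0 => /eqP ->; rewrite mul1r.
Qed.

Section Spanning.

Variables (m : nat) (K : closedFieldType).
Hypothesis N0 : (m * m.+1).+1%:R != 0 :> K.
Local Notation N := (m * m.+1).+1.

Section Regular.

Variable H : hurwitzField m.+1 K.
Local Notation F := (hurwitz_field H).
Local Notation iota := (hurwitz_iota H).
Local Notation S := (hurwitz_S H).
Local Notation T := (hurwitz_T H).
Local Notation x := (kx H).
Local Notation xp := (ev1 iota x).

Lemma spec_xp s0 t0 c p : s0 ^+ m.+1 * t0 + t0 ^+ m.+1 + s0 = 0 ->
  spec s0 t0 x c -> spec s0 t0 (xp p) p.[c].
Proof. by move=> H0; rewrite ev1E; apply: spec_horner. Qed.

(* Over x = c there are N points, and their S-coordinates are the N-th roots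
   of a constant: regularity at all of them bounds each coefficient. *)
Lemma regular_pole w q (p : 'I_N -> {poly K}) c :
  (forall s0 t0, s0 ^+ m.+1 * t0 + t0 ^+ m.+1 + s0 = 0 -> regular_at s0 t0 w) ->
  xp q * w = \sum_(k < N) xp (p k) * S ^+ k ->
  root q c -> c != 0 -> 1 + c != 0 -> forall k, root (p k) c.
Proof.
move=> Rw e qc c0 c1.
pose a := - c ^+ m.+1 / (1 + c).
have a0 : a != 0 by rewrite mulf_neq0 ?invr_eq0 // oppr_eq0 expf_neq0.
have [rs [urs srs rsE]] := roots_of_const N0 a0.
pose r := \poly_(k < N) (p (inord k)).[c].
have r_root s0 : s0 \in rs -> root r s0.
  move=> /rsE s0N; have s00 : s0 != 0.
    by apply: contraNneq a0 => s00; rewrite -s0N s00 expr0n.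
  have sm0 := expf_neq0 m s00.
  (* The choice that gives x the value c at (s0, t0); the point lies on the curve because s0^N = a
     is the Kummer equation at x = c. *)
  pose t0 := c / s0 ^+ m.
  have H0 : s0 ^+ m.+1 * t0 + t0 ^+ m.+1 + s0 = 0.
    have e1 : s0 ^+ m.+1 * t0 = s0 * c by rewrite exprS /t0 -mulrA [s0 ^+ m * _]mulrC divfK.
    have e2 : t0 ^+ m.+1 = - s0 * (1 + c).
      rewrite /t0 expr_div_n -exprM; apply: (mulIf (expf_neq0 (m * m.+1) s00)).
      rewrite divfK ?expf_neq0 // mulrAC mulNr -exprS s0N /a.
      by field.
    by rewrite e1 e2; ring.
  have sx : spec s0 t0 x c.
    have -> : c = s0 ^+ m * t0 by rewrite /t0 mulrC divfK.
    by apply: specM; [apply/specX/spec_S | apply: spec_T].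
  have [d sw] := Rw _ _ H0.
  have s1 := specM (spec_xp q H0 sx) sw.
  have s2 : spec s0 t0 (\sum_(k < N) xp (p k) * S ^+ k) (\sum_(k < N) (p k).[c] * s0 ^+ k).
    apply: spec_sum => // k; apply: specM; first exact: spec_xp.
    exact/specX/spec_S.
  rewrite e in s1; have := spec_fun H0 s1 s2; rewrite (rootP qc) mul0r => e0.
  rewrite rootE horner_poly; apply/eqP; rewrite [RHS]e0.
  by apply: eq_bigr => k _; rewrite inord_val.
have r0 : r = 0.
  apply/eqP; apply: contraT => r0.
  have /(max_poly_roots r0) : all (root r) rs by apply/allP.
  by move=> /(_ urs); rewrite srs ltnNge size_poly.
move=> k; have := congr1 (fun p : {poly K} => p`_k) r0.
by rewrite coef_poly ltn_ord inord_val coef0 rootE => ->.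
Qed.

(** At a root c of q other than 0 and -1 all coefficients vanish, so X - c cancels. The values 0, -1
    and infinity of x are excepted because they belong to the vertices, where the N points over x
    come together. *)
Lemma regular_expansion w :
  (forall s0 t0, s0 ^+ m.+1 * t0 + t0 ^+ m.+1 + s0 = 0 -> regular_at s0 t0 w) ->
  exists (q : {poly K}) (p : 'I_N -> {poly K}),
  [/\ q != 0, forall c, root q c -> c = 0 \/ 1 + c = 0 &
      xp q * w = \sum_(k < N) xp (p k) * S ^+ k].
Proof.
move=> Rw; have [q [p [q0 e]]] := kummer_expansion w.
move: {2}(size q) (leqnn (size q)) => d.
elim: d q p q0 e => [|d IH] q p q0 e; first by rewrite leqn0 size_poly_eq0 (negPf q0).
move=> le_q; have [[c [qc c0 c1]]|good] :=
  classic (exists c, [/\ root q c, c != 0 & 1 + c != 0]); last first.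
  exists q, p; split=> // c qc; have [->|c0] := eqVneq c 0; first by left.
  right; apply/eqP; apply: contraT => c1; case: good; by exists c.
have pc := regular_pole Rw e qc c0 c1.
have /factor_theorem[q' eq] := qc.
have q'0 : q' != 0 by apply: contraNneq q0 => q'0; rewrite eq q'0 mul0r.
have ep k : p k = p k %/ ('X - c%:P) * ('X - c%:P) by rewrite divpK // dvdp_XsubCl.
apply: (IH q' (fun k => p k %/ ('X - c%:P)) q'0).
  have Xc : xp ('X - c%:P) != 0 by rewrite xp_eq0 polyXsubC_eq0.
  apply: (mulfI Xc); rewrite mulrA -rmorphM [_ * q']mulrC -eq e mulr_sumr.
  by apply: eq_bigr => k _; rewrite mulrA -rmorphM [_ * (_ %/ _)]mulrC -ep.
rewrite -ltnS; apply: leq_trans le_q; rewrite eq size_Mmonic ?monicXsubC //.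
by rewrite size_XsubC addn2.
Qed.

Lemma xp_split q : q != 0 -> (forall c, root q c -> c = 0 \/ 1 + c = 0) ->
  exists (c : K) i j, c != 0 /\ xp q = iota c * x ^+ i * (1 + x) ^+ j.
Proof.
have [r ->] := closed_field_poly_normal q.
rewrite scale_poly_eq0 negb_or => /andP[c0 _] rE.
exists (lead_coef q).
have {}rE c : c \in r -> c = 0 \/ 1 + c = 0.
  by move=> cr; apply: rE; rewrite rootZ // root_prod_XsubC.
rewrite -mul_polyC rmorphM /= ev1C rmorph_prod /=.
elim: r rE => [|c r IH] rE.
  by exists 0%N, 0%N; split=> //; rewrite big_nil !expr0 !mulr1.
have [d dr|i [j [_ e]]] := IH; first by apply: rE; rewrite inE dr orbT.
rewrite big_cons mulrCA e rmorphB /= ev1X ev1C.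
have [->|c1] := rE c (mem_head _ _).
  by exists i.+1, j; split=> //; rewrite rmorph0 subr0 exprS; ring.
exists i, j.+1; split=> //.
have -> : c = -1 by apply/eqP; rewrite -addr_eq0 addrC c1.
by rewrite rmorphN rmorph1 opprK exprS; ring.
Qed.

Lemma poly_split (p : {poly K}) : p != 0 -> exists a b g,
  [/\ g.[0] != 0, g.[-1] != 0 & xp p = xp g * x ^+ a * (1 + x) ^+ b].
Proof.
move=> p0; have [a [g1 /implyP/(_ p0) g10 e1]] := multiplicity_XsubC p 0.
have g1n0 : g1 != 0 by apply: contraNneq g10 => ->; rewrite root0.
have [b [g /implyP/(_ g1n0) g0 e2]] := multiplicity_XsubC g1 (-1).
exists a, b, g; split=> //.
  by move: g10; rewrite rootE e2 hornerM mulf_eq0 negb_or => /andP[].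
rewrite e1 e2 !rmorphM !rmorphXn !rmorphB /= ev1X !ev1C rmorph0 subr0 rmorphN rmorph1.
by rewrite opprK [x + 1]addrC mulrAC.
Qed.

End Regular.

End Spanning.

(** The hypotheses are the conditions at the three vertices. With n = m + 1 and l = m - 1 - i - j
    they make n i + j, n j + l and n l + i nonnegative, a cyclic system. A negative i would force j
    >= - n i and l > 0, so that i + j + l exceeds m - 1; the other cases are alike. Finally i + n l
    < N forces d = 0. *)
Lemma triangle_bounds (m : nat) (i j d : int) : 0 <= d ->
  0 <= m.+1%:Z * i + j -> 0 <= m%:Z * j - i + (m%:Z - 1) ->
  (m * m.+1).+1%:Z * d <= i + m.+1%:Z * (m%:Z - 1 - i - j) ->
  [/\ 0 <= i, 0 <= j, i + j < m%:Z & d = 0].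
Proof.
move=> d0; have [l el] : exists l, l = m%:Z - 1 - i - j by eexists.
rewrite -el => h1 h2 h3.
have {}h2 : 0 <= m.+1%:Z * j + l by rewrite el -[m.+1%:Z]/(1%:Z + m%:Z); lia.
have h4 : 0 <= i + m.+1%:Z * l by apply: le_trans h3; apply: mulr_ge0.
have e : i + j + l = m%:Z - 1 by lia.
have M0 : 0 <= m%:Z by [].
have M1 : m.+1%:Z = m%:Z + 1 by lia.
have i0 : 0 <= i by rewrite leNgt; apply/negP => i0; rewrite M1 in h1 h2 h4; nia.
have j0 : 0 <= j by rewrite leNgt; apply/negP => j0; rewrite M1 in h1 h2 h4; nia.
have l0 : 0 <= l by rewrite leNgt; apply/negP => l0; rewrite M1 in h1 h2 h4; nia.
split=> //; first by lia.
have : (m * m.+1).+1%:Z * d < (m * m.+1).+1%:Z.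
  by apply: le_lt_trans h3 _; nia.
by nia.
Qed.

Section PoleValuation.

Variables (K F : fieldType) (iota : {rmorphism K -> F}) (R : F -> Prop) (v : F -> int).
Hypotheses (R1 : R 1) (RB : forall x y, R x -> R y -> R (x - y)).
Hypothesis vP : is_valuation R v.
Hypothesis v_const : forall c, c != 0 -> v (iota c) = 0.

Lemma val_pole x (p : {poly K}) : x != 0 -> v x < 0 -> p != 0 ->
  ev1 iota x p != 0 /\ v (ev1 iota x p) = v x * (size p).-1.
Proof.
move=> x0 vx; elim/poly_ind: p => [|p c IH]; first by rewrite eqxx.
rewrite -size_poly_eq0 size_MXaddC; have [->|p0] := eqVneq p 0.
  case: ifP => //= /negbT c0 _; rewrite mul0r add0r ev1C fmorph_eq0 v_const //.
  by rewrite size_poly0 mulr0.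
move=> _ /=; have [px0 vpx] := IH p0.
rewrite rmorphD rmorphM /= ev1X ev1C.
have px0' : ev1 iota x p * x != 0 by rewrite mulf_neq0.
have vpx' : v (ev1 iota x p * x) = v x * size p.
  rewrite (val_mul vP) // vpx -[X in _ + X]mulr1 -mulrDr.
  by rewrite -[in RHS](prednK (_ : 0 < size p)%N) ?lt0n ?size_poly_eq0 // -addn1 PoszD.
have vpx'0 : v (ev1 iota x p * x) < 0.
  by rewrite vpx' nmulr_rlt0 // ltz_nat lt0n size_poly_eq0.
have [|u0 vu] := @val_add1 _ _ R1 RB _ vP (iota c / (ev1 iota x p * x)).
  have [->|c0] := eqVneq c 0; first by left; rewrite rmorph0 mul0r.
  right; rewrite (val_mul vP) ?invr_eq0 ?fmorph_eq0 // v_const // (valV vP) //.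
  by rewrite add0r; lia.
have -> : ev1 iota x p * x + iota c =
    ev1 iota x p * x * (1 + iota c / (ev1 iota x p * x)).
  by rewrite mulrDr mulr1 mulrCA mulfV // mulr1.
by rewrite mulf_neq0 // (val_mul vP) // vu addr0 vpx'.
Qed.

End PoleValuation.

(** * Orders at the three vertices *)

Section VertexValuations.

Variables (m : nat) (K : closedFieldType).
Local Notation N := (m * m.+1).+1.

(** The rotation acts on x by a Moebius transformation that permutes 0, -1 and infinity
    cyclically. *)
Lemma kx_rot (H : hurwitzField m.+1 K) : kx H = - (1 + kx (hurwitz_rot H))^-1.
Proof.
have S0 := hurwitz_S_neq0 H; have T0 := hurwitz_T_neq0 H.
rewrite (kx_add1 (hurwitz_rot H)) /= exprVn invrN opprK invf_div invrK /kx exprS.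
by field; rewrite S0.
Qed.

Lemma spec_kx (H : hurwitzField m.+1 K) : spec 0 0 (kx H) 0.
Proof.
rewrite -[X in spec _ _ _ X](mulr0 (0 ^+ m)).
by apply: specM; [apply/specX/spec_S | apply: spec_T].
Qed.

Lemma spec_kx_rot (H : hurwitzField m.+1 K) : spec (H := hurwitz_rot H) 0 0 (kx H) (-1).
Proof.
have H0 : (0 : K) ^+ m.+1 * 0 + 0 ^+ m.+1 + 0 = 0 by rewrite mulr0 expr0n /= !addr0.
rewrite kx_rot -[X in spec _ _ _ (- X)]invr1; apply: specN; apply: specV; last exact: oner_neq0.
rewrite -[X in spec _ _ _ X]addr0; apply: specD => //; last exact: spec_kx.
by rewrite -(rmorph1 (hurwitz_iota H)); apply: (spec_iota (hurwitz_rot H)).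
Qed.

Section Values.

Variable H : hurwitzField m.+1 K.
Local Notation iota := (hurwitz_iota H).
Local Notation S := (hurwitz_S H).
Local Notation T := (hurwitz_T H).
Local Notation xp := (ev1 iota (kx H)).

Lemma vertex1 : exists v,
  [/\ is_valuation (@regular_at m K H 0 0) v, v S = m.+1%:Z, v T = 1,
      forall c, c != 0 -> v (iota c) = 0 &
      forall g, g.[0] != 0 -> v (xp g) = 0].
Proof.
have [v [vP vT vS vc v0]] := vertex_valuation H; exists v; split=> // g g0.
have [|_ ->//] := v0 (xp g) g.[0] _ g0.
by rewrite ev1E; apply: spec_horner (spec_kx H); rewrite mulr0 expr0n /= !addr0.
Qed.

Lemma vertex2 : exists v,
  [/\ is_valuation (@regular_at m K (hurwitz_rot H) 0 0) v, v S = -1, v T = m%:Z,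
      forall c, c != 0 -> v (iota c) = 0 &
      forall g, g.[-1] != 0 -> v (xp g) = 0].
Proof.
have S0 := hurwitz_S_neq0 H; have T0 := hurwitz_T_neq0 H.
have [v [vP vT vS vc v0]] := vertex_valuation (hurwitz_rot H); exists v.
have vS1 : v S = -1 by apply: oppr_inj; rewrite opprK -vT /= (valV vP).
split=> // [|g g0].
  move: vS; rewrite /= (val_mul vP) ?invr_eq0 // (valV vP) // vS1.
  by lia.
have [|_ ->//] := v0 (xp g) g.[-1] _ g0.
rewrite ev1E; apply: (spec_horner (H := hurwitz_rot H)); last exact: spec_kx_rot.
by rewrite mulr0 expr0n /= !addr0.
Qed.

Lemma vertex3 : exists v,
  [/\ is_valuation (@regular_at m K (hurwitz_rot (hurwitz_rot H)) 0 0) v,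
      v S = - m%:Z, v T = - m.+1%:Z,
      forall c, c != 0 -> v (iota c) = 0 &
      forall g, g != 0 -> v (xp g) = - (N%:Z * (size g).-1)].
Proof.
have S0 := hurwitz_S_neq0 H; have T0 := hurwitz_T_neq0 H.
have [v [vP vT vS vc v0]] := vertex_valuation (hurwitz_rot (hurwitz_rot H)); exists v.
have TS0 : T / S != 0 by rewrite mulf_neq0 ?invr_eq0.
have vT1 : v T = - m.+1%:Z.
  have -> : T = (S^-1 / (T / S))^-1 by rewrite invfM !invrK mulrC divfK.
  by rewrite (valV vP) ?mulf_neq0 ?invr_eq0 // vS.
have vS1 : v S = - m%:Z.
  move: vT; rewrite /= (valV vP) // (val_mul vP) ?invr_eq0 // (valV vP) // vT1.
  by lia.
split=> // g g0.
have vx : v (kx H) = - N%:Z.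
  rewrite /kx (val_mul vP) ?expf_neq0 // (valX vP) // vS1 vT1.
  by rewrite mulNrn pmulrn -mulrzr intz; lia.
have H0 : (0 : K) ^+ m.+1 * 0 + 0 ^+ m.+1 + 0 = 0 by rewrite mulr0 expr0n /= !addr0.
have R1 := regular1 (hurwitz_rot (hurwitz_rot H)) 0 0.
have RB := @regularB _ _ (hurwitz_rot (hurwitz_rot H)) _ _ H0.
have [|_ ->] := @val_pole _ _ iota _ _ R1 RB vP vc (kx H) _ (kx_neq0 H) _ g0.
  by rewrite vx; lia.
by rewrite vx mulNr.
Qed.

End Values.

End VertexValuations.

(** * The space of holomorphic forms *)

Lemma eq_of_small_multiple (n k l : nat) (u : int) :
  (k < n)%N -> (l < n)%N -> n%:Z * u = k%:Z - l%:Z -> k = l.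
Proof.
move=> kn ln e; have u0 : u = 0.
  apply/eqP; apply: contraT => u0; have [u1|u1] : u <= -1 \/ 1 <= u by lia.
    have : n%:Z * u <= n%:Z * -1 by apply: ler_wpM2l.
    by lia.
  have : n%:Z * 1 <= n%:Z * u by apply: ler_wpM2l.
  by lia.
by move: e; rewrite u0 mulr0; lia.
Qed.

Section Residues.

Variables (m k l : nat) (a b a' b' : int).
Hypotheses (kN : (k < (m * m.+1).+1)%N) (lN : (l < (m * m.+1).+1)%N).

(** With n = m + 1, the left side is N a + n k, so the order of the k-th Kummer component at the
    first vertex is n k modulo N. At the other two vertices the residues are - k and - m k. As m n =
    -1 modulo N, each residue determines k. *)
Lemma residue1 : m.+1%:Z * (m%:Z * a - b + k%:Z) + 1 * (a + m.+1%:Z * b) =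
  m.+1%:Z * (m%:Z * a' - b' + l%:Z) + 1 * (a' + m.+1%:Z * b') -> k = l.
Proof.
move=> /(congr1 (fun z => m%:Z * z)) e.
apply: (eq_of_small_multiple (u := k%:Z - l%:Z + m%:Z * (a - a')) kN lN).
lia.
Qed.

Lemma residue2 : -1 * (m%:Z * a - b + k%:Z) + m%:Z * (a + m.+1%:Z * b) =
  -1 * (m%:Z * a' - b' + l%:Z) + m%:Z * (a' + m.+1%:Z * b') -> k = l.
Proof. by move=> e; apply: (eq_of_small_multiple (u := b - b') kN lN); lia. Qed.

Lemma residue3 d d' :
  - ((m * m.+1).+1%:Z * d) + - m%:Z * (m%:Z * a - b + k%:Z) +
    - m.+1%:Z * (a + m.+1%:Z * b) =
  - ((m * m.+1).+1%:Z * d') + - m%:Z * (m%:Z * a' - b' + l%:Z) +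
    - m.+1%:Z * (a' + m.+1%:Z * b') -> k = l.
Proof.
move=> /(congr1 (fun z => m.+1%:Z * z)) e; pose X := d + a + b - (d' + a' + b').
by apply: (eq_of_small_multiple (u := k%:Z - l%:Z + m.+1%:Z * X) kN lN); rewrite /X; lia.
Qed.

End Residues.

Section HolomorphicSpan.

Variables (m : nat) (K : closedFieldType) (H : hurwitzField m.+1 K).
Hypothesis N0 : (m * m.+1).+1%:R != 0 :> K.
Local Notation N := (m * m.+1).+1.
Local Notation F := (hurwitz_field H).
Local Notation iota := (hurwitz_iota H).
Local Notation S := (hurwitz_S H).
Local Notation T := (hurwitz_T H).
Local Notation x := (kx H).
Local Notation xp := (ev1 iota x).

Let S0 : S != 0 := hurwitz_S_neq0 H.
Let T0 : T != 0 := hurwitz_T_neq0 H.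

Lemma kx_laurent (a b : int) (k : nat) :
  x ^ a * (T ^+ m.+1 / S) ^ b * S ^+ k =
  S ^ (m%:Z * a - b + k%:Z) * T ^ (a + m.+1%:Z * b).
Proof.
rewrite /kx !expfzMl !exprnP !exprz_exp exprz_inv !expfzDr //.
by rewrite [T ^ _ * S ^ (- b)]mulrC [X in X * S ^ _ = _]mulrACA [LHS]mulrAC.
Qed.

(** As x = S^m T and 1 + x = - T^n / S with n = m + 1, all powers of x and 1 + x are absorbed into a
    Laurent monomial in S and T. The remaining factor g(x) is a unit at the first two vertices, and
    at the third one its degree determines its pole. *)
Lemma laurent_expansion w :
  (forall s0 t0, s0 ^+ m.+1 * t0 + t0 ^+ m.+1 + s0 = 0 -> regular_at s0 t0 w) ->
  exists z : 'I_N -> F, w = \sum_k z k /\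
  forall k, z k != 0 -> exists (c : K) (a b : int) (g : {poly K}),
    [/\ c != 0, g.[0] != 0, g.[-1] != 0 &
        z k = iota c * xp g * S ^ (m%:Z * a - b + k%:Z) * T ^ (a + m.+1%:Z * b)].
Proof.
move=> /(regular_expansion N0)[q [p [q0 q_roots e]]].
have [d [i [j [d0 eq]]]] := xp_split H q0 q_roots.
have xq0 : xp q != 0 by rewrite xp_eq0.
have x0 := kx_neq0 H; have x10 := kx_add1_neq0 H.
exists (fun k => xp (p k) * S ^+ k / xp q); split.
  by rewrite -mulr_suml -e mulrC mulKf.
move=> k zk0; have pk0 : p k != 0.
  by apply: contraNneq zk0 => ->; rewrite rmorph0 !mul0r.
have [a [b [g [g0 g1 ->]]]] := poly_split H pk0.
(* The signs come from replacing 1 + x by - T^(m+1) / S. *)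
exists ((-1) ^+ b / (-1) ^+ j / d), (a%:Z - i%:Z), (b%:Z - j%:Z), g; split=> //.
  by rewrite !mulf_neq0 ?invr_eq0 ?expf_neq0 // oppr_eq0 oner_eq0.
rewrite -[RHS]mulrA -kx_laurent eq.
have B0 : T ^+ m.+1 / S != 0 by rewrite mulf_neq0 ?invr_eq0 ?expf_neq0.
have expB (y : F) (c l : nat) : y != 0 -> y ^ (c%:Z - l%:Z) = y ^+ c / y ^+ l.
  by move=> y0; rewrite expfzDr // -exprnN.
rewrite !expB // kx_add1; set B := _ / S in B0 *; rewrite -[- B]mulN1r.
rewrite !(exprMn _ (-1) B).
have iN k' : iota ((-1) ^+ k') = (-1) ^+ k' by rewrite rmorphXn rmorphN rmorph1.
rewrite !fmorph_div /= !iN.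
have N1 k' : (-1) ^+ k' != 0 :> F by rewrite expf_neq0 // oppr_eq0 oner_eq0.
have id0 : iota d != 0 by rewrite fmorph_eq0.
move: (N1 b) (N1 j) (expf_neq0 i x0) (expf_neq0 j B0).
move: ((-1) ^+ b) ((-1) ^+ j) (x ^+ i) (B ^+ j) => u u' xi Bj u0 u'0 xi0 Bj0.
by field; rewrite u'0 id0 xi0 Bj0.
Qed.

Definition monomial (u : 'I_m * 'I_m) : F := S ^+ u.1 * T ^+ u.2.

Definition in_span (w : F) := exists c : 'I_m * 'I_m -> K,
  w = \sum_(u : 'I_m * 'I_m | (u.1 + u.2 < m)%N) iota (c u) * monomial u.

Lemma in_span_add w w' : in_span w -> in_span w' -> in_span (w + w').
Proof.
move=> [c ->] [c' ->]; exists (fun u => c u + c' u).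
by rewrite -big_split; apply: eq_bigr => u _; rewrite /= rmorphD mulrDl.
Qed.

Lemma in_span0 : in_span 0.
Proof. by exists (fun=> 0); rewrite big1 // => u _; rewrite rmorph0 mul0r. Qed.

Lemma in_span_monomial c (i j : nat) : (i + j < m)%N ->
  in_span (iota c * (S ^+ i * T ^+ j)).
Proof.
move=> ij; have im : (i < m)%N by apply: leq_ltn_trans ij; apply: leq_addr.
have jm : (j < m)%N by apply: leq_ltn_trans ij; apply: leq_addl.
pose u0 := (Ordinal im, Ordinal jm).
exists (fun u => if u == u0 then c else 0).
rewrite (bigD1 u0) //= eqxx big1 ?addr0 // => u /andP[_ /negPf ->].
by rewrite rmorph0 mul0r.
Qed.

Lemma holomorphic_span D w : hamiltonian D -> holomorphic iota D w -> in_span w.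
Proof.
move=> hD hw.
have H0 : (0 : K) ^+ m.+1 * 0 + 0 ^+ m.+1 + 0 = 0 by rewrite mulr0 expr0n /= !addr0.
have hD1 := rot_hamiltonian hD; have hD2 := rot_hamiltonian hD1.
set H1 := hurwitz_rot H in hD1 hD2; set H2 := hurwitz_rot H1 in hD2.
have Rw s0 t0 : s0 ^+ m.+1 * t0 + t0 ^+ m.+1 + s0 = 0 -> regular_at s0 t0 w.
  move=> e; apply: (holomorphic_at_regular hD e); apply: hw.
  exact: regular_valuation_ring.
have R1w : @regular_at m K H1 0 0 (S / S ^+ m * w).
  apply: (holomorphic_at_regular hD1 H0); apply: (@holomorphic_at_rot _ _ H D _ w).1; apply: hw.
  exact: (regular_valuation_ring H1).
(* The two rotations contribute S^(1-m) and (T / S)^(1-m), together T^(1-m). *)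
have R2w : @regular_at m K H2 0 0 (T / T ^+ m * w).
  have -> : T / T ^+ m * w = (T / S) / (T / S) ^+ m * (S / S ^+ m * w).
    by rewrite expr_div_n; field; rewrite S0 !expf_neq0.
  apply: (holomorphic_at_regular hD2 H0); apply: (@holomorphic_at_rot _ _ H1 _ _ _).1.
  apply: (@holomorphic_at_rot _ _ H D _ w).1; apply: hw.
  exact: (regular_valuation_ring H2).
have [z [ew zE]] := laurent_expansion Rw.
suff zspan k : in_span (z k).
  rewrite ew; apply: big_ind => //; [exact: in_span0 | exact: in_span_add].
have [->|zk0] := eqVneq (z k) 0; first exact: in_span0.
have [v1 [v1P v1S v1T v1c v1g]] := vertex1 H.
have [v2 [v2P v2S v2T v2c v2g]] := vertex2 H.
have [v3 [v3P v3S v3T v3c v3g]] := vertex3 H.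
have val_z (R : F -> Prop) v c g (i j : int) : is_valuation R v ->
    (forall c, c != 0 -> v (iota c) = 0) -> c != 0 -> g != 0 ->
    v (iota c * xp g * S ^ i * T ^ j) = v (xp g) + v S * i + v T * j.
  move=> vP vc c0 g0; have xg0 : xp g != 0 by rewrite xp_eq0.
  have ic0 : iota c != 0 by rewrite fmorph_eq0.
  rewrite !(val_mul vP) ?mulf_neq0 ?expfz_neq0 // vc // add0r.
  by rewrite !(valXz vP).
have g_neq0 (g : {poly K}) y : g.[y] != 0 -> g != 0.
  by apply: contraNneq => ->; rewrite horner0.
(* The Kummer components of w have distinct orders at each vertex, so the bound that w satisfies
   there passes to every component. *)
have b1 : 0 <= v1 (z k).
  apply: (val_sum_distinct (regular1 H 0 0) (regularB H0) v1P _ _ zk0).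
    move=> k1 k2 /zE[c [a [b [g [c0 g0 g1 ->]]]]] /zE[c' [a' [b' [g' [c'0 g'0 g'1 ->]]]]].
    rewrite !(val_z _ v1 _ _ _ _ v1P) //; try exact: g_neq0 g0; try exact: g_neq0 g'0.
    rewrite !v1g // v1S v1T !add0r => e; apply: ord_inj.
    by apply: residue1 e.
  rewrite -ew; have [->|w0] := eqVneq w 0; [by left | right].
  by apply/(v1P.2 _ w0); apply: Rw.
pose cS := S / S ^+ m; have cS0 : cS != 0 by rewrite mulf_neq0 ?invr_eq0 ?expf_neq0.
have b2 : 0 <= v2 (cS * z k).
  have czk0 : cS * z k != 0 by rewrite mulf_neq0.
  apply: (val_sum_distinct (z := fun k => cS * z k) (regular1 H1 0 0)
    (@regularB _ _ H1 _ _ H0) v2P _ _ czk0).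
    move=> k1 k2; rewrite !(mulf_eq0 cS) (negPf cS0) /= => zk1 zk2.
    rewrite (val_mul v2P cS0 zk1) (val_mul v2P cS0 zk2) => /addrI.
    move: zk1 zk2 => /zE[c [a [b [g [c0 g0 g1 ->]]]]] /zE[c' [a' [b' [g' [c'0 g'0 g'1 ->]]]]].
    rewrite !(val_z _ v2 _ _ _ _ v2P) //; try exact: g_neq0 g0; try exact: g_neq0 g'0.
    rewrite !v2g // v2S v2T !add0r => e; apply: ord_inj.
    by apply: residue2 e.
  rewrite -mulr_sumr -ew; have [->|w0] := eqVneq w 0; first by left; rewrite mulr0.
  by right; apply/(v2P.2 _ (mulf_neq0 cS0 w0)).
pose cT := T / T ^+ m; have cT0 : cT != 0 by rewrite mulf_neq0 ?invr_eq0 ?expf_neq0.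
have b3 : 0 <= v3 (cT * z k).
  have czk0 : cT * z k != 0 by rewrite mulf_neq0.
  apply: (val_sum_distinct (z := fun k => cT * z k) (regular1 H2 0 0)
    (@regularB _ _ H2 _ _ H0) v3P _ _ czk0).
    move=> k1 k2; rewrite !(mulf_eq0 cT) (negPf cT0) /= => zk1 zk2.
    rewrite (val_mul v3P cT0 zk1) (val_mul v3P cT0 zk2) => /addrI.
    move: zk1 zk2 => /zE[c [a [b [g [c0 g0 g1 ->]]]]] /zE[c' [a' [b' [g' [c'0 g'0 g'1 ->]]]]].
    rewrite !(val_z _ v3 _ _ _ _ v3P) //; try exact: g_neq0 g0; try exact: g_neq0 g'0.
    rewrite !v3g ?(g_neq0 _ _ g0) ?(g_neq0 _ _ g'0) // v3S v3T => e; apply: ord_inj.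
    by apply: residue3 e.
  rewrite -mulr_sumr -ew; have [->|w0] := eqVneq w 0; first by left; rewrite mulr0.
  by right; apply/(v3P.2 _ (mulf_neq0 cT0 w0)).
have [c [a [b [g [c0 g0 g1 ez]]]]] := zE k zk0.
have gn0 := g_neq0 _ _ g0.
rewrite ez (val_z _ v1 _ _ _ _ v1P) // v1g // v1S v1T in b1.
rewrite (val_mul v2P cS0 zk0) ez (val_z _ v2 _ _ _ _ v2P) // v2g // in b2.
rewrite /cS (val_mul v2P) ?invr_eq0 ?expf_neq0 // (valV v2P) ?expf_neq0 // in b2.
rewrite (valX v2P) // v2S v2T in b2.
rewrite (val_mul v3P cT0 zk0) ez (val_z _ v3 _ _ _ _ v3P) // v3g // in b3.
rewrite /cT (val_mul v3P) ?invr_eq0 ?expf_neq0 // (valV v3P) ?expf_neq0 // in b3.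
rewrite (valX v3P) // v3S v3T in b3.
move: ez b1 b2 b3; set i := (X in S ^ X); set j := (X in T ^ X) => ez b1 b2 b3.
(* The last argument is the degree of g, which turns out to be 0: only a constant times a monomial
   remains. *)
have [||||i0 j0 ij d0] := @triangle_bounds m i j (size g).-1 _ _ _ _.
- by [].
- by lia.
- by move: b2; rewrite mulNrn pmulrn -mulrzr intz /i /j; move: (nat_of_ord k) => k'; clear; lia.
- move: b3; rewrite mulNrn pmulrn -mulrzr intz /i /j.
  by move: (nat_of_ord k) (size g).-1 => k' d; clear; lia.
have [c' eg] : exists c', g = c'%:P.
  by exists g`_0; apply: size1_polyC; move: d0; case: (size g) => [|[|]].
rewrite ez eg ev1C -rmorphM -mulrA.
have [i' ei] : exists i' : nat, i = i' by exists (absz i); rewrite gez0_abs.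
have [j' ej] : exists j' : nat, j = j' by exists (absz j); rewrite gez0_abs.
by rewrite ei ej -!exprnP; apply: in_span_monomial; rewrite ei ej in ij.
Qed.

End HolomorphicSpan.

(** * The combinatorics of the Cartier operator *)

Section Exponents.

Variables (m l : nat).
Local Notation N := (m * m.+1).+1.

(* Read off from S^i T^j = (S^a T^b)^l x^al (T^(m+1) / S)^(be+1) S^m. *)
Definition cartier_exponents (i j al be : nat) (a b : int) :=
  [/\ (al < l)%N, (be < l)%N,
      i%:Z = l%:Z * a + m%:Z * al.+1%:Z - be.+1%:Z &
      j.+1%:Z = l%:Z * b + al.+1%:Z + m.+1%:Z * be.+1%:Z].

(** Put n = m + 1. Eliminating be gives n i + j + 1 = N (al + 1) modulo l, and eliminating al gives
    m (j + 1) - i = N (be + 1) modulo l. Both are solvable because N has the inverse r modulo l. *)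
Lemma cartier_exponents_exist i j : (0 < l)%N -> coprime l N ->
  exists al be a b, cartier_exponents i j al be a b.
Proof.
move=> l0 co.
have [r [s rs]] : exists r s : int, r * N%:Z + s * l%:Z = 1.
  have : coprimez N l by rewrite coprimezE /= coprime_sym.
  by move=> /coprimezP[[r s] /= e]; exists r, s.
have ln0 : l%:Z != 0 by lia.
(* Residues are taken in 1..l, which is why 1 is subtracted before the division. *)
have res (e : int) : exists (al : nat) (q : int), (al < l)%N /\ r * e = l%:Z * q + al.+1%:Z.
  have e1 := divz_eq (r * e - 1) l; have e2 := modz_ge0 (r * e - 1) ln0.
  have e3 := ltz_pmod (r * e - 1) (_ : 0 < l%:Z).
  exists (absz ((r * e - 1) %% l)%Z), ((r * e - 1) %/ l)%Z; split.
    by have := e3 l0; lia.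
  by lia.
pose e : int := m.+1%:Z * i%:Z + j.+1%:Z; pose e' : int := m%:Z * j.+1%:Z - i%:Z.
have [al [q [al_l eal]]] := res e; have [be [q' [be_l ebe]]] := res e'.
exists al, be, (s * i%:Z + m%:Z * q - q'), (s * j.+1%:Z + q + m.+1%:Z * q'); split=> //.
  have : i%:Z * (r * N%:Z + s * l%:Z) = i%:Z by rewrite rs mulr1.
  have : m%:Z * (r * e) - r * e' = r * N%:Z * i%:Z by rewrite /e /e'; lia.
  by rewrite eal ebe; lia.
have : j.+1%:Z * (r * N%:Z + s * l%:Z) = j.+1%:Z by rewrite rs mulr1.
have : r * e + m.+1%:Z * (r * e') = r * N%:Z * j.+1%:Z by rewrite /e /e'; lia.
by rewrite eal ebe; lia.
Qed.

(* One more than the order of S^i T^j dS / fT at the point (0, 0). *)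
Definition weight (i j : nat) := (m.+1 * i + j.+1)%N.

Lemma weight_bounds i j : (i + j < m)%N -> (0 < weight i j < N)%N.
Proof. rewrite /weight; nia. Qed.

Lemma weight_inj i j i' j' : (i + j < m)%N -> (i' + j' < m)%N ->
  weight i j = weight i' j' -> i = i' /\ j = j'.
Proof.
have wE k n : (k + n < m)%N -> (weight k n %/ m.+1 = k)%N.
  by move=> kn; rewrite /weight mulnC divnMDl // divn_small ?addn0 //; lia.
move=> ij ij' e; have ii : i = i' by rewrite -(wE i j) // e wE.
by split=> //; move: e; rewrite /weight ii; lia.
Qed.

Section Image.

Variables (i j al be : nat) (a b : int).
Hypotheses (ij : (i + j < m)%N) (ex : cartier_exponents i j al be a b).

(** The exponents are those of S^a T^b S^m (T^(m+1) / S). Multiplied by l, each of i' + 1, j' + 1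
    and m - i' - j' is a positive integer by the equations for i and j; only the third needs the
    bound on al + be. *)
Lemma cartier_image : (l <= (al + be).+1)%N -> exists i' j' : nat,
  [/\ (i' + j' < m)%N, i'%:Z = a + m%:Z - 1, j'%:Z = b + m.+1%:Z &
      (l * weight i' j' = weight i j %[mod N])%N].
Proof.
have [al_l be_l ei ej] := ex; move=> le.
have l0 : 0 < l%:Z by lia.
have I0 : 0 < a + m%:Z.
  rewrite -(pmulr_rgt0 _ l0); have : 0 <= m%:Z * (l%:Z - 1 - al%:Z) by apply: mulr_ge0; lia.
  by lia.
have J0 : 0 < b + m.+1%:Z + 1.
  rewrite -(pmulr_rgt0 _ l0); have : 0 <= m.+1%:Z * (l%:Z - 1 - be%:Z) by apply: mulr_ge0; lia.
  by lia.
have L0 : 0 < m%:Z - (a + m%:Z - 1) - (b + m.+1%:Z).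
  rewrite -(pmulr_rgt0 _ l0).
  have : 0 <= m.+1%:Z * (al%:Z + be%:Z + 1 - l%:Z) by apply: mulr_ge0; lia.
  by lia.
have [i' ei'] : exists i' : nat, i'%:Z = a + m%:Z - 1.
  by exists (absz (a + m%:Z - 1)%R); lia.
have [j' ej'] : exists j' : nat, j'%:Z = b + m.+1%:Z.
  by exists (absz (b + m.+1%:Z)%R); lia.
exists i', j'; split=> //; first by lia.
have e : (l * weight i' j' = weight i j + (l - al.+1) * N)%N.
  have [d ed] : exists d, (l - al.+1 = d)%N by eexists.
  have ld : l%:Z = d%:Z + al%:Z + 1 by lia.
  rewrite /weight ed; apply/eqP; rewrite -eqz_nat !(PoszD, PoszM) ei' ei.
  have := congr1 (fun z => m.+1%:Z * z) ei; have := congr1 (fun z => l%:Z * z) ej'.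
  have := congr1 (fun z => (m * m.+1).+1%:Z * z) ld.
  have -> : j'.+1%:Z = j'%:Z + 1 by lia.
  by rewrite ej ej'; lia.
by rewrite e addnC modnMDl.
Qed.

(** Besides the weight, e2 = m (j + 1) - i is used, which is one more than the order at the second
    vertex. Comparing both for the two forms gives multipliers u = l - 1 - al and v = l - 1 - be. If
    al + be + 1 < l, then u + v >= l, and l (i' + j' + 1) = i + j + 1 + (m + 1) u + m v exceeds l m,
    although i' + j' < m. *)
Lemma cartier_no_image i' j' : coprime l N -> (i' + j' < m)%N ->
  (l * weight i' j' = weight i j %[mod N])%N -> (l <= (al + be).+1)%N.
Proof.
have [al_l be_l ei ej] := ex; move=> co ij' e.
have [u eu] : exists u : int, l%:Z * (weight i' j')%:Z = (weight i j)%:Z + N%:Z * u.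
  have d1 := divn_eq (l * weight i' j') N; have d2 := divn_eq (weight i j) N.
  exists (((l * weight i' j') %/ N)%N%:Z - (weight i j %/ N)%N%:Z).
  by move: d1 d2; rewrite e; move: (_ %/ _)%N (_ %/ _)%N (_ %% _)%N => q1 q2 r; clear; lia.
have /andP[w0 wN] := weight_bounds ij; have /andP[w'0 w'N] := weight_bounds ij'.
pose v : int := m%:Z * u - (l%:Z * i'%:Z - i%:Z).
pose e2 : int := m%:Z * j.+1%:Z - i%:Z; pose e2' : int := m%:Z * j'.+1%:Z - i'%:Z.
have ev : l%:Z * e2' = e2 + N%:Z * v.
  by have := congr1 (fun z => m%:Z * z) eu; rewrite /e2 /e2' /v /weight; clear; lia.
have e2_bounds k n : (k + n < m)%N -> 0 < m%:Z * n.+1%:Z - k%:Z < N%:Z by clear; nia.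
have /andP[e20 e2N] : 0 < e2 < N%:Z := e2_bounds _ _ ij.
have /andP[e2'0 e2'N] : 0 < e2' < N%:Z := e2_bounds _ _ ij'.
have l0 : 0 < l%:Z by lia.
(* The bounds on y and y' give 0 <= d < l, so d + t + 1 is a multiple of l strictly between 0 and 2
   l. *)
have digit (y y' d c : int) (t : nat) : 0 < y -> y < N%:Z -> 0 < y' -> y' < N%:Z ->
    (t < l)%N -> l%:Z * y' = y + N%:Z * d -> y = l%:Z * c + N%:Z * t.+1%:Z ->
    d + t.+1%:Z = l%:Z.
  move=> y0 yN y'0 y'N tl ed ec.
  have d_ge0 : 0 <= d.
    rewrite leNgt; apply/negP => d0; have : N%:Z * d <= N%:Z * -1 by apply: ler_wpM2l; lia.
    have : 0 < l%:Z * y' by apply: mulr_gt0.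
    by lia.
  have d_lt : d < l%:Z.
    rewrite -(ltr_pM2l (_ : 0 < N%:Z)) //; have : l%:Z * y' <= l%:Z * N%:Z by apply: ler_wpM2l; lia.
    by lia.
  have : (l%:Z %| (d + t.+1%:Z) * N%:Z)%Z.
    by apply/dvdzP; exists (y' - c); lia.
  rewrite Gauss_dvdzl ?coprimezE //; move=> /dvdzP[k ek].
  have : 0 < k by rewrite -(pmulr_lgt0 _ l0) -ek; lia.
  have : k < 2 by rewrite -(ltr_pM2r l0) -ek; lia.
  move=> k2 k0; have k1 : k = 1 by lia.
  by rewrite ek k1 mul1r.
have du : u + al.+1%:Z = l%:Z.
  apply: (digit (weight i j)%:Z (weight i' j')%:Z _ (m.+1%:Z * a + b)) => //.
  by have := congr1 (fun z => m.+1%:Z * z) ei; move: ej; rewrite /weight; clear; lia.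
have dv : v + be.+1%:Z = l%:Z.
  apply: (digit e2 e2' _ (m%:Z * b - a)) => //.
  by have := congr1 (fun z => m%:Z * z) ej; move: ei; rewrite /e2; clear; lia.
rewrite leqNgt; apply/negP => lt.
have uv : l%:Z <= u + v by lia.
have ej' : l%:Z * j'.+1%:Z = j.+1%:Z + u + m.+1%:Z * v.
  have Nn0 : N%:Z != 0 by [].
  apply: (mulfI Nn0); have := congr1 (fun z => m.+1%:Z * z) ev.
  by move: eu; rewrite /e2 /e2' /weight; clear; lia.
have ei' : l%:Z * i'%:Z = i%:Z + m%:Z * u - v by rewrite /v; lia.
have : l%:Z * (i'%:Z + j'.+1%:Z) <= l%:Z * m%:Z by apply: ler_wpM2l; lia.
have : m%:Z * l%:Z <= m%:Z * (u + v) by apply: ler_wpM2l.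
rewrite [l%:Z * (_ + _)]mulrDr ei' ej'; move: du al_l; clear; lia.
Qed.

End Image.

End Exponents.

(** * Derivation with respect to kx in positive characteristic *)

Lemma prime_Ndvd_fact p k : prime p -> (k < p)%N -> ~~ (p %| k`!)%N.
Proof.
move=> p_prime; elim: k => [|k IH] kp; first by rewrite Euclid_dvd1.
by rewrite factS Euclid_dvdM // negb_or IH ?(ltnW kp) // gtnNdvd.
Qed.

Section CharacteristicP.

Variables (m : nat) (K : closedFieldType) (H : hurwitzField m.+1 K).
Local Notation N := (m * m.+1).+1.
Local Notation F := (hurwitz_field H).
Local Notation iota := (hurwitz_iota H).
Local Notation S := (hurwitz_S H).
Local Notation T := (hurwitz_T H).
Local Notation x := (kx H).

Variables (D : F -> F^o) (hD : hamiltonian D).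
Variables (l : nat) (l_prime : prime l) (charK : l \in [pchar K]).
Hypothesis lN : coprime l N.

Let S0 : S != 0 := hurwitz_S_neq0 H.
Let T0 : T != 0 := hurwitz_T_neq0 H.
Let l_gt0 : (0 < l)%N := prime_gt0 l_prime.

Lemma N_neq0 : N%:R != 0 :> K.
Proof. by rewrite -(dvdn_pcharf charK) -prime_coprime. Qed.

Lemma charF : l \in [pchar F].
Proof. by rewrite (fmorph_pchar iota). Qed.

Local Notation frob := (pFrobenius_aut charF).

Lemma frobE (y : F) : frob y = y ^+ l. Proof. exact: pFrobenius_autE. Qed.

Lemma l_natF : l%:R = 0 :> F.
Proof. by have /andP[_ /eqP] := charF. Qed.

Lemma rootK (c : K) : exists d, d ^+ l = c.
Proof.
have [|d] := closed_rootP ('X^l - c%:P) _.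
  by rewrite -(prednK l_gt0) size_XnsubC // prednK // eqSS -lt0n.
by rewrite rootE !hornerE subr_eq0 => /eqP; exists d.
Qed.

(** As dx is a Laurent monomial times dS / fT, the monomial forms stay monomial when expressed
    through dx. The constant N is nonzero in K because l does not divide it. *)
Lemma D_kx : D x = N%:R * (S ^+ m * (T ^+ m.+1 / S)) :> F.
Proof.
have [dD DS DT] := hD.
have DSm k : S * D (S ^+ k) = k%:R * S ^+ k * fT H :> F.
  case: k => [|k]; first by rewrite expr0 (der1 dD) mulr0 !mul0r.
  by rewrite (der_exp dD) DS /GRing.scale /= mulrA mulrCA -exprS.
apply: (mulfI S0); rewrite /kx (der_mul dD) DT /GRing.scale /= mulrDr [S * (T * _)]mulrCA DSm.
transitivity (N%:R * (S ^+ m * T ^+ m.+1)); last by field.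
apply/eqP; rewrite -subr_eq0; apply/eqP.
rewrite -[RHS](mulr0 (- S ^+ m)) -(hurwitz_equation H) /fS /fT !exprS.
have -> : m.+1%:R = m%:R + 1 :> F by rewrite natr1.
have -> : N%:R = m%:R * (m%:R + 1) + 1 :> F by rewrite -natr1 natrM -natr1.
by ring.
Qed.

Lemma NF_neq0 : N%:R != 0 :> F.
Proof. by rewrite -(rmorph_nat iota) fmorph_eq0 N_neq0. Qed.

Lemma D_kx_neq0 : D x != 0 :> F.
Proof. by rewrite D_kx !mulf_neq0 ?NF_neq0 ?invr_eq0 ?expf_neq0. Qed.

Definition der_kx (z : F) : F^o := D z / D x.
Local Notation dx := der_kx.

Lemma dx_derivation : derivation iota dx.
Proof.
have [dD _ _] := hD; split=> [c|y z|y z]; rewrite /der_kx.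
- by rewrite (der_const dD) mul0r.
- by rewrite (der_add dD) mulrDl.
- by rewrite (der_mul dD) mulrDl /GRing.scale /= !mulrA.
Qed.

Lemma dx_kx : dx x = 1 :> F.
Proof. by rewrite /der_kx mulfV // D_kx_neq0. Qed.

Lemma dx_frob y : dx (frob y) = 0.
Proof.
rewrite frobE -(prednK l_gt0) (der_exp dx_derivation) prednK //.
by rewrite l_natF mul0r scale0r.
Qed.

Lemma iter_dx_frob k P : iter k dx (map_poly frob P).[x] = ((map_poly frob P)^`(k)).[x].
Proof.
elim: k => [|k IH]; first by rewrite derivn0.
rewrite iterS IH derivn_map (der_horner dx_derivation).
  by rewrite dx_kx derivnS derivn_map /GRing.scale /= mulr1.
by move=> i; rewrite coef_map /= dx_frob.
Qed.

(** F = F^l[x]. This ring contains inverses, since 1/y = y^(l-1) (1/y)^l, and constants, which are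
    l-th powers. It contains S^N by the Kummer equation, hence S, because u l = N v + 1 makes S an
    l-th power divided by a power of S^N. *)
Lemma frob_span z : exists P, z = (map_poly frob P).[x].
Proof.
pose A z := exists P, z = (map_poly frob P).[x].
have AM y w : A y -> A w -> A (y * w).
  by move=> [P ->] [Q ->]; exists (P * Q); rewrite rmorphM hornerM.
have Afrob y : A (frob y) by exists y%:P; rewrite map_polyC hornerC.
have A1 : A 1 by rewrite -(rmorph1 frob); apply: Afrob.
have AX y k : A y -> A (y ^+ k).
  move=> Ay; elim: k => [|k IH]; last by rewrite exprS; apply: AM.
  by rewrite expr0.
have AV y : A y -> A y^-1.
  move=> Ay; have -> : y^-1 = y ^+ l.-1 * frob y^-1.
    have [->|y0] := eqVneq y 0; first by rewrite invr0 rmorph0 mulr0.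
    apply: (mulfI y0); rewrite mulrA -exprS prednK // -frobE -rmorphM.
    by rewrite !mulfV // rmorph1.
  by apply: AM; [apply: AX | apply: Afrob].
have Ax : A x by exists 'X; rewrite map_polyX hornerX.
have AB y w : A y -> A w -> A (y - w).
  by move=> [P ->] [Q ->]; exists (P - Q); rewrite rmorphB hornerD hornerN.
have AS : A S.
  have /(coprimeP N l_gt0)[[u v] /= uv] := lN.
  have ASN : A (S ^+ N).
    have -> : S ^+ N = - x ^+ m.+1 / (1 + x).
      by rewrite -kummer_equation mulfK // kx_add1_neq0.
    have -> : - x ^+ m.+1 = (1 - 1) - x ^+ m.+1 by rewrite subrr sub0r.
    apply: (AM); first by apply: (AB); [apply: (AB) | apply: AX].
    have -> : 1 + x = 1 - ((1 - 1) - x) by rewrite subrr sub0r opprK.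
    by apply: AV; do 2![apply: (AB) => //]; apply: AB.
  have -> : S = frob (S ^+ u) * ((S ^+ N) ^+ v)^-1.
    have ul : (u * l = N * v + 1)%N by lia.
    by rewrite frobE -!exprM ul exprD expr1 mulrAC mulfV ?mul1r // expf_neq0.
  by apply: AM => //; apply/AV/AX.
have AT : A T.
  have -> : T = x * (S ^+ m)^-1 by rewrite /kx mulrAC mulfV ?mul1r // expf_neq0.
  by apply: AM => //; apply/AV/AX.
suff: A z by [].
apply: (hurwitz_generated z) => [|c|y].
- split=> // y w Ay Aw; apply: AM => //; exact: AV.
- have [d <-] := rootK c; rewrite rmorphXn -frobE; exact: Afrob.
- by rewrite !inE => /orP[] /eqP ->.
Qed.

(** Elements of F^l are constants for d/dx, and the l-th derivative of a polynomial is divisible by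
    l!. *)
Lemma iter_dx_eq0 z : iter l dx z = 0.
Proof.
have [P ->] := frob_span z; rewrite iter_dx_frob nderivn_def.
have /dvdnP[d ->] : (l %| l`!)%N by rewrite dvdn_fact // l_gt0 leqnn.
by rewrite mulnC mulrnA hornerMn hornerMn -[_ *+ l]mulr_natr l_natF mulr0 mul0rn.
Qed.

(** Differentiating as often as the degree leaves the leading coefficient times the factorial of the
    degree, which is prime to l. *)
Lemma frob_free (P : {poly F}) : (size P <= l)%N -> (map_poly frob P).[x] = 0 -> P = 0.
Proof.
move=> sP e; apply/eqP; apply: contraT => P0.
have sP0 : (0 < size P)%N by rewrite lt0n size_poly_eq0.
have : iter (size P).-1 dx (map_poly frob P).[x] = 0.
  by rewrite e; elim: (size P).-1 => //= k ->; rewrite (der0 dx_derivation).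
rewrite iter_dx_frob.
have -> : (map_poly frob P)^`((size P).-1) = (frob (lead_coef P) *+ (size P).-1`!)%:P.
  apply/polyP => i; rewrite coef_derivn coefC coef_map /=; case: i => [|i] /=.
    by rewrite addn0 ffactnn /lead_coef.
  by rewrite nth_default ?rmorph0 ?mul0rn // addnS -(prednK sP0) ltnS leq_addr.
rewrite hornerC -mulr_natr => /eqP; rewrite mulf_eq0 fmorph_eq0 lead_coef_eq0 (negPf P0) /=.
rewrite -(dvdn_pcharf charF) (negPf (prime_Ndvd_fact _ _)) //.
by rewrite prednK.
Qed.

End CharacteristicP.

(** * The element x is separating *)

Section Separating.

Variables (m : nat) (K : closedFieldType) (H : hurwitzField m.+1 K).
Local Notation N := (m * m.+1).+1.
Local Notation F := (hurwitz_field H).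
Local Notation iota := (hurwitz_iota H).
Local Notation S := (hurwitz_S H).
Local Notation T := (hurwitz_T H).
Local Notation x := (kx H).
Local Notation xp := (ev1 iota x).

(** y = S (1 + x) is integral over K[x], as y^N = - x^(m+1) (1 + x)^(N-1). The factor (1 + x)^N
    turns the powers of S in the Kummer expansion into powers of y, so a multiple of z is integral
    as well. *)
Lemma annihilator z : exists G, G != 0 /\ ev2 iota x z G = 0.
Proof.
pose y := S * (1 + x).
have xp1X : xp (1 + 'X) = 1 + x by rewrite rmorphD rmorph1 /= ev1X.
have y_int : integralOver xp y.
  pose a : {poly K} := 'X^(m.+1) * (1 + 'X) ^+ (m * m.+1).
  exists ('X^N + a%:P).
    rewrite monicE lead_coefDl ?lead_coefXn // size_polyXn ltnS.
    exact: leq_trans (size_polyC_leq1 _) _.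
  rewrite rootE rmorphD /= map_polyXn map_polyC !hornerE /= /a rmorphM !rmorphXn /= xp1X ev1X.
  by rewrite /y exprMn [(1 + x) ^+ N]exprS mulrA kummer_equation mulNr addNr.
have int_exp w k : integralOver xp w -> integralOver xp (w ^+ k).
  move=> iw; elim: k => [|k IH]; first exact: integral1.
  by rewrite exprS; apply: integral_mul.
have [q [p [q0 e]]] := kummer_expansion z.
pose q' := q * (1 + 'X) ^+ N.
have X10 : 1 + 'X != 0 :> {poly K} by rewrite addrC -size_poly_eq0 size_XaddC.
have q'0 : q' != 0 by rewrite mulf_neq0 ?expf_neq0.
have [M Mmonic Mroot] : integralOver xp (xp q' * z).
  have -> : xp q' * z = \sum_(k < N) xp (p k * (1 + 'X) ^+ (N - k)) * y ^+ k.
    rewrite /q' rmorphM mulrAC e mulr_suml; apply: eq_bigr => k _.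
    rewrite rmorphM !rmorphXn /= xp1X /y exprMn.
    have -> : (1 + x) ^+ N = (1 + x) ^+ (N - k) * (1 + x) ^+ k.
      by rewrite -exprD subnK // ltnW.
    by ring.
  apply: big_ind => [|u v|k _]; [exact: integral0 | exact: integral_add | ].
  by apply: integral_mul; [apply: integral_id | apply: int_exp].
exists (M \Po (q'%:P * 'X)); split.
  by rewrite comp_poly2_eq0 ?monic_neq0 // mul_polyC size_scale // size_polyX.
rewrite ev2E map_comp_poly horner_comp rmorphM /= map_polyC map_polyX !hornerE.
exact/rootP.
Qed.

Lemma adjoin_xp p : adjoin iota [:: x] (xp p).
Proof.
move=> A Asub Aconst Ax; have [A1 AB AV] := Asub.
have A0 : A 0 by rewrite -(subrr 1); apply: AB.
have AD y w : A y -> A w -> A (y + w).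
  by move=> Ay Aw; rewrite -[w]opprK -[- w]sub0r; apply: (AB) => //; apply: AB.
have AM y w : A y -> A w -> A (y * w).
  move=> Ay Aw; rewrite -[w]invrK; apply: (AV) => //.
  by rewrite -[w^-1]mul1r; apply: AV.
elim/poly_ind: p => [|p c IH]; first by rewrite rmorph0.
rewrite rmorphD rmorphM /= ev1X ev1C; apply: (AD) => //; apply: (AM) => //.
by apply: Ax; rewrite inE.
Qed.

Variables (D : F -> F^o) (hD : hamiltonian D).
Variables (l : nat) (l_prime : prime l) (charK : l \in [pchar K]).
Hypothesis lN : coprime l N.

Lemma poly_frob_split (p : {poly K}) : exists h : nat -> {poly K},
  p = \sum_(r < l) h r ^+ l * 'X^r.
Proof.
have l_gt0 := prime_gt0 l_prime.
have charP : l \in [pchar {poly K}] by rewrite pchar_poly.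
elim/poly_ind: p => [|p c [h e]].
  exists (fun=> 0); rewrite big1 // => r _.
  by rewrite expr0n gtn_eqF // mul0r.
have [d dc] := rootK l_prime c.
exists (fun r => if r is r'.+1 then h r' else h l.-1 * 'X + d%:P).
rewrite e -(prednK l_gt0) big_ord_recr big_ord_recl /= prednK //.
rewrite -(pFrobenius_autE charP (_ + _)) rmorphD /= !pFrobenius_autE expr0 mulr1.
rewrite exprMn -rmorphXn /= dc mulrDl mulr_suml [RHS]addrC addrA; congr (_ + _ + _).
  by apply: eq_bigr => r _; rewrite /= /bump /= exprSr mulrA.
by rewrite -mulrA -exprSr prednK.
Qed.

(* G(z) is the sum of the H_r(z)^l x^r over r < l for suitable H_r, because K is
   perfect, and 1, x, ..., x^(l-1) are linearly independent over F^l. *)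
Lemma inseparable_annihilator z G : G != 0 -> G^`() = 0 -> ev2 iota x z G = 0 ->
  exists G', [/\ G' != 0, ev2 iota x z G' = 0 & (size G' < size G)%N].
Proof.
move=> G0 dG eG.
have l_gt0 := prime_gt0 l_prime.
have charP : l \in [pchar {poly K}] by rewrite pchar_poly.
pose G1 := \poly_(j < size G) G`_(l * j).
have GE : G = G1 \Po 'X^l.
  apply/polyP => i; rewrite coef_comp_poly_Xn // coef_poly.
  case: ifP => [/dvdnP[j ->]|lNi]; last first.
    case: i lNi => [|i] lNi; first by rewrite dvdn0 in lNi.
    have := congr1 (fun P : {poly {poly K}} => P`_i) dG.
    rewrite coef_deriv coef0 -mulr_natr => /eqP.
    by rewrite mulf_eq0 -(dvdn_pcharf charP) lNi orbF => /eqP.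
  rewrite mulnK // mulnC; case: ifP => // /negbT; rewrite -leqNgt => le.
  by rewrite nth_default // (leq_trans le) // leq_pmull.
have sG1 : (size G1 < size G)%N.
  have sG : (1 < size G)%N.
    rewrite ltnNge; apply/negP => /size1_polyC eG0; move/eqP: eG.
    by rewrite eG0 ev2C xp_eq0 -polyC_eq0 -eG0 (negPf G0).
  have := size_comp_poly G1 'X^l; rewrite -GE size_polyXn /=.
  have := prime_gt1 l_prime; move: sG; move: (size G) (size G1) => g g1; clear.
  by case: g1 => [|[|g1]]; nia.
have [h hE] : exists h : nat -> nat -> {poly K},
    forall j, G1`_j = \sum_(r < l) h j r ^+ l * 'X^r.
  exists (fun j => sval (constructive_indefinite_description _ (poly_frob_split G1`_j))).
  by move=> j; case: constructive_indefinite_description.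
pose Hr r := \poly_(j < size G1) h j r.
have sHr r : (size (Hr r) < size G)%N by apply: leq_ltn_trans sG1; apply: size_poly.
have [[r [rl Hr0]]|all0] := classic (exists r, (r < l)%N /\ Hr r != 0); last first.
  case/negP: G0; apply/eqP; rewrite GE.
  suff -> : G1 = 0 by rewrite comp_poly0.
  apply/polyP => j; rewrite coef0; have [jG|/leq_sizeP->//] := ltnP j (size G1).
  rewrite hE big1 // => r _; suff -> : h j r = 0 by rewrite expr0n gtn_eqF // mul0r.
  have : Hr r = 0 by apply/eqP; apply: contraT => Hr0; case: all0; exists r.
  by move/(congr1 (fun P : {poly {poly K}} => P`_j)); rewrite coef_poly jG coef0.
exists (Hr r); split=> //.
pose P := \poly_(r < l) ev2 iota x z (Hr r).
suff P0 : P = 0.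
  by have := congr1 (fun p : {poly F} => p`_r) P0; rewrite coef_poly rl coef0.
apply: (@frob_free _ _ _ _ hD _ l_prime charK lN); first exact: size_poly.
rewrite -{}[RHS]eG {1}GE ev2E map_comp_poly horner_comp map_polyXn hornerXn.
have evH r' : ev2 iota x z (Hr r') = \sum_(j < size G1) xp (h j r') * z ^+ j.
  rewrite ev2E (horner_coef_wide _ (n := size G1)).
    by apply: eq_bigr => j _; rewrite coef_map coef_poly ltn_ord.
  exact: leq_trans (size_poly _ _) (size_poly _ _).
rewrite (horner_coef_wide _ (n := l)); last first.
  exact: leq_trans (size_poly _ _) (size_poly _ _).
rewrite (horner_coef_wide _ (n := size G1)) ?size_poly //.
under eq_bigr => r' _ do
  rewrite coef_map coef_poly ltn_ord evH raddf_sum mulr_suml.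
rewrite exchange_big; apply: eq_bigr => j _; rewrite coef_map hE raddf_sum mulr_suml.
apply: eq_bigr => r' _; rewrite /= pFrobenius_autE exprMn -!exprM.
by rewrite [(j * l)%N]mulnC rmorphM !rmorphXn /= ev1X mulrAC.
Qed.

(** An annihilator G of least degree has a nonzero derivative, by the previous lemma. A nonconstant
    common factor of G and its derivative does not vanish at z, so its cofactor would be a smaller
    annihilator. *)
Lemma kx_separating : separating iota x.
Proof.
move=> z.
have min : exists G, [/\ G != 0, ev2 iota x z G = 0 &
    forall G', G' != 0 -> ev2 iota x z G' = 0 -> (size G <= size G')%N].
  have [G [G0 eG]] := annihilator z.
  move: {2}(size G) (leqnn (size G)) => k.
  elim: k G G0 eG => [|k IH] G G0 eG; first by rewrite leqn0 size_poly_eq0 (negPf G0).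
  move=> sG; have [[G' [G'0 eG' lt]]|no] := classic (exists G',
      [/\ G' != 0, ev2 iota x z G' = 0 & (size G' < size G)%N]).
    by apply: (IH G') => //; rewrite -ltnS; apply: leq_trans sG.
  exists G; split=> // G' G'0 eG'; rewrite leqNgt; apply/negP => lt.
  by apply: no; exists G'.
have [G [G0 eG minG]] := min.
have dG0 : G^`() != 0.
  apply/eqP => dG; have [G' [G'0 eG']] := inseparable_annihilator G0 dG eG.
  by rewrite ltnNge minG.
have co : Pdiv.Idomain.coprimep G G^`().
  pose d := Pdiv.Idomain.gcdp G G^`().
  have /Pdiv.Idomain.dvdpP[[/= c h] c0 e1] := Pdiv.Idomain.dvdp_gcdl G G^`().
  have d0 : d != 0 by rewrite Pdiv.Idomain.gcdp_eq0 negb_and G0.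
  have sd : (size d < size G)%N.
    apply: leq_ltn_trans (Pdiv.Idomain.dvdp_leq dG0 (Pdiv.Idomain.dvdp_gcdr _ _)) _.
    exact: lt_size_deriv.
  have ed : ev2 iota x z d != 0.
    by apply/eqP => ed; have := minG d d0 ed; rewrite leqNgt sd.
  have h0 : h != 0.
    have : c *: G != 0 by rewrite scale_poly_eq0 negb_or c0.
    by rewrite e1; apply: contraNneq => ->; rewrite mul0r.
  have eh : ev2 iota x z h = 0.
    have := congr1 (ev2 iota x z) e1; rewrite -mul_polyC !rmorphM /= eG mulr0 => /esym/eqP.
    by rewrite mulf_eq0 (negPf ed) orbF => /eqP.
  have := minG h h0 eh.
  have := congr1 (fun p : {poly {poly K}} => size p) e1; rewrite size_scale // size_mul // -/d.
  rewrite /Pdiv.Idomain.coprimep -/d.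
  have : (0 < size d)%N by rewrite lt0n size_poly_eq0.
  by move: (size d) (size h) (size G) => a b n; lia.
have /Pdiv.Idomain.Bezout_coprimepP[[u v] /=] := co.
rewrite -size_poly_eq1 => /size_poly1P[c c0 euv].
exists (map_poly xp G); split.
- by move=> i; rewrite coef_map; apply: adjoin_xp.
- rewrite separable_poly.unlock; apply/Bezout_coprimepP.
  exists (map_poly xp u, map_poly xp v) => /=.
  have := congr1 (map_poly xp) euv; rewrite rmorphD !rmorphM /= map_polyC /= -deriv_map => ->.
  by rewrite -size_poly_eq1 size_polyC xp_eq0 c0.
- by rewrite rootE -ev2E eG.
Qed.

End Separating.

Lemma prime_Ndvd_bin p n k : prime p -> (n < p)%N -> (k <= n)%N -> ~~ (p %| 'C(n, k))%N.
Proof.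
move=> p_prime np kn; apply: contra (prime_Ndvd_fact p_prime np) => pC.
by rewrite -(bin_fact kn) dvdn_mulr.
Qed.

Lemma prime_dvd_ffact p i : prime p -> (0 < i < p)%N -> (p %| (p.-1 + i) ^_ p.-1)%N.
Proof.
move=> p_prime /andP[i0 ip]; have p0 := prime_gt0 p_prime.
have := ffact_fact (leq_addr i p.-1); rewrite addKn => e.
have : (p %| (p.-1 + i)`!)%N by rewrite dvdn_fact // p0 /=; lia.
by rewrite -e Euclid_dvdM // (negPf (prime_Ndvd_fact p_prime ip)) orbF.
Qed.

(** The derivative of x^(l-1+i) has as coefficient a falling factorial divisible by l for 0 < i < l,
    so up to degree 2 l - 2 only x^(l-1) survives. *)
Lemma derivn_pchar (K : fieldType) l (p : {poly K}) : prime l -> l \in [pchar K] ->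
  (size p <= l.-1 + l)%N -> p^`(l.-1) = (p`_l.-1 *+ (l.-1)`!)%:P.
Proof.
move=> l_prime charK sp; apply/polyP => i; rewrite coef_derivn coefC.
case: i => [|i] /=; first by rewrite addn0 ffactnn.
have [il|li] := ltnP i.+1 l.
  apply/eqP; rewrite -mulr_natr mulf_eq0 -(dvdn_pcharf charK).
  by rewrite prime_dvd_ffact ?orbT.
by rewrite nth_default ?mul0rn // (leq_trans sp) // leq_add2l.
Qed.

Lemma coef_exp_1addX (K : comNzRingType) n k : ((1 + 'X : {poly K}) ^+ n)`_k = 'C(n, k)%:R.
Proof.
rewrite addrC exprD1n coef_sum.
under eq_bigr => i _ do rewrite coefMn coefXn.
have [kn|nk] := ltnP k n.+1.
  rewrite (bigD1 (Ordinal kn)) //= eqxx big1 ?addr0 // => i ik.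
  rewrite (_ : (k == i) = false) ?mul0rn //; apply: contraNF ik => /eqP e.
  by apply/eqP/val_inj.
rewrite bin_small // big1 // => i _; rewrite (_ : (k == i) = false) ?mul0rn //.
by apply: gtn_eqF; apply: leq_trans (ltn_ord i) nk.
Qed.

(** * Counting the weights that are not l times a weight *)

Section Hits.

Variable m : nat.
Local Notation N := (m * m.+1).+1.

Definition triangle := [set u : 'I_m * 'I_m | (u.1 + u.2 < m)%N].

Definition hit (l : nat) (u : 'I_m * 'I_m) :=
  [exists v in triangle, l * weight m v.1 v.2 == weight m u.1 u.2 %[mod N]].

Lemma weight_modN_inj (u v : 'I_m * 'I_m) : u \in triangle -> v \in triangle ->
  weight m u.1 u.2 = weight m v.1 v.2 %[mod N] -> u = v.
Proof.
case: u v => [i j] [i' j']; rewrite !inE /= => u_tri v_tri.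
have /andP[_ uN] := weight_bounds u_tri; have /andP[_ vN] := weight_bounds v_tri.
rewrite !modn_small // => /(weight_inj u_tri v_tri)[ii jj].
by congr pair; apply: ord_inj.
Qed.

Lemma hit_mod l l' : l = l' %[mod N] -> hit l =1 hit l'.
Proof. by move=> e u; apply: eq_existsb => v; rewrite -modnMml e modnMml. Qed.

(** If l times the weight of v is the weight of u, then l' times the weight of u is the weight of v.
    So u maps to an element hit under l', injectively because v determines u. *)
Lemma card_hit_le l l' : l * l' = 1 %[mod N] ->
  (#|[set u in triangle | hit l u]| <= #|[set u in triangle | hit l' u]|)%N.
Proof.
move=> ll'.
pose f (u : 'I_m * 'I_m) := odflt u [pick v in triangle |
  l * weight m v.1 v.2 == weight m u.1 u.2 %[mod N]].
have fP u : u \in [set u in triangle | hit l u] -> f u \in triangle /\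
    l * weight m (f u).1 (f u).2 = weight m u.1 u.2 %[mod N].
  rewrite inE /f => /andP[_ /exists_inP[v v_tri e]].
  case: pickP => [v' /andP[v'_tri /eqP e'] //|/(_ v)].
  by rewrite v_tri e.
rewrite -(card_in_imset (f := f)); last first.
  move=> u v uA vA; have [_ eu] := fP u uA; have [_ ev] := fP v vA.
  move=> e; rewrite e in eu; move: uA vA; rewrite !inE => /andP[u_tri _] /andP[v_tri _].
  by apply: weight_modN_inj; rewrite ?inE // -eu -ev.
apply: subset_leq_card; apply/subsetP => _ /imsetP[u uA ->].
have [fu_tri e] := fP u uA; rewrite inE fu_tri /=; apply/exists_inP; exists u.
  by move: uA; rewrite inE => /andP[].
apply/eqP; rewrite -modnMmr -e modnMmr mulnA -modnMml [(l' * l)%N]mulnC ll'.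
by rewrite modnMml mul1n.
Qed.

Lemma card_Nhit_eq l l' : l * l' = 1 %[mod N] ->
  #|[set u in triangle | ~~ hit l u]| = #|[set u in triangle | ~~ hit l' u]|.
Proof.
move=> ll'; have split_card k :
    (#|[set u in triangle | hit k u]| + #|[set u in triangle | ~~ hit k u]| = #|triangle|)%N.
  rewrite -(cardsID [set u | hit k u] triangle); congr (_ + _)%N; apply: eq_card => u.
    by rewrite !inE.
  by rewrite !inE andbC.
have e := split_card l; rewrite -(split_card l') in e.
have h : #|[set u in triangle | hit l u]| = #|[set u in triangle | hit l' u]|.
  by apply/eqP; rewrite eqn_leq !card_hit_le // mulnC.
by move: e; rewrite h => /addnI.
Qed.

End Hits.

(** * Monomial forms expressed through dx *)

Section CartierKernel.

Variables (m : nat) (K : closedFieldType) (H : hurwitzField m.+1 K).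
Local Notation N := (m * m.+1).+1.
Local Notation F := (hurwitz_field H).
Local Notation iota := (hurwitz_iota H).
Local Notation S := (hurwitz_S H).
Local Notation T := (hurwitz_T H).
Local Notation x := (kx H).
Local Notation xp := (ev1 iota x).
Local Notation mono := (@monomial m K H).

Variables (D : F -> F^o) (hD : hamiltonian D).
Variables (l : nat) (l_prime : prime l) (charK : l \in [pchar K]).
Hypothesis lN : coprime l N.

Let S0 : S != 0 := hurwitz_S_neq0 H.
Let T0 : T != 0 := hurwitz_T_neq0 H.
Let l_gt0 : (0 < l)%N := prime_gt0 l_prime.
Local Notation frob := (pFrobenius_aut (charF H charK)).

(** Distinct weights are distinct orders at the origin. The index map g is constrained only where c
    is nonzero, so that the lemma applies both to a basis and to images that exist for hit indices
    alone. *)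
Lemma monomial_free (J : finType) (g : J -> 'I_m * 'I_m) (c : J -> K) :
  (forall j, c j != 0 -> g j \in triangle m) ->
  (forall j k, c j != 0 -> c k != 0 -> g j = g k -> j = k) ->
  \sum_j iota (c j) * mono (g j) = 0 -> forall j, c j = 0.
Proof.
move=> g_tri g_inj sum0 j; have H0 : (0 : K) ^+ m.+1 * 0 + 0 ^+ m.+1 + 0 = 0.
  by rewrite mulr0 expr0n /= !addr0.
have [v [vP vS vT vc _]] := vertex1 H.
have mono0 u : mono u != 0 by rewrite mulf_neq0 ?expf_neq0.
have v_mono u : v (mono u) + 1 = (weight m u.1 u.2)%:Z.
  rewrite /monomial (val_mul vP) ?expf_neq0 // !(valX vP) // vS vT.
  by rewrite -(mulr_natr _ u.1) -(mulr_natr _ u.2) !natz /weight; clear; lia.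
have z0 k : (iota (c k) * mono (g k) != 0) = (c k != 0).
  by rewrite mulf_eq0 (negPf (mono0 _)) orbF fmorph_eq0.
have vz k : c k != 0 -> v (iota (c k) * mono (g k)) = v (mono (g k)).
  by move=> ck; rewrite (val_mul vP _ (mono0 _)) ?fmorph_eq0 // vc // add0r.
have v_inj k k' : iota (c k) * mono (g k) != 0 -> iota (c k') * mono (g k') != 0 ->
    v (iota (c k) * mono (g k)) = v (iota (c k') * mono (g k')) -> k = k'.
  rewrite !z0 => ck ck'; rewrite !vz // => e.
  apply: (g_inj) => //; apply: weight_modN_inj; try exact: g_tri.
  by congr (_ %% _)%N; have := v_mono (g k); rewrite e v_mono => -[].
have := val_sum_eq0 (regular1 H 0 0) (regularB H0) vP v_inj sum0 j.
by move/eqP; apply: contraTeq; rewrite z0.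
Qed.

(** The form of u is N^-1 M^l x^al (-1-x)^be dx, which the Cartier operator sends to a constant
    multiple of M dx. If u is hit, M dx is N times the form of v; if not, the polynomial has degree
    below l - 1 and the image is 0. *)
Definition cartier_data (u : 'I_m * 'I_m) (al be : nat) (M : F) :=
  [/\ (al < l)%N, (be < l)%N,
      mono u / D x = N%:R^-1 * M ^+ l * (x ^+ al * (T ^+ m.+1 / S) ^+ be),
      hit l u -> (l <= (al + be).+1)%N /\ exists v : 'I_m * 'I_m,
        [/\ v \in triangle m, l * weight m v.1 v.2 = weight m u.1 u.2 %[mod N] &
            M * (S ^+ m * (T ^+ m.+1 / S)) = mono v] &
      ~~ hit l u -> ((al + be).+1 < l)%N].

Lemma cartier_data_exists u : u \in triangle m -> exists al be M, cartier_data u al be M.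
Proof.
case: u => [i j]; rewrite inE /= => ij.
have [al [be [a [b ex]]]] := cartier_exponents_exist i j l_gt0 lN.
have [al_l be_l ei ej] := ex.
exists al, be, (S ^ a * T ^ b).
have B0 : T ^+ m.+1 / S != 0 by rewrite mulf_neq0 ?invr_eq0 ?expf_neq0.
have Nn0 := NF_neq0 H l_prime charK lN.
have eM : mono (i, j) = (S ^ a * T ^ b) ^+ l * (x ^+ al * (T ^+ m.+1 / S) ^+ be) *
    (S ^+ m * (T ^+ m.+1 / S)).
  have -> : (S ^ a * T ^ b) ^+ l * (x ^+ al * (T ^+ m.+1 / S) ^+ be) *
      (S ^+ m * (T ^+ m.+1 / S)) =
      (S ^ a * T ^ b) ^+ l * (x ^ al%:Z * (T ^+ m.+1 / S) ^ be.+1%:Z * S ^+ m).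
    by rewrite -!exprnP [_ ^+ be.+1]exprSr; ring.
  rewrite kx_laurent exprMn !exprnP !exprz_exp mulrACA -!expfzDr // /monomial /= !exprnP.
  by congr (_ ^ _ * _ ^ _); lia.
split=> //.
- rewrite (D_kx hD) eM; have B0' := mulf_neq0 (expf_neq0 m S0) B0.
  by rewrite -[RHS]mulrA invfM mulrACA mulfV // mulr1 mulrC.
- move=> /exists_inP[v v_tri /eqP e]; rewrite inE in v_tri.
  have le : (l <= (al + be).+1)%N := cartier_no_image ij ex lN v_tri e.
  split=> //; have [i' [j' [ij' ei' ej' e']]] := cartier_image ij ex le.
  have i'm : (i' < m)%N by apply: leq_ltn_trans ij'; apply: leq_addr.
  have j'm : (j' < m)%N by apply: leq_ltn_trans ij'; apply: leq_addl.
  exists (Ordinal i'm, Ordinal j'm); rewrite inE; split=> //.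
  rewrite /monomial /= [S ^+ m * _]mulrC -[X in _ * (X * _)]mul1r -[X in X * _ * _](expr0z x).
  rewrite -[X in _ * X * _]expr1z kx_laurent mulrACA -!expfzDr // !exprnP.
  by congr (_ ^ _ * _ ^ _); lia.
- apply: contraR; rewrite -leqNgt => le; apply/exists_inP.
  have [i' [j' [ij' _ _ e']]] := cartier_image ij ex le.
  have i'm : (i' < m)%N by apply: leq_ltn_trans ij'; apply: leq_addr.
  have j'm : (j' < m)%N by apply: leq_ltn_trans ij'; apply: leq_addl.
  by exists (Ordinal i'm, Ordinal j'm); rewrite ?inE //; apply/eqP.
Qed.

End CartierKernel.

(** * The kernel of the Cartier operator *)

Section KernelCriterion.

Variables (m : nat) (K : closedFieldType) (H : hurwitzField m.+1 K).
Local Notation N := (m * m.+1).+1.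
Local Notation F := (hurwitz_field H).
Local Notation iota := (hurwitz_iota H).
Local Notation S := (hurwitz_S H).
Local Notation T := (hurwitz_T H).
Local Notation x := (kx H).
Local Notation xp := (ev1 iota x).
Local Notation mono := (@monomial m K H).

Variables (D : F -> F^o) (hD : hamiltonian D).
Variables (l : nat) (l_prime : prime l) (charK : l \in [pchar K]).
Hypothesis lN : coprime l N.

Let l_gt0 : (0 < l)%N := prime_gt0 l_prime.
Let l1E : l.-1.+1 = l := prednK l_gt0.
Let Dx0 : D x != 0 := D_kx_neq0 hD l_prime charK lN.
Local Notation frob := (pFrobenius_aut (charF H charK)).
Local Notation dx := (der_kx D).
Let dx_der : derivation iota dx := dx_derivation hD.

Definition cartier_poly al be : {poly K} := 'X^al * (-1 - 'X) ^+ be.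

Lemma cartier_polyE al be : xp (cartier_poly al be) = x ^+ al * (T ^+ m.+1 / S) ^+ be.
Proof.
rewrite rmorphM !rmorphXn rmorphB rmorphN rmorph1 /= ev1X; congr (_ * _ ^+ _).
by rewrite -opprD kx_add1 opprK.
Qed.

Lemma size_cartier_poly al be : (size (cartier_poly al be) <= (al + be).+1)%N.
Proof.
apply: leq_trans (size_polyMleq _ _) _; rewrite size_polyXn addSn /= -addnS leq_add2l.
apply: leq_trans (size_poly_exp_leq _ _) _; rewrite -opprD size_polyN addrC.
by rewrite size_XaddC mul1n.
Qed.

(** Up to sign this is the binomial coefficient of be over l - 1 - al, which is prime to l because
    be < l. *)
Lemma coef_cartier_poly al be : (al < l)%N -> (be < l)%N -> (l <= (al + be).+1)%N ->
  (cartier_poly al be)`_l.-1 != 0.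
Proof.
move=> al_l be_l le; rewrite coefXnM ltnNge (_ : (al <= l.-1)%N); last by lia.
rewrite /= -opprD -mulN1r exprMn -polyC1 -polyCN -rmorphXn /= coefCM polyC1 coef_exp_1addX.
rewrite mulf_neq0 ?expf_neq0 ?oppr_eq0 ?oner_eq0 // -(dvdn_pcharf charK).
by apply: prime_Ndvd_bin => //; lia.
Qed.

Lemma D_frob y : D (frob y) = 0.
Proof.
have := dx_frob hD l_prime charK y; rewrite /der_kx => /eqP.
by rewrite mulf_eq0 invr_eq0 (negPf Dx0) orbF => /eqP.
Qed.

Lemma iter_dx_term k y p : iter k dx (frob y * xp p) = frob y * xp p^`(k).
Proof.
elim: k p => [|k IH] p; first by rewrite derivn0.
rewrite iterS IH (der_mul dx_der) dx_frob // scaler0 addr0 (der_ev1 dx_der).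
by rewrite (dx_kx hD l_prime charK lN) derivnS /GRing.scale /= mulr1.
Qed.

Lemma iter_dx_sum k (I : finType) (P : pred I) (G : I -> F) :
  iter k dx (\sum_(i | P i) G i) = \sum_(i | P i) iter k dx (G i).
Proof. by elim: k => [|k IH] //=; rewrite IH (der_sum dx_der). Qed.

(** Once the term with t^(l-1) is gone, the others integrate one by one: l-th powers are constants
    for D, and i + 1 is invertible for i < l - 1. *)
Lemma cartier0_exact w : cartier iota D l w 0 -> exists z, w = D z.
Proof.
move=> [t [y [_ -> y0]]]; have [dD _ _] := hD.
exists (\sum_(i < l.-1) frob (y i) * (t ^+ i.+1 * iota (i.+1%:R^-1))).
rewrite (der_sum dD) -[in LHS]l1E big_ord_recr /= scalerDl.
have -> : (y l.-1 ^+ l.-1.+1 * t ^+ l.-1) *: D t = 0.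
  by rewrite exprSr -mulrA [y _ * _]mulrC mulrA -scalerA -y0 scaler0.
rewrite l1E addr0 scaler_suml; apply: eq_bigr => i _.
rewrite (der_mul dD) D_frob scaler0 addr0 (der_mul dD) (der_const dD) scaler0 add0r.
rewrite (der_exp dD) !scalerA frobE; congr (_ *: _).
have i0 : i.+1%:R != 0 :> F.
  rewrite -(dvdn_pcharf (charF H charK)) gtnNdvd //.
  by have := ltn_ord i; lia.
by rewrite fmorphV rmorph_nat -mulrA mulKf.
Qed.

Lemma cartier0_iter_dx w : cartier iota D l w 0 -> iter l.-1 dx (w / D x : F) = 0.
Proof.
move=> /cartier0_exact[z ->]; rewrite -[_ / _]/(dx z) -iterSr l1E.
exact: iter_dx_eq0.
Qed.

Variable dat : 'I_m * 'I_m -> nat * nat * F.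
Hypothesis datP : forall u, u \in triangle m ->
  cartier_data D l u (dat u).1.1 (dat u).1.2 (dat u).2.

Local Notation al u := (dat u).1.1.
Local Notation be u := (dat u).1.2.
Local Notation M u := (dat u).2.

(* A form killed by the Cartier operator is exact, hence killed by dx^(l-1),
   which extracts the coefficient of x^(l-1). *)
Lemma cartier0_coef (c : 'I_m * 'I_m -> K) :
  cartier iota D l (\sum_(u in triangle m) iota (c u) * mono u : F^o) 0 ->
  forall u, u \in triangle m -> hit l u -> c u = 0.
Proof.
move=> /cartier0_iter_dx e0 u u_tri u_hit.
have [root rootE] : exists root : K -> K, forall a, root a ^+ l = a.
  exists (fun a => sval (constructive_indefinite_description _ (rootK l_prime a))).
  by move=> a; case: constructive_indefinite_description.
(* ka u is the factor that (d/dx)^(l-1) produces from the polynomial of u. The l-th roots d u are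
   chosen so that the l-th power of the sum of d u M u is (d/dx)^(l-1) of the whole form, hence
   0. *)
pose ka u := (cartier_poly (al u) (be u))`_l.-1 * ((l.-1)`!)%:R.
pose d u := if (u \in triangle m) && hit l u then root (c u / N%:R * ka u) else 0.
have ka0 v : v \in triangle m -> hit l v -> ka v != 0.
  move=> /datP[al_l be_l _ hh _] /hh[le _].
  rewrite mulf_neq0 ?coef_cartier_poly // -(dvdn_pcharf charK).
  by rewrite prime_Ndvd_fact // l1E.
have [tgt tgtP] : exists tgt : 'I_m * 'I_m -> 'I_m * 'I_m,
    forall v, v \in triangle m -> hit l v ->
    [/\ tgt v \in triangle m,
        l * weight m (tgt v).1 (tgt v).2 = weight m v.1 v.2 %[mod N] &
        M v * (S ^+ m * (T ^+ m.+1 / S)) = mono (tgt v)].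
  have ex v : exists w, v \in triangle m -> hit l v ->
    [/\ w \in triangle m,
        l * weight m w.1 w.2 = weight m v.1 v.2 %[mod N] &
        M v * (S ^+ m * (T ^+ m.+1 / S)) = mono w].
    have [v_ok|] := boolP ((v \in triangle m) && hit l v); last first.
      by move=> /negP nv; exists v => v1 v2; case: nv; rewrite v1.
    have /andP[v_tri v_hit] := v_ok; have [_ _ _ hh _] := datP v_tri.
    by have [_ [w hw]] := hh v_hit; exists w.
  exists (fun v => sval (constructive_indefinite_description _ (ex v))).
  by move=> v; case: constructive_indefinite_description.
have d_hit v : d v != 0 -> (v \in triangle m) /\ hit l v.
  by rewrite /d; case: ifP => [/andP[]//|]; rewrite eqxx.
have sumM : \sum_v iota (d v) * M v = 0.
  apply/eqP; rewrite -(fmorph_eq0 frob) raddf_sum -[X in _ == X]e0 mulr_suml iter_dx_sum.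
  rewrite [X in _ == X]big_mkcond /=; apply/eqP/eq_bigr => v _.
  case: ifP => [v_tri|v_tri]; last by rewrite /d v_tri rmorph0 mul0r rmorph0.
  have [al_l be_l eM _ Nh] := datP v_tri.
  have [r0 er] : exists r0, r0 ^+ l = c v / N%:R by exists (root (c v / N%:R)).
  have -> : iota (c v) * mono v / D x =
      frob (iota r0 * M v) * xp (cartier_poly (al v) (be v)).
    rewrite -mulrA eM cartier_polyE rmorphM /= !frobE -rmorphXn /= er fmorph_div rmorph_nat.
    by rewrite !mulrA.
  rewrite iter_dx_term derivn_pchar //; last first.
    by apply: leq_trans (size_cartier_poly _ _) _; lia.
  rewrite ev1C -mulr_natr -/(ka v) /d v_tri /=.
  case: ifPn => v_hit.
    rewrite !rmorphM /= !frobE -!rmorphXn /= rootE er rmorphM /= mulrAC.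
    by congr (_ * _); rewrite /ka rmorphM.
  (* For u that is not hit the polynomial has degree below l - 1, so both sides vanish. *)
  rewrite rmorph0 mul0r rmorph0 /ka nth_default ?mul0r ?rmorph0 ?mulr0 //.
  by apply: leq_trans (size_cartier_poly _ _) _; have := Nh v_hit; lia.
(* After multiplication by S^m (T^(m+1) / S) the M v become monomials of the triangle, distinct for
   distinct hit v, and these are independent. *)
have du : d u = 0.
  apply: (@monomial_free m K H _ tgt d) => [v /d_hit[v1 v2]|v w /d_hit[v1 v2] /d_hit[w1 w2] e|].
  - by have [] := tgtP v v1 v2.
  - apply: weight_modN_inj => //; have [_ <- _] := tgtP v v1 v2.
    by have [_ <- _] := tgtP w w1 w2; rewrite e.
  - transitivity ((\sum_v iota (d v) * M v) * (S ^+ m * (T ^+ m.+1 / S))).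
      rewrite mulr_suml; apply: eq_bigr => v _.
      have [->|/d_hit[v1 v2]] := eqVneq (d v) 0; first by rewrite rmorph0 !mul0r.
      by have [_ _ <-] := tgtP v v1 v2; rewrite mulrA.
    by rewrite sumM mul0r.
have : root (c u / N%:R * ka u) ^+ l = 0.
  by move: du; rewrite /d u_tri u_hit /= => ->; rewrite expr0n gtn_eqF.
rewrite rootE => /eqP; rewrite mulf_eq0 (negPf (ka0 _ u_tri u_hit)) orbF mulf_eq0.
by rewrite invr_eq0 (negPf (N_neq0 l_prime charK lN)) orbF => /eqP.
Qed.

(** The expansion in t = x is written down: the coefficients from K have l-th roots, and the
    remaining polynomials have degree below l - 1, so the entry at x^(l-1) is 0. *)
Lemma cartier0_of_coef (c : 'I_m * 'I_m -> K) :
  (forall u, u \in triangle m -> hit l u -> c u = 0) ->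
  cartier iota D l (\sum_(u in triangle m) iota (c u) * mono u : F^o) 0.
Proof.
move=> c_hit.
have [root rootE] : exists root : K -> K, forall a, root a ^+ l = a.
  exists (fun a => sval (constructive_indefinite_description _ (rootK l_prime a))).
  by move=> a; case: constructive_indefinite_description.
pose q u := cartier_poly (al u) (be u).
pose y r := \sum_(u in triangle m) iota (root (c u / N%:R * (q u)`_r)) * M u.
have yE r : y r ^+ l = \sum_(u in triangle m) iota (c u / N%:R * (q u)`_r) * M u ^+ l.
  rewrite -(frobE charK) raddf_sum; apply: eq_bigr => u _.
  by rewrite /= frobE exprMn -rmorphXn /= rootE.
exists x, y; split; first exact: (kx_separating hD l_prime charK lN).
  under [X in _ = X *: _]eq_bigr => r _ do rewrite yE mulr_suml.
  rewrite exchange_big /= scaler_suml; apply: eq_bigr => u u_tri.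
  have [al_l be_l eM _ Nh] := datP u_tri.
  have [->|cu0] := eqVneq (c u) 0.
    rewrite rmorph0 mul0r big1 ?scale0r // => r _.
    by rewrite !mul0r rmorph0 !mul0r.
  have Nhit : ~~ hit l u by apply: contraNN cu0 => /(c_hit u u_tri) ->.
  have sq : (size (q u) <= l)%N.
    by apply: leq_trans (size_cartier_poly _ _) _; apply: ltnW; apply: Nh.
  have xq : xp (q u) = \sum_(r < l) iota (q u)`_r * x ^+ r.
    rewrite ev1E (horner_coef_wide _ (n := l)).
      by apply: eq_bigr => r _; rewrite coef_map.
    exact: leq_trans (size_poly _ _) sq.
  have -> : \sum_(r < l) iota (c u / N%:R * (q u)`_r) * M u ^+ l * x ^+ r =
      iota (c u) * (mono u / D x).
    rewrite eM -cartier_polyE -/(q u) xq !mulr_sumr; apply: eq_bigr => r _.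
    by rewrite !rmorphM fmorphV rmorph_nat; ring.
  by rewrite /GRing.scale /= mulrA divfK.
rewrite /y big1 ?scale0r // => u u_tri; have [_ _ _ _ Nh] := datP u_tri.
have root0 : root 0 = 0.
  by apply/eqP; have /eqP := rootE 0; rewrite expf_eq0 => /andP[].
have [u_hit|/Nh lt] := boolP (hit l u).
  by rewrite c_hit // !mul0r root0 rmorph0 mul0r.
rewrite /q nth_default ?mulr0 ?root0 ?rmorph0 ?mul0r //.
by apply: leq_trans (size_cartier_poly _ _) _; lia.
Qed.

End KernelCriterion.

(** * The a-number as a count of weights *)

Section ANumber.

Variables (m : nat) (K : closedFieldType) (H : hurwitzField m.+1 K).
Local Notation N := (m * m.+1).+1.
Local Notation F := (hurwitz_field H).
Local Notation iota := (hurwitz_iota H).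
Local Notation mono := (@monomial m K H).

Variables (l : nat) (l_prime : prime l) (charK : l \in [pchar K]).
Hypothesis lN : coprime l N.

Theorem hurwitz_a_number :
  is_a_number iota l #|[set u in triangle m | ~~ hit l u]|.
Proof.
have N0 := N_neq0 l_prime charK lN.
have [D hD] := hamiltonian_exists H.
have [dat datP] : exists dat : 'I_m * 'I_m -> nat * nat * F,
    forall u, u \in triangle m -> cartier_data D l u (dat u).1.1 (dat u).1.2 (dat u).2.
  have ex u : exists d : nat * nat * F,
      u \in triangle m -> cartier_data D l u d.1.1 d.1.2 d.2.
    have [u_tri|nu] := boolP (u \in triangle m); last by exists (0%N, 0%N, 0).
    have [al [be [M h]]] := cartier_data_exists hD l_prime charK lN u_tri.
    by exists (al, be, M).
  exists (fun u => sval (constructive_indefinite_description _ (ex u))).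
  by move=> u; case: constructive_indefinite_description.
exists F^o, D; split; first exact: hamiltonian_kaehler.
set A := [set u in triangle m | ~~ hit l u].
exists (fun i : 'I_#|A| => mono (enum_val i) : F^o); split.
- move=> i; have := enum_valP i; rewrite inE => /andP[u_tri u_Nhit].
  set u := enum_val i in u_tri u_Nhit *; split.
    by apply: monomial_holomorphic => //; move: u_tri; rewrite inE.
  have -> : mono u = \sum_(v in triangle m) iota (if v == u then 1 else 0) * mono v.
    rewrite (bigD1 u) //= eqxx rmorph1 mul1r big1 ?addr0 // => v /andP[_ /negPf ->].
    by rewrite rmorph0 mul0r.
  apply: (cartier0_of_coef hD l_prime charK lN datP) => v _ v_hit.
  by case: eqP => // vu; rewrite -vu v_hit in u_Nhit.
- move=> w [w_hol w_ker]; have [c ew] := holomorphic_span N0 hD w_hol.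
  have {}ew : w = \sum_(u in triangle m) iota (c u) * mono u.
    by rewrite ew; apply: eq_bigl => u; rewrite inE.
  rewrite ew in w_ker.
  have c_hit := cartier0_coef hD l_prime charK lN datP w_ker.
  exists (fun i => c (enum_val i)).
  rewrite -(big_enum_val (fun u => iota (c u) *: (mono u : F^o))) ew.
  rewrite [RHS](_ : _ = \sum_(u in triangle m | ~~ hit l u) iota (c u) * mono u); last first.
    by apply: eq_bigl => u; rewrite inE.
  rewrite (bigID (hit l)) /= big1 ?add0r // => u /andP[u_tri u_hit].
  by rewrite c_hit // rmorph0 mul0r.
- move=> c e0; apply: (@monomial_free m K H _ (fun i : 'I_#|A| => enum_val i) c).
  + by move=> i _; have := enum_valP i; rewrite inE => /andP[].
  + by move=> i j _ _ /enum_val_inj.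
  + exact: e0.
Qed.

End ANumber.

Theorem corollary5p12 (n N p pbar ptilde pinv : nat)
  (hn : (0 < n)%N) (hN : N = (n ^ 2 - n + 1)%N)
  (p_prime : prime p) (pbar_prime : prime pbar) (ptilde_prime : prime ptilde)
  (hp : ~~ (p %| N)%N) (hpbar : ~~ (pbar %| N)%N) (hptilde : ~~ (ptilde %| N)%N)
  (hpbar_p : (pbar = p %[mod N])%N)
  (hpinv : (p * pinv = 1 %[mod N])%N)
  (hptilde_p : (ptilde = pinv %[mod N])%N)
  (K Kbar Ktilde : closedFieldType)
  (charK : p \in [pchar K]%R) (charKbar : pbar \in [pchar Kbar]%R)
  (charKtilde : ptilde \in [pchar Ktilde]%R)
  (H : hurwitzField n K) (Hbar : hurwitzField n Kbar)
  (Htilde : hurwitzField n Ktilde) :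
  exists a : nat,
    [/\ is_a_number (hurwitz_iota H) p a,
        is_a_number (hurwitz_iota Hbar) pbar a &
        is_a_number (hurwitz_iota Htilde) ptilde a].
Proof.
case: n hn hN H Hbar Htilde => // m _ hN H Hbar Htilde.
have {hN}eN : N = (m * m.+1).+1.
  by rewrite hN addn1 -[X in (_ - X)%N]muln1 -mulnBr subn1 mulnC.
rewrite {N}eN in hp hpbar hptilde hpbar_p hpinv hptilde_p *.
exists #|[set u in triangle m | ~~ hit p u]|; split.
- by apply: hurwitz_a_number; rewrite ?prime_coprime.
- have -> : [set u in triangle m | ~~ hit p u] = [set u in triangle m | ~~ hit pbar u].
    by apply/setP => u; rewrite !inE (hit_mod hpbar_p).
  by apply: hurwitz_a_number; rewrite ?prime_coprime.
- have pp : (p * ptilde = 1 %[mod (m * m.+1).+1])%N.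
    by rewrite -modnMmr hptilde_p modnMmr.
  rewrite (card_Nhit_eq pp).
  by apply: hurwitz_a_number; rewrite ?prime_coprime.
Qed.
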